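(* Let $\{X_k\}_{k\ge 1}$ be i.i.d. random variables distributed uniformly on the open unit disc $\mathbb{D}\subset\mathbb{C}$, let $P_n(z)=\prod_{k=1}^n (z-X_k)$, let $\Lambda_n=\{z\in\mathbb{C}: |P_n(z)|<1\}$, and let $\mathscr{C}(\Lambda_n)$ be the number of connected components of $\Lambda_n$. Then $$\lim_{n\to\infty}\frac{\mathbb{E}[\mathscr{C}(\Lambda_n)]}{\sqrt{n}}=\sqrt{\frac{\zeta(2)-1}{\pi}}.$$
   Context: $\zeta$ denotes the Riemann zeta function, so $\zeta(2)=\pi^2/6$. *)

(* Defs.v *)
From HB Require Import structures.
From mathcomp Require Import all_boot all_order all_algebra finmap.
From mathcomp Require Import all_classical all_reals all_analysis.
From mathcomp Require Export complex.

Set Implicit Arguments.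
Unset Strict Implicit.
Unset Printing Implicit Defensive.

Import Order.TTheory GRing.Theory Num.Theory.
Import numFieldNormedType.Exports.

Local Open Scope classical_set_scope.
Local Open Scope ring_scope.
Local Open Scope complex_scope.
Local Open Scope ereal_scope.

(* R[i] packed as a numClosedFieldType, so that it receives the topology which
   the library puts on every such field: the one given by its norm. *)
Definition Cplx (R : realType) : numClosedFieldType :=
  Num.ClosedField.clone R[i] _.

(* The library puts no measurable structure on the complex numbers; this is
   the Borel sigma-algebra. *)
Definition borelC (R : realType) := g_sigma_algebraType (@open (Cplx R)).

(* Two-dimensional Lebesgue measure, transported along R * R ~ R[i]. *)
Definition area (R : realType) (A : set (Cplx R)) : \bar R :=
  (lebesgue_measure \x lebesgue_measure)
    ((fun p : R * R => (p.1 +i* p.2)%C) @^-1` A).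

(* Both the norm and the order are those of R[i]: `|z| is a nonnegative real
   embedded in R[i], and two reals embedded in R[i] compare as in R. *)
Definition unit_disc (R : realType) : set (Cplx R) := [set z | (`|z| < 1)%R].

Definition uniformly_distributed_on (R : realType) d (T : measurableType d)
    (P : probability T R) (X : {RV P >-> borelC R}) (D : set (Cplx R)) : Prop :=
  forall A : set (borelC R), measurable A ->
    distribution P X A = area (A `&` D) / area D.

Definition mutually_independent (R : realType) d (T : measurableType d)
    d' (U : measurableType d') (P : probability T R)
    (X : nat -> {RV P >-> U}) : Prop :=
  forall (J : {fset nat}) (A : nat -> set U),
    (forall k, k \in J -> measurable (A k)) ->
    P (\bigcap_(k in [set` J]) (X k @^-1` A k)) =
    \big[*%E/1]_(k <- J) P (X k @^-1` A k).

Definition root_poly (C : comNzRingType) (x : nat -> C) (n : nat) : {poly C} :=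
  (\prod_(k < n) ('X - (x k)%:P))%R.

Definition lemniscate (R : realType) (p : {poly Cplx R}) : set (Cplx R) :=
  [set z | (`|p.[z]| < 1)%R].

(* [counting] is +oo on infinite sets. *)
Definition num_components (R : realType) (T : topologicalType) (A : set T) :
    \bar R :=
  counting (connected_component A @` A).

(* The Dirichlet series of the Riemann zeta function, meaningful for s > 1. *)
Definition zeta (R : realType) (s : R) : R :=
  limn (series (fun k : nat => (k.+1%:R `^ (- s))%R)).

(* Main.v *)
Require Import Defs.
From HB Require Import structures.
From mathcomp Require Import all_boot all_order all_algebra finmap.
From mathcomp Require Import all_classical all_reals all_analysis.
From mathcomp Require Import measurable_realfun ring lra zify.

Set Implicit Arguments.
Unset Strict Implicit.
Unset Printing Implicit Defensive.

Import Order.TTheory GRing.Theory Num.Theory.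
Import numFieldNormedType.Exports.

Local Open Scope classical_set_scope.
Local Open Scope ring_scope.
Local Open Scope ereal_scope.

(** Every component of [|P_n| < 1] contains a root, since the modulus of a
    polynomial has no nonzero local minimum ([component_root]); so the number of
    components is, up to lower order, the number of roots that have a component
    to themselves. Let [x] be one root, at depth [tau x = (1 - |x|^2) / 2], and
    let [N = n - 1] be the number of the others. The logarithm of the product of
    the distances from [x] to the other roots is a sum of [N] independent terms
    [ln |x - X_j|], of mean [- tau x] ([Rintegral_ln_dst]). Close to the unit
    circle, its fluctuations are those of the sum [Z] of [N] independent copies
    of [ln |1 - X|]: replacing [x] by its radial projection changes a term by a
    random variable of small second moment ([disc_law_ln_dst_sqr]), and on the
    circle the law of a term does not depend on the point. Hence [x] is isolated
    essentially when [Z >= N tau x]. As [tau x] is uniform on the interval from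
    [0] to [1/2], this has probability about [2 E Z^+ / N = E |Z| / N], which is
    [sigma sqrt (2 / (pi N))] by the central limit theorem. Multiplying by [n]
    gives the mean number of components.

    The variance [sigma ^ 2] of [ln |1 - X|] is computed by Parseval's identity
    ([Rintegral_ln_dst_sqr]): under a rotation invariant law the powers of [X]
    are orthogonal, so that it is the sum of [E |X|^(2k) / (2 k^2)], that is of
    [1 / (2 k^2 (k+1))], which is [(zeta 2 - 1) / 2]. The limit is therefore
    [sigma sqrt (2 / pi) = sqrt ((zeta 2 - 1) / pi)].

    Only the mean of [|Z|] matters, not its whole law, so a test function close
    to [x + |x|] suffices. Lindeberg's replacement ([lindeberg]) exchanges the
    terms of [Z] for fair coin tosses of the same variance, and for these the
    mean modulus of the walk is an explicit multiple of a central binomial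
    coefficient ([iter_coin_normr]), estimated by Wallis' product
    ([return_prob_bounds]).

    For the upper bound ([num_components_le], [upper_event]), a root joined to
    the origin by a segment inside the lemniscate is in the component of the
    origin. If the segment leaves the lemniscate, the sum of the logarithms is
    nearly nonnegative at one of [O(n^(1/4))] points of a net whose depths grow
    quadratically ([net_exists]). Unless [Z >= (1 - eps) N tau x] approximately,
    a sum of differences of logarithms then deviates from its mean. Chebyshev's
    inequality and the small probability that [x] is at most that deep bound the
    probability of each such event by [O(1 / n)].

    For the lower bound ([num_components_ge], [lower_event]), a large product of
    distances from [x] and no root within [1 / n] make a tiny circle around [x]
    lie outside the lemniscate ([isolating_circle]). Only roots of depth at most
    [M / sqrt N] are retained, so that the replacement of [x] by its projection
    is uniformly cheap; the loss vanishes as [M] grows, because [Z] has second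
    moment [N sigma ^ 2]. *)

(** * Lebesgue measure on the plane *)

Notation plane R := (measurableTypeR R * measurableTypeR R)%type.
Notation leb2 := (lebesgue_measure \x lebesgue_measure).

Lemma measurable_preimage d d' (T : measurableType d) (T' : measurableType d')
    (f : T -> T') B :
  measurable_fun setT f -> measurable B -> measurable (f @^-1` B).
Proof. by move=> mf mB; rewrite -[X in measurable X]setTI; exact: mf. Qed.

Section plane_measure.
Context {R : realType}.
Implicit Types (A : set (measurableTypeR R)) (B : set (plane R)).
Notation leb := (@lebesgue_measure R).

Lemma lebesgue_measure_translation (c : R) A : measurable A ->
  leb ((fun x => x + c)%R @^-1` A) = leb A.
Proof.
move=> mA.
have mf : measurable_fun [set: measurableTypeR R]
    ((fun x => x + c)%R : _ -> measurableTypeR R).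
  by apply: measurable_funD.
rewrite -[LHS]/(pushforward leb ((fun x => x + c)%R : _ -> measurableTypeR R) A).
apply/esym/lebesgue_measure_unique => //= _ [[a b]] _ <-.
rewrite /pushforward.
rewrite (_ : _ @^-1` _ = `]a - c, b - c]%classic)%R; last first.
  by apply/seteqP; split=> x /=; rewrite !in_itv/= ltrBlDr lerBrDr.
rewrite !lebesgue_measure_itv/= !lte_fin ltrD2r; case: ifP => // _.
by rewrite -!EFinB; congr EFin; ring.
Qed.

Lemma lebesgue_measure_dilation (r : R) A : (0 < r)%R -> measurable A ->
  leb ((fun x => r * x)%R @^-1` A) = r^-1%:E * leb A.
Proof.
move=> r0 mA.
have mf : measurable_fun [set: measurableTypeR R]
    ((fun x => r * x)%R : _ -> measurableTypeR R).
  by apply: measurable_funM.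
have r0' : (0 <= r)%R by exact: ltW.
pose m : {measure set (measurableTypeR R) -> \bar R} := mscale (NngNum r0')
   (pushforward leb ((fun x => r * x)%R : _ -> measurableTypeR R)).
have -> : leb A = m mf A.
  apply: lebesgue_measure_unique => //= _ [[a b]] _ <-.
  rewrite /m /mscale/= /pushforward.
  rewrite (_ : _ @^-1` _ = `]a / r, b / r]%classic)%R; last first.
    apply/seteqP; split=> x /=; rewrite !in_itv/=;
    by rewrite ltr_pdivrMr// ler_pdivlMr// ![(x * r)%R]mulrC.
  rewrite !lebesgue_measure_itv/= !lte_fin ltr_pM2r ?invr_gt0//; case: ifP => // _.
    rewrite -EFinB -EFinM; congr EFin.
    by field; rewrite gt_eqF.
  by rewrite mule0.
by rewrite /m /mscale/= /pushforward muleA -EFinM mulVf ?gt_eqF// mul1e.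
Qed.

Lemma leb2_translation (a b : R) B : measurable B ->
  leb2 ((fun p => (p.1 + a, p.2 + b))%R @^-1` B) = leb2 B.
Proof.
move=> mB.
pose f : plane R -> plane R := fun p => (p.1 + a, p.2 + b)%R.
have mf : measurable_fun setT f.
  by apply: measurable_fun_pair; apply: measurable_funD.
rewrite -[LHS]/(pushforward leb2 f B).
apply/esym/product_measure_unique => //= A1 A2 mA1 mA2.
rewrite /pushforward (_ : f @^-1` _ =
  ((fun x => x + a)%R @^-1` A1) `*` ((fun x => x + b)%R @^-1` A2))//.
have mt c A : measurable A -> measurable ((fun x => x + c)%R @^-1` A).
  by apply: measurable_preimage; exact: measurable_funD.
rewrite product_measure1E//; [|exact: mt..].
by congr (_ * _); exact: lebesgue_measure_translation.
Qed.

Lemma leb2_dilation (r : R) B : (0 < r)%R -> measurable B ->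
  leb2 ((fun p => (r * p.1, r * p.2))%R @^-1` B) = (r^-1 ^+ 2)%:E * leb2 B.
Proof.
move=> r0 mB.
pose f : plane R -> plane R := fun p => (r * p.1, r * p.2)%R.
have mf : measurable_fun setT f.
  by apply: measurable_fun_pair; apply: measurable_funM.
have r0' : (0 <= r ^+ 2)%R by exact: sqr_ge0.
pose m : {measure set (plane R) -> \bar R} := mscale (NngNum r0')
   (pushforward leb2 f).
have mE D : m mf D = (r ^+ 2)%:E * leb2 (f @^-1` D) by [].
have -> : leb2 B = m mf B.
  apply: product_measure_unique => //= A1 A2 mA1 mA2.
  rewrite mE (_ : f @^-1` _ =
    ((fun x => r * x)%R @^-1` A1) `*` ((fun x => r * x)%R @^-1` A2))//.
  have mt A : measurable A -> measurable ((fun x => r * x)%R @^-1` A).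
    by apply: measurable_preimage; exact: measurable_funM.
  rewrite product_measure1E//; [|exact: mt..].
  have e1 A : measurable A ->
      lebesgue_measure ((fun x => r * x)%R @^-1` A) = r^-1%:E * leb A.
    exact: lebesgue_measure_dilation.
  rewrite [X in _ * (X * _)]e1// [X in _ * (_ * X)]e1//.
  rewrite muleACA [LHS]muleA.
  have -> : (r ^+ 2)%:E * (r^-1%:E * r^-1%:E) = 1 :> \bar R.
    by rewrite -!EFinM; congr EFin; field; rewrite gt_eqF.
  by rewrite mul1e.
rewrite mE muleA -EFinM.
rewrite (_ : r^-1 ^+ 2 * r ^+ 2 = 1)%R ?mul1e//.
by field; rewrite gt_eqF.
Qed.

Lemma leb2_swap B : measurable B ->
  leb2 ((fun p => (p.2, p.1)) @^-1` B) = leb2 B.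
Proof.
move=> mB.
pose f : plane R -> plane R := fun p => (p.2, p.1).
have mf : measurable_fun setT f by exact: measurable_fun_pair.
rewrite -[LHS]/(pushforward leb2 f B).
apply/esym/product_measure_unique => //= A1 A2 mA1 mA2.
rewrite /pushforward (_ : f @^-1` _ = A2 `*` A1); last first.
  by apply/seteqP; split=> [[x y]/= []|[x y]/= []].
by rewrite product_measure1E// muleC.
Qed.

Let shear (c : R) : plane R -> plane R := fun p => (p.1, p.2 + c * p.1)%R.

Let measurable_shear c : measurable_fun setT (shear c).
Proof.
apply: measurable_fun_pair => //; apply: measurable_funD => //.
exact: measurable_funM.
Qed.

(** By Fubini: a shear translates each vertical section. *)
Let leb2_shear (c : R) B : measurable B -> leb2 (shear c @^-1` B) = leb2 B.
Proof.
move=> mB; apply: eq_integral => x _ /=.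
have mBx : measurable (xsection B x) by exact: measurable_xsection.
apply: etrans (lebesgue_measure_translation (c * x) mBx).
by congr (lebesgue_measure _); apply/seteqP; split=> y /=; rewrite /xsection/= !inE.
Qed.

(** The rotation by the unit vector [(a, b)]. *)
Definition rotate (a b : R) : plane R -> plane R :=
  fun p => (a * p.1 - b * p.2, b * p.1 + a * p.2)%R.

Lemma measurable_rotate a b : measurable_fun setT (rotate a b).
Proof.
apply: measurable_fun_pair.
  by apply: measurable_funB; apply: measurable_funM.
by apply: measurable_funD; apply: measurable_funM.
Qed.

(** A rotation by [theta] other than a half turn is a product of three shears,
    horizontal, vertical and horizontal, of slopes [- tan (theta / 2)],
    [sin theta] and [- tan (theta / 2)]. *)
Let leb2_rotate_neq0 a b B : b != 0%R -> (a ^+ 2 + b ^+ 2 = 1)%R ->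
  measurable B -> leb2 (rotate a b @^-1` B) = leb2 B.
Proof.
move=> b0 ab1 mB.
pose swap : plane R -> plane R := fun p => (p.2, p.1).
have mswap : measurable_fun setT swap by exact: measurable_fun_pair.
pose t : R := (- ((1 - a) / b))%R.
have tb : (t * b = a - 1)%R by rewrite /t; field.
have ta : (t * (1 + a) = - b)%R.
  apply: (mulIf b0); rewrite mulrAC tb.
  by transitivity (a ^+ 2 - (a ^+ 2 + b ^+ 2))%R; [rewrite ab1; ring|ring].
have rotE p : rotate a b p = swap (shear t (swap (shear b (swap (shear t (swap p)))))).
  case: p => x y; rewrite /rotate /swap /shear/=; congr pair; apply/esym.
    transitivity (x * (1 + t * b) + y * (t * (1 + (1 + t * b))))%R; first by ring.
    by rewrite tb (addrC 1%R (a - 1)%R) subrK ta; ring.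
  transitivity (y * (1 + t * b) + x * b)%R; first by ring.
  by rewrite tb; ring.
have mS D : measurable D -> measurable (swap @^-1` D).
  exact: measurable_preimage.
have mH c D : measurable D -> measurable (shear c @^-1` D).
  exact: measurable_preimage.
pose B1 := swap @^-1` B; have mB1 : measurable B1 by exact: mS.
pose B2 := shear t @^-1` B1; have mB2 : measurable B2 by exact: mH.
pose B3 := swap @^-1` B2; have mB3 : measurable B3 by exact: mS.
pose B4 := shear b @^-1` B3; have mB4 : measurable B4 by exact: mH.
pose B5 := swap @^-1` B4; have mB5 : measurable B5 by exact: mS.
pose B6 := shear t @^-1` B5; have mB6 : measurable B6 by exact: mH.
have -> : rotate a b @^-1` B = swap @^-1` B6.
  by apply/funext => p; rewrite /preimage/= rotE.
transitivity (leb2 B6); first exact: leb2_swap.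
transitivity (leb2 B5); first exact: leb2_shear.
transitivity (leb2 B4); first exact: leb2_swap.
transitivity (leb2 B3); first exact: leb2_shear.
transitivity (leb2 B2); first exact: leb2_swap.
transitivity (leb2 B1); first exact: leb2_shear.
exact: leb2_swap.
Qed.

Lemma leb2_rotate a b B : (a ^+ 2 + b ^+ 2 = 1)%R ->
  measurable B -> leb2 (rotate a b @^-1` B) = leb2 B.
Proof.
move=> ab1 mB; have [b0|b0] := eqVneq b 0%R; last exact: leb2_rotate_neq0.
(* a half turn or the identity is a product of two quarter turns *)
have [i1 i2] : (0 ^+ 2 + 1 ^+ 2 = 1 :> R)%R /\ (0 ^+ 2 + a ^+ 2 = 1 :> R)%R.
  by move: ab1; rewrite b0 !expr0n/= addr0 !add0r expr1n.
have -> : rotate a b @^-1` B = rotate 0 1 @^-1` (rotate 0 (- a) @^-1` B).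
  rewrite -comp_preimage; congr (_ @^-1` B); apply/funext => -[x y].
  by rewrite /rotate/= b0; congr pair; ring.
have a0 : a != 0%R.
  by apply/eqP => a0; move: i2; rewrite a0 => /eqP; rewrite expr0n addr0 eq_sym oner_eq0.
rewrite !leb2_rotate_neq0 ?oner_eq0 ?oppr_eq0 ?sqrrN//.
by apply: measurable_preimage mB; exact: measurable_rotate.
Qed.

End plane_measure.

(** * The uniform law on the unit disc *)

Section disc_law.
Context {R : realType}.
Implicit Types (p z : plane R).

Definition sqn p : R := (p.1 ^+ 2 + p.2 ^+ 2)%R.
Definition nrm p : R := Num.sqrt (sqn p).
Definition dst z p : R := nrm (z.1 - p.1, z.2 - p.2)%R.

Lemma sqn_ge0 p : (0 <= sqn p)%R.
Proof. by rewrite addr_ge0 ?sqr_ge0. Qed.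

Lemma nrm_ge0 p : (0 <= nrm p)%R. Proof. exact: sqrtr_ge0. Qed.

Lemma dst_ge0 z p : (0 <= dst z p)%R. Proof. exact: nrm_ge0. Qed.

Lemma sqr_nrm p : (nrm p ^+ 2 = sqn p)%R.
Proof. by rewrite sqr_sqrtr// sqn_ge0. Qed.

Lemma nrm_eq0 p : (nrm p == 0)%R = (p == (0, 0)%R).
Proof.
case: p => x y; rewrite sqrtr_eq0 /sqn/= le_eqVlt ltNge addr_ge0 ?sqr_ge0// orbF.
by rewrite paddr_eq0 ?sqr_ge0// !sqrf_eq0.
Qed.

Lemma dst_eq0 z p : (dst z p == 0)%R = (p == z).
Proof.
rewrite [RHS]eq_sym; case: z p => a b [x y].
by rewrite nrm_eq0/= !xpair_eqE !subr_eq0.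
Qed.

Lemma nrmD p z : (nrm (p.1 + z.1, p.2 + z.2)%R <= nrm p + nrm z)%R.
Proof.
rewrite -(@ler_pXn2r _ 2)// ?nnegrE ?addr_ge0 ?nrm_ge0//.
rewrite sqrrD !sqr_nrm /sqn/=.
have CS : (p.1 * z.1 + p.2 * z.2 <= nrm p * nrm z)%R.
  apply: le_trans (ler_norm _) _.
  rewrite -(@ler_pXn2r _ 2)// ?nnegrE ?mulr_ge0 ?nrm_ge0//.
  rewrite exprMn !sqr_nrm /sqn real_normK ?num_real// -subr_ge0.
  rewrite [leRHS](_ : _ = (p.1 * z.2 - p.2 * z.1) ^+ 2)%R ?sqr_ge0//.
  by ring.
rewrite mulr2n; move: CS; set u := (nrm p * nrm z)%R; nra.
Qed.

Lemma nrmN p : nrm (- p.1, - p.2)%R = nrm p.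
Proof. by rewrite /nrm /sqn/= !sqrrN. Qed.

Lemma dstC z p : dst z p = dst p z.
Proof. by rewrite /dst -nrmN/=; congr nrm; congr pair; ring. Qed.

Lemma dst_triangle w z p : (dst z p <= dst z w + dst w p)%R.
Proof.
rewrite /dst; apply: le_trans (nrmD _ _) => /=.
by rewrite !subrKA.
Qed.

Lemma ler_dist_dst z w p : (`|dst z p - dst w p| <= dst z w)%R.
Proof.
rewrite ler_norml; apply/andP; split.
  rewrite lerBrDr addrC lerBlDr (dstC z w) addrC; exact: dst_triangle.
by rewrite lerBlDr dst_triangle.
Qed.

Lemma dst0p p : dst (0, 0)%R p = nrm p.
Proof. by rewrite /dst/= !sub0r nrmN. Qed.

Lemma measurable_sqn : measurable_fun setT sqn.
Proof. by apply: measurable_funD; apply: measurable_funX. Qed.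

Lemma measurable_sqrt d (T : measurableType d) (f : T -> R) :
  measurable_fun setT f -> measurable_fun setT (fun x => Num.sqrt (f x)).
Proof.
have ms : measurable_fun setT (@Num.sqrt R : measurableTypeR R -> measurableTypeR R).
  by apply: continuous_measurable_fun; exact: sqrt_continuous.
by move=> mf; exact: (measurableT_comp ms mf).
Qed.

Lemma measurable_nrm : measurable_fun setT nrm.
Proof. by apply: measurable_sqrt; exact: measurable_sqn. Qed.

Lemma measurable_inv_ge0 d (T : measurableType d) (f : T -> R) :
  (forall x, 0 <= f x)%R -> measurable_fun setT f ->
  measurable_fun setT (fun x => (f x)^-1)%R.
Proof.
move=> f0 mf.
have -> : (fun x => (f x)^-1)%R = (fun x => f x `^ (-1))%R.
  by apply/funext => x; rewrite powR_inv1.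
have mp : measurable_fun setT
    (fun x : measurableTypeR R => (x `^ (-1))%R : measurableTypeR R).
  exact: measurable_powR.
exact: (measurableT_comp mp mf).
Qed.

Lemma measurable_dst d (T : measurableType d) (f g : T -> plane R) :
  measurable_fun setT f -> measurable_fun setT g ->
  measurable_fun setT (fun x => dst (f x) (g x)).
Proof.
move=> mf mg; apply: (measurableT_comp measurable_nrm).
by apply: measurable_fun_pair; apply: measurable_funB;
  apply: measurableT_comp.
Qed.

Lemma measurable_ltr_set d (T : measurableType d) (f g : T -> R) :
  measurable_fun setT f -> measurable_fun setT g ->
  measurable [set x | (f x < g x)%R].
Proof.
move=> mf mg; have := @measurable_fun_ltr _ _ _ setT f g mf mg measurableT [set true].
rewrite setTI; apply => //.
Qed.

Lemma measurable_ler_set d (T : measurableType d) (f g : T -> R) :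
  measurable_fun setT f -> measurable_fun setT g ->
  measurable [set x | (f x <= g x)%R].
Proof.
move=> mf mg; have := @measurable_fun_ler _ _ _ setT f g mf mg measurableT [set true].
by rewrite setTI; apply.
Qed.

Lemma sqn_rotate a b p : (a ^+ 2 + b ^+ 2 = 1)%R -> sqn (rotate a b p) = sqn p.
Proof.
move=> ab1; rewrite -[RHS]mul1r -ab1 /sqn /rotate/=; ring.
Qed.

(** The normalising constant is left abstract: the total mass determines it. *)
Definition disc_law (mu : set (plane R) -> \bar R) : Prop :=
  exists2 c : R, (0 < c)%R & forall A, measurable A ->
    mu A = c^-1%:E * leb2 (A `&` [set p | (sqn p < 1)%R]).

Variable mu : probability (plane R) R.
Hypothesis mu_disc : disc_law mu.

Let mD : measurable [set p | (sqn p < 1)%R].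
Proof. by apply: measurable_ltr_set => //; exact: measurable_sqn. Qed.

Lemma disc_law_rotate a b A : (a ^+ 2 + b ^+ 2 = 1)%R -> measurable A ->
  mu (rotate a b @^-1` A) = mu A.
Proof.
move=> ab1 mA; have [c c0 muE] := mu_disc.
have mA' := measurable_preimage (measurable_rotate a b) mA.
rewrite (muE _ mA) (muE _ mA').
congr (_ * _); rewrite -[RHS](leb2_rotate ab1); last exact: measurableI.
by congr leb2; apply/seteqP; split=> p /=; rewrite sqn_rotate.
Qed.

Let c1 c : (0 < c)%R -> (forall A, measurable A ->
    mu A = c^-1%:E * leb2 (A `&` [set p | (sqn p < 1)%R])) ->
  c^-1%:E * leb2 [set p | (sqn p < 1)%R] = 1.
Proof.
by move=> c0 /(_ setT measurableT); rewrite setTI probability_setT => <-.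
Qed.

Let leb2_nrm_lt r : (0 < r)%R -> leb2 [set p | (nrm p < r)%R] =
  (r ^+ 2)%:E * leb2 [set p | (sqn p < 1)%R].
Proof.
move=> r0; have ri0 : (0 < r^-1)%R by rewrite invr_gt0.
have := leb2_dilation ri0 mD; rewrite invrK => <-.
congr leb2; apply/seteqP.
have E p : ((nrm p < r) = (sqn (r^-1 * p.1, r^-1 * p.2) < 1))%R.
  rewrite -[LHS](@ltr_pXn2r _ 2)// ?nnegrE ?nrm_ge0 ?ltW// sqr_nrm /sqn/=.
  by rewrite !exprMn -mulrDr exprVn ltr_pdivrMl ?exprn_gt0// mulr1.
by split=> p /=; rewrite E.
Qed.

(** Dilations make the areas of centred discs proportional to the squares of
    their radii. *)
Lemma disc_law_sqn_lt s : (0 <= s <= 1)%R ->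
  mu [set p | (sqn p < s)%R] = s%:E.
Proof.
have [c c0 muE] := mu_disc; rewrite le_eqVlt => /andP[/orP[/eqP<- _|s0 s1]].
  rewrite (_ : [set _ | _] = set0) ?measure0//.
  by apply/seteqP; split=> // p /=; rewrite ltNge sqn_ge0.
rewrite muE; last by apply: measurable_ltr_set => //; exact: measurable_sqn.
rewrite (_ : _ `&` _ = [set p | (nrm p < Num.sqrt s)%R]).
  by rewrite leb2_nrm_lt ?sqrtr_gt0// sqr_sqrtr ?ltW// muleCA c1// mule1.
apply/seteqP; split=> p /=; rewrite /nrm ltr_sqrt//; first by case.
by move=> ps; split => //; exact: lt_le_trans s1.
Qed.

(** The part of a ball inside the unit disc has at most the area of the centred
    disc of the same radius. *)
Lemma disc_law_ball z r : (0 <= r)%R ->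
  mu [set p | (dst z p < r)%R] <= (r ^+ 2)%:E.
Proof.
rewrite le_eqVlt => /predU1P[<-|r0].
  rewrite (_ : [set _ | _] = set0) ?measure0 ?lee_fin ?sqr_ge0//.
  by apply/seteqP; split=> // p /=; rewrite ltNge dst_ge0.
have [c c0 muE] := mu_disc.
have mB : measurable [set p | (dst z p < r)%R].
  by apply: measurable_ltr_set => //; exact: measurable_dst.
have mB0 : measurable [set p | (nrm p < r)%R].
  by apply: measurable_ltr_set => //; exact: measurable_nrm.
rewrite muE// -[leRHS]mule1 -[X in _ <= _ * X](c1 c0 muE).
rewrite muleCA lee_pmul2l ?lte_fin ?invr_gt0//.
rewrite -leb2_nrm_lt//.
rewrite -(leb2_translation (- z.1) (- z.2) mB0).
apply: le_measure; rewrite ?inE; first exact: measurableI.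
  apply: measurable_preimage mB0; apply: measurable_fun_pair => //;
  exact: measurable_funD.
by move=> p [/= pzr _]; move: pzr; rewrite dstC.
Qed.

Lemma disc_law_setC : mu [set p | (1 <= sqn p)%R] = 0.
Proof.
have [c c0 muE] := mu_disc; rewrite muE.
  rewrite (_ : _ `&` _ = set0) ?measure0 ?mule0//.
  by apply/seteqP; split=> // p [/=]; rewrite leNgt => /negbTE->.
by apply: measurable_ler_set => //; exact: measurable_sqn.
Qed.

Lemma disc_law_ae : {ae mu, forall p, (sqn p < 1)%R}.
Proof.
exists [set p | (1 <= sqn p)%R]; split.
- by apply: measurable_ler_set => //; exact: measurable_sqn.
- exact: disc_law_setC.
- by move=> p /= /negP; rewrite -leNgt.
Qed.

Lemma disc_law_set1 z : mu [set z] = 0.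
Proof.
have mz : measurable [set z].
  rewrite (_ : [set z] = [set p | (dst z p <= 0)%R]).
    by apply: measurable_ler_set => //; exact: measurable_dst.
  apply/seteqP; split => p /=; rewrite le_eqVlt ltNge dst_ge0 orbF dst_eq0.
    by move=> ->.
  by move/eqP.
apply/eqP; rewrite eq_le measure_ge0 andbT.
apply/lee_addgt0Pr => e e0; rewrite add0e.
have r0 : (0 < Num.sqrt e)%R by rewrite sqrtr_gt0.
apply: (@le_trans _ _ (mu [set p | (dst z p < Num.sqrt e)%R])).
  apply: le_measure; rewrite ?inE//.
    by apply: measurable_ltr_set => //; exact: measurable_dst.
  move=> p /= ->; rewrite (_ : dst z z = 0%R)//.
  by apply/eqP; rewrite dst_eq0.
by rewrite -[in leRHS](sqr_sqrtr (ltW e0)); apply: disc_law_ball; exact: ltW.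
Qed.

Lemma disc_law_dst_gt0 z : {ae mu, forall p, (0 < dst z p)%R}.
Proof.
exists [set z]; split; last 2 first.
- exact: disc_law_set1.
- move=> p /= /negP; rewrite -leNgt le_eqVlt ltNge dst_ge0 orbF dst_eq0.
  by move/eqP.
rewrite (_ : [set z] = [set p | (dst z p <= 0)%R]).
  by apply: measurable_ler_set => //; exact: measurable_dst.
apply/seteqP; split => p /=; rewrite le_eqVlt ltNge dst_ge0 orbF dst_eq0.
  by move=> ->.
by move/eqP.
Qed.

End disc_law.

(** * Logarithms and inverse distances *)

Section real_inequalities.
Context {R : realType}.
Implicit Types a b x : R.
Local Open Scope ring_scope.

(** With [r] and [s] the square roots of [a >= b], [ln (a / b) = 2 ln (r / s)]
    is at most [2 (r - s) / s], whose square is of order [|a - b| / b]. Using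
    [ln (a / b) <= (a - b) / b] directly would lead to inverse squares of
    distances, which are not integrable in the plane. *)
Lemma ln_diff_sqr a b : 0 < a -> 0 < b ->
  (ln a - ln b) ^+ 2 <= 4 * `|a - b| * (a^-1 + b^-1).
Proof.
wlog ab : a b / b <= a.
  move=> H a0 b0; have [ba|/ltW ab] := leP b a; first exact: H.
  by rewrite -sqrrN opprB distrC (addrC a^-1); exact: H.
move=> a0 b0; rewrite -ln_div ?posrE//.
set r := Num.sqrt a; set s := Num.sqrt b.
have r0 : 0 < r by rewrite sqrtr_gt0.
have s0 : 0 < s by rewrite sqrtr_gt0.
have ra : a = r ^+ 2 by rewrite sqr_sqrtr// ltW.
have sb : b = s ^+ 2 by rewrite sqr_sqrtr// ltW.
have sr : s <= r by rewrite ler_sqrt// ltW.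
have rs1 : 1 <= r / s by rewrite ler_pdivlMr// mul1r.
have -> : ln (a / b) = 2 * ln (r / s).
  by rewrite ra sb -expr_div_n lnXn ?divr_gt0// mulr_natl.
have l0 : 0 <= ln (r / s) by exact: ln_ge0.
have l1 : ln (r / s) <= (r - s) / s.
  have := @le_ln1Dx _ (r / s - 1); rewrite (addrC 1) subrK ltrBrDl subrr.
  by rewrite divr_gt0// mulrBl divff ?gt_eqF//; exact.
have l2 : ln (r / s) ^+ 2 <= (r ^+ 2 - s ^+ 2) / s ^+ 2.
  apply: (@le_trans _ _ (((r - s) / s) ^+ 2)).
    by rewrite ler_pXn2r// nnegrE// (le_trans l0).
  rewrite expr_div_n ler_pM2r ?invr_gt0 ?exprn_gt0//; nra.
rewrite exprMn (_ : 2 ^+ 2 = 4)%R; last by ring.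
rewrite -mulrA ler_pM2l// ger0_norm ?subr_ge0//; apply: le_trans l2 _.
rewrite -ra -sb ler_wpM2l ?subr_ge0//.
by rewrite lerDr invr_ge0 ltW.
Qed.

(** From [x ^ 3 <= exp (3 x)] at [x = |ln a| / 3]. *)
Lemma normr_ln_cube a : 0 < a -> `|ln a| ^+ 3 <= 27 * (a + a^-1).
Proof.
move=> a0; set x := `|ln a| / 3.
have x0 : 0 <= x by rewrite divr_ge0.
have xe : x ^+ 3 <= expR `|ln a|.
  have -> : expR `|ln a| = expR x ^+ 3.
    by rewrite -expRM_natl; congr expR; rewrite /x; field.
  rewrite ler_pXn2r// ?nnegrE ?expR_ge0//.
  by apply: le_trans (expR_ge1Dx _); rewrite lerDr.
have -> : `|ln a| ^+ 3 = 27 * x ^+ 3 by rewrite /x; field.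
rewrite ler_pM2l//; apply: le_trans xe _.
have [l0|l0] := leP 0 (ln a).
  by rewrite ger0_norm// lnK ?posrE// lerDl invr_ge0 ltW.
by rewrite ltr0_norm// expRN lnK ?posrE// lerDr ltW.
Qed.

Lemma sqr_le_1Dcube a : 0 <= a -> a ^+ 2 <= 1 + a ^+ 3.
Proof.
move=> a0; have [a1|a1] := leP a 1.
  by rewrite (@le_trans _ _ 1) ?exprn_ile1// lerDl exprn_ge0.
apply: (@le_trans _ _ (a ^+ 3)); last by rewrite lerDr.
by rewrite [leRHS]exprS ler_peMl ?exprn_ge0// ltW.
Qed.

Lemma sum_pow2 m : \sum_(0 <= k < m) (2 : R) ^+ k = 2 ^+ m - 1.
Proof.
elim: m => [|m IH]; first by rewrite big_geq// expr0 subrr.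
by rewrite big_nat_recr//= IH exprS; ring.
Qed.

(** Dyadic layers: they turn the integral of an inverse distance into a series
    of masses of balls. *)
Lemma inv_le_dyadic a : 0 <= a ->
  ((a^-1)%:E <= 2%:E + \sum_(k <oo) (2 ^+ k * ((a < (2^-1) ^+ k)%R)%:R)%:E)%E.
Proof.
move=> a0; pose u k : \bar R := (2 ^+ k * ((a < 2^-1 ^+ k)%R)%:R)%:E.
rewrite -[X in (_ <= _ + X)%E]/(\sum_(k <oo) u k)%E.
have s0 k : (0 <= u k)%E by rewrite lee_fin mulr_ge0// exprn_ge0.
move: a0; rewrite le_eqVlt => /predU1P[<-|a0].
  by rewrite invr0 adde_ge0// nneseries_ge0.
have [m0 am0] : exists m, (2^-1) ^+ m <= a.
  have [m _ /(_ m (leqnn m)) ma] := near_infty_natSinv_expn_lt (PosNum a0).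
  exists m; apply: ltW; rewrite exprVn -div1r; exact: ma.
have [m am Hm] := ex_minnP (ex_intro (fun m => (2^-1) ^+ m <= a) m0 am0).
apply: (@le_trans _ _ (2%:E + \sum_(0 <= k < m) u k)%E); last first.
  by rewrite leeD2l// nneseries_lim_ge.
have -> : (\sum_(0 <= k < m) u k = (2 ^+ m - 1)%:E)%E.
  rewrite -sum_pow2 -sumEFin; apply: eq_big_nat => k /andP[_ km].
  rewrite /u; have [//|ak] := ltP a (2^-1 ^+ k); first by rewrite mulr1.
  by have := Hm _ ak; rewrite leqNgt km.
rewrite -EFinD lee_fin.
have : a^-1 <= 2 ^+ m by rewrite -[leRHS]invrK lef_pV2 ?posrE ?invr_gt0 ?exprn_gt0// -exprVn.
lra.
Qed.

End real_inequalities.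

Section disc_law_integrals.
Context {R : realType}.
Implicit Types (p z : plane R).
Variable mu : probability (plane R) R.
Hypothesis mu_disc : disc_law mu.

Lemma ge0_integral_rotate (a b : R) (f : plane R -> \bar R) :
  (a ^+ 2 + b ^+ 2 = 1)%R -> measurable_fun setT f -> (forall p, 0 <= f p) ->
  \int[mu]_p f (rotate a b p) = \int[mu]_p f p.
Proof.
move=> ab1 mf f0.
have := @ge0_integral_pushforward _ _ _ _ R _ (measurable_rotate a b) mu setT f
  measurableT mf (fun p _ => f0 p).
move=> E; transitivity (\int[pushforward mu (rotate a b)]_p f p).
  by rewrite E.
apply: eq_measure_integral; first exact: measurable_rotate.
by move=> mf' A mA _; exact: (disc_law_rotate mu_disc ab1 mA).
Qed.

(** By [disc_law_ball] the ball of radius [2 ^ - k] has mass at most [4 ^ - k],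
    so its layer contributes at most [2 ^ - k], and the bound is [2 + 2]. *)
Lemma disc_law_inv_dst z : \int[mu]_p ((dst z p)^-1)%:E <= 4%:E.
Proof.
have mdst : measurable_fun setT (dst z) by exact: measurable_dst.
have mE (k : nat) : measurable [set p | (dst z p < 2^-1 ^+ k)%R].
  exact: measurable_ltr_set.
pose u k p := (2 ^+ k * ((dst z p < 2^-1 ^+ k)%R)%:R)%:E : \bar R.
have u0 k p : 0 <= u k p by rewrite lee_fin mulr_ge0// exprn_ge0.
have uE k : u k = fun p => (2 ^+ k * \1_[set p | (dst z p < 2^-1 ^+ k)%R] p)%:E.
  by apply/funext => p; rewrite /u indicE mem_setE.
have mu_ k : measurable_fun setT (u k).
  by rewrite uE; apply/measurable_EFinP; apply: measurable_funM.
have minv : measurable_fun setT (fun p => ((dst z p)^-1)%:E).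
  by apply/measurable_EFinP; apply: measurable_inv_ge0 => // p; exact: dst_ge0.
apply: (@le_trans _ _ (\int[mu]_p (2%:E + \sum_(k <oo) u k p))).
  apply: ge0_le_integral => //.
  - by move=> p _; rewrite lee_fin invr_ge0 dst_ge0.
  - apply: emeasurable_funD => //.
    by apply: ge0_emeasurable_sum.
  - by move=> p _; apply: inv_le_dyadic; exact: dst_ge0.
rewrite ge0_integralD//=; last 2 first.
- by move=> p _; rewrite nneseries_ge0.
- by apply: ge0_emeasurable_sum.
have -> : \int[mu]__ 2%:E = 2%:E.
  rewrite integral_cst// [X in _ * X](_ : _ = 1) ?mule1//.
  exact: probability_setT.
rewrite (_ : 4 = 2 + 2 :> R)%R ?EFinD ?leeD2l//; last by ring.
rewrite integral_nneseries//.
have ui k : \int[mu]_p u k p <= ((2^-1) ^+ k)%:E.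
  rewrite uE; under eq_integral do rewrite EFinM.
  rewrite ge0_integralZl_EFin ?exprn_ge0//; last first.
    exact/measurable_EFinP/measurable_indic.
  rewrite integral_indic// setIT.
  apply: (@le_trans _ _ ((2 ^+ k)%:E * ((2^-1 ^+ k) ^+ 2)%:E)).
    rewrite lee_pmul2l ?lte_fin ?exprn_gt0//.
    by apply: disc_law_ball => //; rewrite exprn_ge0.
  by rewrite -EFinM lee_fin expr2 mulrA -exprMn mulfV// expr1n mul1r.
apply: lime_le.
  by apply: is_cvg_nneseries => k _ _; apply: integral_ge0.
near=> n.
apply: (@le_trans _ _ (\sum_(0 <= k < n) ((2^-1 : R) ^+ k)%:E)).
  by apply: lee_sum => k _; exact: ui.
rewrite sumEFin lee_fin.
suff -> : (\sum_(0 <= k < n) (2^-1 : R) ^+ k = 2 - 2 * 2^-1 ^+ n)%R.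
  by rewrite gerBl mulr_ge0// exprn_ge0.
elim: (n) => [|m IH]; first by rewrite big_geq// expr0; ring.
by rewrite big_nat_recr//= IH exprS; field.
Unshelve. all: by end_near. Qed.

Lemma disc_law_sqn_le (s : R) : (0 <= s <= 1)%R ->
  mu [set p | (sqn p <= s)%R] = s%:E.
Proof.
move=> /andP[s0 s1].
have mlt t : measurable [set p : plane R | (sqn p < t)%R].
  by apply: measurable_ltr_set => //; exact: measurable_sqn.
have mle : measurable [set p : plane R | (sqn p <= s)%R].
  by apply: measurable_ler_set => //; exact: measurable_sqn.
apply/eqP; rewrite eq_le; apply/andP; split; last first.
  rewrite -(disc_law_sqn_lt mu_disc) ?s0 ?s1//; apply: le_measure; rewrite ?inE//.
  by move=> p /= /ltW.
have [s1'|sN1] := eqVneq s 1%R.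
  by rewrite [X in _ <= X%:E]s1'; exact: probability_le1.
have {sN1}s1 : (s < 1)%R by rewrite lt_neqAle sN1.
apply/lee_addgt0Pr => e e0.
pose t : R := Num.min (s + e)%R 1%R.
have st : (s < t)%R by rewrite lt_min s1 ltrDl e0.
apply: (@le_trans _ _ (mu [set p | (sqn p < t)%R])).
  by apply: le_measure; rewrite ?inE// => p /= ps; exact: le_lt_trans st.
rewrite (disc_law_sqn_lt mu_disc); first by rewrite lee_fin ge_min lexx.
by rewrite (le_trans s0 (ltW st))/= ge_min lexx orbT.
Qed.

(** The square of the modulus is uniform on the unit interval, by
    [disc_law_sqn_le]. *)
Lemma disc_law_integral_sqn (g : measurableTypeR R -> \bar R) : measurable_fun setT g ->
  (forall s, 0 <= g s) ->
  \int[mu]_p g (sqn p) = \int[lebesgue_measure]_(s in `]0%R, 1%R]) g s.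
Proof.
move=> mg g0.
have msqn := @measurable_sqn R.
pose E : set (measurableTypeR R) := `]0%R, 1%R]%classic.
have mE : measurable E by exact: measurable_itv.
have mle (t : R) : measurable [set p : plane R | (sqn p <= t)%R].
  exact: measurable_ler_set.
have pushE : forall A, measurable A -> A `<=` E ->
    pushforward mu (@sqn R : _ -> measurableTypeR R) A = lebesgue_measure A.
  move=> A mA AE.
  pose push : {measure set (measurableTypeR R) -> \bar R} :=
    pushforward mu (@sqn R : _ -> measurableTypeR R).
  pose leb : {measure set (measurableTypeR R) -> \bar R} := lebesgue_measure.
  pose m1 : {measure set (measurableTypeR R) -> \bar R} := mrestr (push msqn) mE.
  pose m2 : {measure set (measurableTypeR R) -> \bar R} := mrestr leb mE.
  have -> : pushforward mu (@sqn R : _ -> measurableTypeR R) A = m1 A.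
    by rewrite /m1 /= /mrestr setIidl.
  have -> : lebesgue_measure A = m2 A by rewrite /m2 /= /mrestr setIidl.
  pose g_ k : set (measurableTypeR R) := `]- k%:R, k%:R]%classic%R.
  apply: (@measure_unique _ R (measurableTypeR R) (@ocitv R) g_ _ _ _ _ m1 m2) => //.
  - exact: ocitvI.
  - by move=> k; exact: is_ocitv.
  - apply/seteqP; split => // x _; exists (Num.truncn `|x|).+1 => //=.
    rewrite /g_/= in_itv/=.
    have := Num.Theory.truncnS_gt `|x|; set k := (_.+1)%:R%R.
    by rewrite ltr_norml => /andP[-> /ltW].
  - move=> _ [[a b] _ <-] /=; rewrite /mrestr/=.
    have -> : `]a, b]%classic `&` E = `]Num.max a 0%R, Num.min b 1%R]%classic.
      apply/seteqP; split => x; rewrite /E/= !in_itv/= gt_max le_min.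
        by move=> [/andP[-> ->] /andP[-> ->]].
      by move=> /andP[/andP[-> ->] /andP[-> ->]].
    set a' := Num.max a 0%R; set b' := Num.min b 1%R.
    rewrite /leb lebesgue_measure_itv/= lte_fin /push /pushforward.
    have a'0 : (0 <= a')%R by rewrite le_max lexx orbT.
    have b'1 : (b' <= 1)%R by rewrite ge_min lexx orbT.
    case: ifPn => ab'; last first.
      rewrite -leNgt in ab'.
      rewrite (_ : _ @^-1` _ = set0) ?measure0//.
      apply/seteqP; split => // p /=; rewrite in_itv/= => /andP[h1 h2].
      by have := le_lt_trans (le_trans h2 ab') h1; rewrite ltxx.
    rewrite (_ : _ @^-1` _ = [set p | (sqn p <= b')%R] `\` [set p | (sqn p <= a')%R]).
      rewrite measureD//; last by rewrite (le_lt_trans (probability_le1 _ _))// ltry.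
      rewrite setIidr; last by move=> p /= h; rewrite (le_trans h)// ltW.
      rewrite EFinN; congr (_ + - _); apply: disc_law_sqn_le => //.
        by rewrite b'1 andbT (le_trans a'0)// ltW.
      by rewrite a'0 (le_trans (ltW ab')).
    apply/seteqP; split => p /=; rewrite in_itv/=.
      by move=> /andP[h1 h2]; split => //; apply/negP; rewrite -ltNge.
    by move=> [-> /negP]; rewrite -ltNge => ->.
  - move=> k; rewrite /mrestr; apply: le_lt_trans (probability_le1 _ _) _ => //.
      apply: (measurable_preimage msqn); apply: measurableI => //.
      exact: measurable_itv.
    exact: ltry.
transitivity (\int[pushforward mu (@sqn R : _ -> measurableTypeR R)]_(s in E) g s);
  last by apply: eq_measure_integral.
have mgE : measurable_fun E g by exact: measurable_funTS.
have H := @ge0_integral_pushforward _ _ (plane R) (measurableTypeR R) R _ msqn mu E g mE mgE (fun s _ => g0 s).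
transitivity (\int[mu]_(p in @sqn R @^-1` E) g (sqn p)); last exact/esym/H.
have mE' : measurable (@sqn R @^-1` E) by exact: measurable_preimage.
rewrite [LHS](@ge0_negligible_integral _ _ _ mu setT (@sqn R @^-1` (~` E)))//.
- by rewrite setTD -preimage_setC setCK.
- exact: measurable_preimage (measurableC mE).
- exact: measurableT_comp.
rewrite (_ : _ @^-1` _ = [set p | (sqn p <= 0)%R] `|` [set p | (1 < sqn p)%R]).
  apply/eqP; rewrite eq_le measure_ge0 andbT.
  have m1 : measurable [set p : plane R | (1 < sqn p)%R].
    exact: measurable_ltr_set.
  apply: le_trans (measureU2 _ _ _) _ => //.
  rewrite [X in X + _](_ : _ = 0) ?add0e; last first.
    by apply: disc_law_sqn_le; rewrite ?lexx ?ler01.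
  apply: (@le_trans _ _ (mu [set p | (1 <= sqn p)%R])).
    apply: le_measure; rewrite ?inE//; first exact: measurable_ler_set.
    by move=> p /= /ltW.
  rewrite le_eqVlt; apply/orP; left; apply/eqP; exact: disc_law_setC.
apply/seteqP; split => p /=; rewrite /E/= in_itv/=.
  by move/negP; rewrite negb_and -leNgt -ltNge => /orP[]; [left|right].
by move=> [h|h]; apply/negP; rewrite negb_and -leNgt -ltNge h ?orbT.
Qed.

End disc_law_integrals.

(** * Components of a lemniscate *)

Section counting_bounds.
Context {R : realType} {T : choiceType}.

Lemma counting_le_size (X : set T) (s : seq T) : X `<=` [set` s] ->
  (counting X : \bar R) <= (size s)%:R%:E.
Proof.
move=> Xs; have fX : finite_set X.
  by apply: sub_finite_set Xs _; apply/finite_seqP; exists s.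
rewrite /counting; case: asboolP => // _; rewrite lee_fin ler_nat.
apply: leq_trans (_ : #|` [fset x in s]%fset| <= _)%N.
  apply: fsubset_leq_card; apply/fsubsetP => x.
  by rewrite in_fset_set// inE => /Xs /= xs; rewrite in_fset /=.
by rewrite card_fseq size_undup.
Qed.

Lemma size_le_counting (X : set T) (s : seq T) : uniq s -> [set` s] `<=` X ->
  (size s)%:R%:E <= (counting X : \bar R).
Proof.
move=> us sX; rewrite /counting; case: asboolP => [fX|_]; last by rewrite leey.
rewrite lee_fin ler_nat.
apply: leq_trans (_ : _ <= #|` [fset x in s]%fset|)%N _.
  by rewrite card_fseq undup_id.
apply: fsubset_leq_card; apply/fsubsetP => x.
by rewrite in_fset /= => xs; rewrite in_fset_set// inE; exact: sX.
Qed.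

End counting_bounds.

Section lemniscate_components.
Context {R : realType}.
Local Open Scope ring_scope.
Local Open Scope complex_scope.
Notation C := (Cplx R).
Notation normc := (@Normc.normc R).

Lemma Cplx_normE (z : C) : `|z| = (normc z)%:C.
Proof. by rewrite normc_def; case: z. Qed.

Lemma normc_ge0 (z : C) : 0 <= normc z.
Proof. by case: z => a b; exact: sqrtr_ge0. Qed.

Lemma normcBC (z w : C) : normc (z - w) = normc (w - z).
Proof. by rewrite -normcN opprB. Qed.

Lemma normc_prod (n : nat) (F : nat -> C) :
  normc (\prod_(k < n) F k) = \prod_(k < n) normc (F k).
Proof.
elim: n => [|n IH]; first by rewrite !big_ord0 Normc.normc1.
by rewrite !big_ord_recr/= Normc.normcM IH.
Qed.

Lemma ler_dist_normc (z w : C) : `|normc z - normc w| <= normc (z - w).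
Proof.
have H (a b : C) : normc a <= normc (a - b) + normc b.
  by rewrite -{1}(subrK b a); exact: le_normcD.
rewrite ler_norml lerBlDr H andbT lerBrDr addrC lerBlDr.
by rewrite normcBC addrC H.
Qed.

Lemma continuous_normcB (a : C) : continuous (fun z : C => normc (z - a)).
Proof.
move=> z; apply: (iffRL (@cvgrPdist_lt _ _ _ (nbhs z) _ _ _)) => e e0.
exists e%:C; first by rewrite /= ltcR.
move=> w /=; rewrite Cplx_normE ltcR => zw.
apply: le_lt_trans (ler_dist_normc _ _) _.
by rewrite opprB addrA subrK.
Qed.

Lemma continuous_normc : continuous (normc : C -> R).
Proof.
have -> : (normc : C -> R) = (fun z : C => normc (z - 0)).
  by apply/funext => z; rewrite subr0.
exact: continuous_normcB.
Qed.

Lemma continuous_real_complex : continuous (fun r : R => r%:C : C).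
Proof.
move=> x; apply/cvgrPdist_lt => e e0.
have eE : e = (complex.Re e)%:C.
  by case: e e0 => a b; rewrite ltcE/= => /andP[/eqP-> _].
have re0 : 0 < complex.Re e by rewrite -ltcR -eE.
exists (complex.Re e) => //= y xy.
have -> : x%:C - y%:C = (x - y)%:C :> C by rewrite -rmorphB.
by rewrite Cplx_normE eE ltcR /= expr0n/= addr0 sqrtr_sqr.
Qed.

Lemma continuous_segment (z d : C) : continuous (fun t : R => z + t%:C * d).
Proof.
move=> t; apply: cvgD; first exact: cvg_cst.
by apply: cvgM; [exact: continuous_real_complex|exact: cvg_cst].
Qed.

Lemma continuous_polyC (p : {poly C}) : continuous (fun z : C => p.[z]).
Proof.
elim/poly_ind: p => [|p c IH] z.
  have -> : (fun z : C => (0 : {poly C}).[z]) = cst 0.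
    by apply/funext => w; rewrite horner0.
  exact: cst_continuous.
have -> : (fun z : C => (p * 'X + c%:P).[z]) = (fun z => p.[z] * z + c).
  by apply/funext => w; rewrite !hornerE.
apply: (@cvgD _ _ _ (nbhs z) (nbhs_filter z)); last exact: cst_continuous.
by apply: (@cvgM _ _ (nbhs z) (nbhs_filter z)); [exact: IH|exact: cvg_id].
Qed.

(** Near [z0] the polynomial behaves like [a + b * h ^ m], and the direction of
    [h] can be chosen so that [b * h ^ m] is a negative multiple of [a]. *)
Lemma poly_modulus_decrease (p : {poly C}) (z0 e : C) : (1 < size p)%N ->
  0 < e -> p.[z0] != 0 -> exists w, `|w - z0| < e /\ `|p.[w]| < `|p.[z0]|.
Proof.
move=> p1 e0 pz0.
pose q := p \Po ('X + z0%:P).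
have qE t : q.[t] = p.[t + z0] by rewrite horner_comp !hornerE.
pose a := q.[0]; have a0 : a != 0 by rewrite /a qE add0r.
have sq : size q = size p by rewrite size_comp_poly2// size_XaddC.
have qa : q - a%:P != 0.
  rewrite subr_eq0; apply/eqP => qa; move: p1.
  by rewrite -sq qa size_polyC; case: (a == 0).
have [m [r]] := multiplicity_XsubC (q - a%:P) 0.
rewrite qa /= subr0 => r0 qr.
have m0 : (0 < m)%N.
  rewrite lt0n; apply: contraNneq r0 => m0; move: qr; rewrite m0 expr0 mulr1 => <-.
  by rewrite /root !hornerE subrr.
pose b := r.[0]; have b0 : b != 0 by exact: r0.
have /factor_theorem[s] : root (r - b%:P) 0 by rewrite /root !hornerE subrr.
rewrite subr0 => rs.
have qE2 t : q.[t] = a + t ^+ m * (b + t * s.[t]).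
  have -> : q = a%:P + (b%:P + s * 'X) * 'X^m.
    have -> : b%:P + s * 'X = r by rewrite -rs addrC subrK.
    by rewrite -qr addrC subrK.
  by rewrite !(hornerE, hornerXn); ring.
pose c := m.-root (- a / b).
have cm : c ^+ m = - a / b by rewrite rootCK.
(* The step is [t * c], with [t] so small that it is shorter than [e] and that
   the terms of higher order, at most [t * D] relative to the main one, do not
   cancel the decrease. The order on complex numbers is partial, so [u] and [V]
   replace a minimum and a maximum. *)
pose S := \sum_(i < size s) `|s`_i| * `|c| ^+ i.
have S0 : 0 <= S by apply: sumr_ge0 => i _; rewrite mulr_ge0 ?exprn_ge0.
pose D := `|c| * S / `|b|.
have D0 : 0 <= D by rewrite divr_ge0 ?mulr_ge0.
pose u := e / (1 + e).
have e1 : 0 < 1 + e by rewrite addr_gt0.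
have u0 : 0 < u by rewrite divr_gt0.
have u1 : u < 1 by rewrite ltr_pdivrMr// mul1r ltrDr.
have ue : u < e by rewrite ltr_pdivrMr// mulrDr mulr1 ltrDl mulr_gt0.
pose V := 1 + `|c| + D.
have V0 : 0 < V by rewrite /V ltr_wpDr// ltr_wpDr.
have V1 : 1 <= V by rewrite /V -addrA lerDl addr_ge0.
have Vc : `|c| <= V by rewrite /V addrAC lerDr addr_ge0.
have VD : D <= V by rewrite /V lerDr addr_ge0.
pose t := u / V.
have t0 : 0 < t by rewrite divr_gt0.
have tle y : 0 <= y -> y <= V -> t * y <= u.
  by move=> y0 yV; rewrite /t mulrAC ler_pdivrMr// ler_pM2l.
have t1 : t < 1 by rewrite -[t]mulr1 (le_lt_trans (tle _ _ V1)).
have tc : `|t * c| < e.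
  by rewrite normrM gtr0_norm// (le_lt_trans (tle _ _ Vc)).
have tD : t * D < 1 by rewrite (le_lt_trans (tle _ _ VD)).
exists (t * c + z0); rewrite addrK; split => //.
rewrite -qE -[z0 in ltRHS]add0r -qE -/a.
have tm0 : 0 < t ^+ m by rewrite exprn_gt0.
have tm1 : t ^+ m <= 1 by rewrite exprn_ile1 ?ltW.
have sS : `|s.[t * c]| <= S.
  rewrite horner_coef; apply: le_trans (ler_norm_sum _ _ _) _.
  apply: ler_sum => i _; rewrite normrM ler_wpM2l// normrX normrM exprMn.
  by rewrite ler_piMl ?exprn_ge0// gtr0_norm// exprn_ile1 ?ltW.
have -> : q.[t * c] = a * (1 - t ^+ m) - t ^+ m * (a / b * (t * c * s.[t * c])).
  by rewrite qE2 exprMn cm; field.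
apply: le_lt_trans (ler_normB _ _) _.
have -> : `|a * (1 - t ^+ m)| = `|a| * (1 - t ^+ m).
  by rewrite normrM [X in _ * X]ger0_norm// subr_ge0.
have H : `|t ^+ m * (a / b * (t * c * s.[t * c]))| <= t ^+ m * (`|a| * (t * D)).
  rewrite normrM gtr0_norm// ler_pM2l//.
  have -> : `|a / b * (t * c * s.[t * c])| =
     `|a| * (t * (`|c| * `|s.[t * c]| / `|b|)).
    by rewrite (normrM (a / b)) (normrM (t * c)) (normrM t) (normrM a) normfV
      (gtr0_norm t0); ring.
  rewrite ler_wpM2l// ler_pM2l// ler_wpM2r ?invr_ge0// ler_wpM2l//.
apply: le_lt_trans (lerD (lexx _) H) _.
rewrite mulrCA -mulrDr gtr_pMr ?normr_gt0//.
by rewrite -addrA gtrDl addrC subr_lt0 gtr_pMr.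
Qed.

Section component_roots.
Variable p : {poly C}.
Hypothesis p1 : (1 < size p)%N.
Hypothesis p_bounded : exists M : R, forall z, lemniscate p z -> normc z <= M.
Local Notation A := (lemniscate p).

Lemma lemniscate_ball z : A z ->
  exists2 e : C, 0 < e & forall w, `|w - z| < e -> A w.
Proof.
rewrite /lemniscate/= => Az.
have e0 : 0 < 1 - `|p.[z]| by rewrite subr_gt0.
have := @continuous_polyC p z => /cvgrPdist_lt/(_ _ e0)[e e0' He].
exists e => // w wz; have := He w; rewrite /= distrC => /(_ wz) H.
rewrite -[p.[w]](subrK p.[z]); apply: le_lt_trans (ler_normD _ _) _.
by rewrite -ltrBrDr distrC.
Qed.

Lemma lemniscate_segment (z w : C) : (forall t : R, 0 <= t <= 1 -> A (z + t%:C * (w - z))) ->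
  connected_component A z w.
Proof.
move=> H.
pose S : set C := (fun t : R => z + t%:C * (w - z)) @` `[0, 1]%classic.
exists S; first split.
- by exists 0; rewrite /= ?in_itv/= ?lexx ?ler01// mul0r addr0.
- by move=> _ [t /= t01 <-]; apply: H; rewrite in_itv in t01.
- apply: connected_continuous_connected; first exact: segment_connected.
  by apply: continuous_subspaceT; exact: continuous_segment.
- by exists 1; rewrite /= ?in_itv/= ?lexx ?ler01// mul1r addrC subrK.
Qed.

Lemma lemniscate_ball_component z e w : (forall w, `|w - z| < e -> A w) ->
  `|w - z| < e -> connected_component A z w.
Proof.
move=> He wz; apply: lemniscate_segment => t /andP[t0 t1].
apply: He; rewrite addrC addKr normrM; apply: le_lt_trans wz.
rewrite ler_piMl// Cplx_normE /= expr0n/= addr0 sqrtr_sqr ger0_norm//.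
by rewrite -[1]/(1%:C) lecR.
Qed.

Lemma compact_square (M : R) :
  compact [set z : C | `|complex.Re z| <= M /\ `|complex.Im z| <= M].
Proof.
have -> : [set z : C | `|complex.Re z| <= M /\ `|complex.Im z| <= M] =
   (fun x : R * R => x.1%:C + x.2%:C * (0 +i* 1) : C) @` (`[- M, M] `*` `[- M, M]).
  apply/seteqP; split => [[a b] /= [aM bM]|_ [[a b] /= [aM bM] <-]].
    exists (a, b); rewrite /= ?in_itv/= -?ler_norml//.
    by apply/eqP; rewrite eq_complex /=; apply/andP; split; apply/eqP; ring.
  have -> : a%:C + b%:C * (0 +i* 1) = a +i* b.
    by apply/eqP; rewrite eq_complex /=; apply/andP; split; apply/eqP; ring.
  by rewrite /= !ler_norml; move: aM bM; rewrite /= !in_itv.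
apply: continuous_compact; last by apply: compact_setX; exact: segment_compact.
apply: continuous_subspaceT => x; apply: cvgD.
  by apply: continuous_comp; [exact: cvg_fst|exact: continuous_real_complex].
apply: cvgM; last exact: cvg_cst.
by apply: continuous_comp; [exact: cvg_snd|exact: continuous_real_complex].
Qed.

(** On the closure of the component the modulus has a minimum. As it is below
    one there, the minimum lies in the lemniscate, hence in the component,
    which contains a neighbourhood of it; so the modulus could be decreased if
    it were not zero. *)
Lemma component_root z0 : A z0 ->
  exists2 w, connected_component A z0 w & p.[w] = 0.
Proof.
move=> Az0; apply: contrapT => noroot.
set K := connected_component A z0.
have [M AM] := p_bounded.
pose Q := [set z : C | `|complex.Re z| <= M /\ `|complex.Im z| <= M].
have AQ : A `<=` Q.
  move=> [a b] /AM /= H; split; apply: le_trans H; rewrite -sqrtr_sqr.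
    by rewrite ler_sqrt ?addr_ge0 ?sqr_ge0// lerDl sqr_ge0.
  by rewrite ler_sqrt ?addr_ge0 ?sqr_ge0// lerDr sqr_ge0.
have cQ : closed Q.
  by apply: compact_closed; [exact: norm_hausdorff|exact: compact_square].
have cK : compact (closure K).
  apply: (subclosed_compact (@closed_closure _ K) (@compact_square M)).
  rewrite -/Q ((closure_id Q).1 cQ); apply: closure_subset.
  by apply: subset_trans AQ; exact: connected_component_sub.
pose f (z : C) : R := normc p.[z].
have cf : {within closure K, continuous f}.
  apply: continuous_subspaceT => z.
  by apply: continuous_comp; [exact: continuous_polyC|exact: continuous_normc].
have Kz0 : K z0 by exact: connected_component_refl.
have K0 : closure K !=set0 by exists z0; exact: subset_closure.
have [c cK' cmin] := compact_EVT_min K0 cK cf.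
have AE z : A z = (f z < 1) :> Prop.
  by rewrite /lemniscate/= Cplx_normE -[1]/(1%:C) ltcR.
have Ac : A c.
  rewrite AE; apply: le_lt_trans (cmin z0 _) _; first by rewrite inE; exact: subset_closure.
  by rewrite -AE.
have [e e0 He] := lemniscate_ball Ac.
have Kc : K c.
  move: cK'; rewrite inE => /(_ [set w | `|w - c| < e]) [].
    by apply/nbhs_normP; exists e => // w /=; rewrite distrC.
  move=> y [Ky /= yc]; apply: connected_component_trans Ky _.
  apply: connected_component_sym; exact: lemniscate_ball_component yc.
have [w [wc pw]] : exists w, `|w - c| < e /\ `|p.[w]| < `|p.[c]|.
  by apply: poly_modulus_decrease => //; apply/eqP => pc; apply: noroot; exists c.
have Kw : K w.
  apply: connected_component_trans Kc _; exact: lemniscate_ball_component wc.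
have : f c <= f w by apply: cmin; rewrite inE; exact: subset_closure.
by move: pw; rewrite !Cplx_normE ltcR ltNge => /negP.
Qed.

End component_roots.

Variables (x : nat -> C) (n : nat).
Let p := root_poly x n.
Local Notation A := (lemniscate p).

Lemma root_polyE z : p.[z] = \prod_(k < n) (z - x k).
Proof. by rewrite horner_prod; apply: eq_bigr => k _; rewrite !hornerE. Qed.

Lemma lemniscateE z : A z <-> \prod_(k < n) normc (z - x k) < 1.
Proof.
rewrite /lemniscate/= root_polyE Cplx_normE (normc_prod n (fun k => z - x k)).
by rewrite -[X in _ < X]/(1%:C) ltcR.
Qed.

Lemma lemniscate_root k : (k < n)%N -> A (x k).
Proof.
by move=> kn; apply/lemniscateE; rewrite (bigD1 (Ordinal kn))//= subrr
  Normc.normc0 mul0r.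
Qed.

Let p_bounded : exists M : R, forall z, A z -> normc z <= M.
Proof.
exists (1 + \sum_(k < n) normc (x k)) => z /lemniscateE Az.
have [k zk] : exists k : 'I_n, normc (z - x k) < 1.
  apply: contrapT => H; move: Az; apply/negP; rewrite -leNgt.
  elim/big_ind : _ => //.
    by move=> a b a1 b1; rewrite -[1]mulr1 ler_pM.
  by move=> k _; rewrite leNgt; apply/negP => zk; apply: H; exists k.
rewrite -(subrK (x k) z); apply: le_trans (le_normcD _ _) _.
apply: lerD; first exact: ltW.
by rewrite (bigD1 k)//= lerDl sumr_ge0// => i _; exact: normc_ge0.
Qed.

(** By [component_root] a component is that of some root [x k]; if [b k] fails,
    the segment to [x k] shows that it is the component of the origin. *)
Lemma num_components_le (b : nat -> bool) :
  (forall k, (k < n)%N -> ~~ b k -> forall t : R, 0 <= t <= 1 ->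
     \prod_(j < n) normc (t%:C * x k - x j) < 1) ->
  (num_components R A <= (1 + \sum_(k < n) (b k)%:R)%:E)%E.
Proof.
move=> Hb.
pose cc := connected_component A.
pose s := cc 0 :: [seq cc (x k) | k <- iota 0 n & b k].
have sE : 1 + \sum_(k < n) (b k)%:R = (size s)%:R :> R.
  rewrite /= -natr1 addrC size_map size_filter -sum1_count; congr (_ + _).
  rewrite -natr_sum; congr (_%:R).
  have -> : iota 0 n = index_iota 0 n by rewrite /index_iota subn0.
  rewrite [in RHS]big_mkcond/= big_mkord.
  by apply: eq_bigr => k _; case: (b k).
rewrite sE; apply: counting_le_size => _ [z0 Az0 <-].
have [n0|n0] := posnP n.
  by move: Az0 => /lemniscateE; rewrite n0 big_ord0 ltxx.
have sp : (1 < size p)%N.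
  rewrite /p /root_poly size_prod_XsubC /index_enum -enumT size_enum_ord.
  by rewrite ltnS.
have [w Kw pw] := component_root sp p_bounded Az0.
have [k zk] : exists k : 'I_n, w = x k.
  move: pw; rewrite root_polyE => /eqP/prodf_eq0[k _]; rewrite subr_eq0 => /eqP wk.
  by exists k.
have KE : cc z0 = cc (x k) by rewrite -zk; exact: same_connected_component.
have [bk|bk] := boolP (b k).
  rewrite /s /= inE; apply/orP; right; apply/mapP; exists (k : nat) => //.
  by rewrite mem_filter bk mem_iota/= add0n ltn_ord.
rewrite /s /= inE; apply/orP; left; apply/eqP.
rewrite -/(cc z0) KE.
have H : connected_component A 0 (x k).
  apply: lemniscate_segment => t t01; rewrite add0r subr0.
  by apply/lemniscateE; exact: Hb.
exact/esym/(same_connected_component H).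
Qed.

(** Suppose that the component of [x k] contains [x j]. Being connected, it
    meets the circle between them, which is outside the lemniscate. *)
Lemma num_components_ge (g : nat -> bool) :
  (forall k, (k < n)%N -> g k -> exists2 r : R, 0 < r &
     (forall z, normc (z - x k) = r -> 1 <= \prod_(j < n) normc (z - x j)) /\
     (forall j, (j < n)%N -> j != k -> r < normc (x j - x k))) ->
  ((\sum_(k < n) (g k)%:R)%:E <= num_components R A)%E.
Proof.
move=> Hg.
pose cc := connected_component A.
pose s := [seq cc (x k) | k <- iota 0 n & g k].
have sE : \sum_(k < n) (g k)%:R = (size s)%:R :> R.
  rewrite size_map size_filter -sum1_count -natr_sum; congr (_%:R).
  have -> : iota 0 n = index_iota 0 n by rewrite /index_iota subn0.
  rewrite [in RHS]big_mkcond/= big_mkord.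
  by apply: eq_bigr => k _; case: (g k).
rewrite sE; apply: size_le_counting; last first.
  move=> K /= /mapP[k]; rewrite mem_filter mem_iota => /andP[_ /andP[_ kn]] ->.
  by exists (x k) => //; exact: lemniscate_root.
rewrite map_inj_in_uniq ?filter_uniq ?iota_uniq//.
move=> k j; rewrite !mem_filter !mem_iota !add0n.
move=> /andP[gk /andP[_ kn]] /andP[_ /andP[_ jn]] ckj.
apply: contrapT => /eqP kj.
have [r r0 [circ far]] := Hg k kn gk.
have Kj : cc (x k) (x j).
  by rewrite ckj; apply: connected_component_refl; exact: lemniscate_root.
have Kk : cc (x k) (x k).
  by apply: connected_component_refl; exact: lemniscate_root.
pose f (z : C) : R := normc (z - x k).
have cf : continuous f by exact: continuous_normcB.
have : connected (f @` cc (x k)).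
  apply: connected_continuous_connected; first exact: component_connected.
  exact: continuous_subspaceT.
move=> /connected_intervalP H.
have /H : (f @` cc (x k)) (f (x k)) by exists (x k).
have fj : (f @` cc (x k)) (f (x j)) by exists (x j).
move=> /(_ _ fj r); rewrite {1}/f subrr Normc.normc0 (ltW r0) /=.
have jk : j != k by rewrite eq_sym.
rewrite /f ltW ?far// => /(_ isT)[z Kz fz].
have := connected_component_sub Kz => /lemniscateE.
by rewrite ltNge circ.
Qed.

End lemniscate_components.

(** * Wallis' product *)

Section wallis.
Context {R : realType}.
Local Open Scope ring_scope.

(** The probability that a simple random walk is back at its start at time
    [2 m]. *)
Definition return_prob (m : nat) : R := 'C(m.*2, m)%:R / 4 ^+ m.

Let natrS k : k.+1%:R = k%:R + 1 :> R. Proof. by rewrite -natr1. Qed.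
Let natr_double k : k.*2%:R = 2 * k%:R :> R. Proof. by rewrite -mul2n natrM. Qed.

Lemma return_prob0 : return_prob 0 = 1.
Proof. by rewrite /return_prob bin0 expr0 divr1. Qed.

Lemma central_binS m :
  ('C(m.+1.*2, m.+1) * m.+1 = 'C(m.*2, m) * (m.*2.+1).*2)%N.
Proof.
have F k : ('C(k.*2, k) * (k`! * k`!) = (k.*2)`!)%N.
  by rewrite -(bin_fact (n := k.*2) (m := k)) ?leq_double// -addnn ?leq_addr// addnK.
have f0 : (0 < m`! * m`!)%N by rewrite muln_gt0 !fact_gt0.
apply/eqP; rewrite -(eqn_pmul2r f0) -(eqn_pmul2r (ltn0Sn m)); apply/eqP.
transitivity ('C(m.+1.*2, m.+1) * (m.+1`! * m.+1`!))%N.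
  by rewrite !factS; nia.
rewrite F doubleS !factS -F; nia.
Qed.

Lemma return_probS m :
  return_prob m.+1 = return_prob m * ((2 * m%:R + 1) / (2 * m%:R + 2)).
Proof.
have := congr1 (fun k : nat => k%:R : R) (central_binS m).
rewrite !natrM natr_double (natrS m) (natrS m.*2) natr_double => E.
rewrite /return_prob exprS.
have m1 : (m%:R + 1 : R) != 0 by rewrite natr1 pnatr_eq0.
have m2 : (2 * m%:R + 2 : R) != 0.
  by rewrite (_ : _ + _ = 2 * (m%:R + 1)) ?mulf_neq0 ?pnatr_eq0//; ring.
have e4 : (4 ^+ m : R) != 0 by rewrite expf_neq0.
have -> : 'C(m.+1.*2, m.+1)%:R =
    'C(m.*2, m)%:R * (2 * (2 * m%:R + 1)) / (m%:R + 1) :> R.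
  by rewrite -E mulfK.
by field; rewrite m1 m2 e4.
Qed.

Lemma return_prob_gt0 m : 0 < return_prob m.
Proof.
elim: m => [|m IH]; first by rewrite return_prob0.
by rewrite return_probS mulr_gt0// divr_gt0// ltr_wpDl// mulr_ge0.
Qed.

Local Notation leb := (@lebesgue_measure R).
Local Notation J n := (\int[leb]_(x in `[0, pi]) (sin x ^+ n)).

Let cvg_sinX n : {within `[0, pi], continuous (fun x : R => sin x ^+ n)}.
Proof.
apply: continuous_subspaceT => x.
by apply: (@continuous_comp _ _ _ sin (fun y => y ^+ n));
  [exact: continuous_sin|exact: exprn_continuous].
Qed.

Let int_sinX n : leb.-integrable `[0, pi] (EFin \o (fun x : R => sin x ^+ n)).
Proof. by apply: continuous_compact_integrable => //; exact: segment_compact. Qed.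

Let J0 : J 0 = pi.
Proof.
under eq_Rintegral do rewrite expr0.
have L : leb `[0, pi] = (pi : R)%:E.
  by rewrite lebesgue_measure_itv/= lte_fin pi_gt0/= sube0.
by rewrite Rintegral_cst// mul1r [X in fine X]L.
Qed.

Let FTC (f F : R -> R) : (forall x, is_derive x (1 : R) F (f x)) ->
  continuous f -> \int[leb]_(x in `[0, pi]) f x = F pi - F 0.
Proof.
move=> dF cf; rewrite /Rintegral (@continuous_FTC2 _ f F) ?pi_gt0//.
- exact: continuous_subspaceT.
- split.
  + by move=> x _; apply: ex_derive.
  + apply: cvg_at_right_filter.
    by apply: differentiable_continuous; apply/derivable1_diffP; apply: ex_derive.
  + apply: cvg_at_left_filter.
    by apply: differentiable_continuous; apply/derivable1_diffP; apply: ex_derive.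
- by move=> x _; rewrite derive1E; apply: derive_val.
Qed.

Let J1 : J 1 = 2.
Proof.
under eq_Rintegral do rewrite expr1.
have dF x : is_derive x (1 : R) (- cos) (sin x).
  by rewrite -[sin x]opprK; apply: is_deriveN.
rewrite (FTC dF); last exact: continuous_sin.
by rewrite !fctE cospi cos0; ring.
Qed.

Let JSS n : n.+2%:R * J n.+2 = n.+1%:R * J n.
Proof.
apply/eqP; rewrite -subr_eq0 -!RintegralZl//; apply/eqP.
rewrite -RintegralB//; last 2 first.
- apply: continuous_compact_integrable; first exact: segment_compact.
  by move=> x; apply: cvgM; [exact: cvg_cst|exact: cvg_sinX].
- apply: continuous_compact_integrable; first exact: segment_compact.
  by move=> x; apply: cvgM; [exact: cvg_cst|exact: cvg_sinX].
pose F : R -> R := - (cos * sin ^+ n.+1).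
have dF x : is_derive x (1 : R) F (n.+2%:R * sin x ^+ n.+2 - n.+1%:R * sin x ^+ n).
  have H : is_derive x (1 : R) F
     (- (cos x *: (n.+1%:R * sin x ^+ n *: cos x) +
         (sin ^+ n.+1) x *: (- sin x))).
    by apply: is_deriveN.
  apply: is_derive_eq H _.
  rewrite !fctE /GRing.scale/=.
  have cE : cos x * cos x = 1 - sin x ^+ 2 by rewrite -(cos2Dsin2 x) expr2; ring.
  transitivity (- (n.+1%:R * sin x ^+ n * (cos x * cos x)) + sin x ^+ n.+2).
    by rewrite [sin x ^+ n.+2]exprS [sin x ^+ n.+1]exprS; ring.
  by rewrite cE (natrS n.+1) !exprS; ring.
rewrite (FTC dF).
  by rewrite /F !fctE sinpi sin0 exprS !mul0r !mulr0 subrr.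
move=> x; apply: cvgB; apply: cvgM; (try exact: cvg_cst);
  by apply: (@continuous_comp _ _ _ sin (fun y => y ^+ _));
    [exact: continuous_sin|exact: exprn_continuous].
Qed.

Let J_even m : J m.*2 = pi * return_prob m.
Proof.
elim: m => [|m IH]; first by rewrite J0 return_prob0 mulr1.
have m2 : (m.*2.+2%:R : R) != 0 by rewrite pnatr_eq0.
apply: (mulfI m2); rewrite doubleS JSS IH return_probS.
have e2 : m.*2.+2%:R = 2 * m%:R + 2 :> R by rewrite !natrS natr_double; ring.
rewrite e2 (natrS m.*2) natr_double; field.
by rewrite -e2.
Qed.

Let J_odd m : J m.*2.+1 * return_prob m * (2 * m%:R + 1) = 2.
Proof.
elim: m => [|m IH]; first by rewrite J1 return_prob0; ring.
rewrite -{2}IH return_probS doubleS.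
have m3 : (m.*2.+3%:R : R) != 0 by rewrite pnatr_eq0.
have E : J m.*2.+3 = m.*2.+2%:R * J m.*2.+1 / m.*2.+3%:R.
  by rewrite -JSS mulrC mulKf.
have e3 : m.*2.+3%:R = 2 * m%:R + 3 :> R.
  by rewrite !natrS natr_double; ring.
have e2 : m.*2.+2%:R = 2 * m%:R + 2 :> R.
  by rewrite !natrS natr_double; ring.
rewrite E e2 e3 -[m.+1%:R]natr1; field.
by rewrite -e2 -e3 !pnatr_eq0.
Qed.

Let J_decr n : J n.+1 <= J n.
Proof.
apply: le_Rintegral => // x /=; rewrite in_itv/= => /andP[x0 xpi].
have s0 : 0 <= sin x by rewrite sin_ge0_pi// x0.
by rewrite exprS ler_piMl ?exprn_ge0// sin_le1.
Qed.

(** Wallis' product: for even and odd exponents, the integrals of the powers of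
    the sine from [0] to [pi] are, up to explicit factors, the return
    probabilities and their inverses; and they decrease with the exponent. *)
Lemma return_prob_bounds m :
  2 / pi / (2 * m%:R + 1) <= return_prob m ^+ 2 <=
  2 / pi / (2 * m%:R + 1) * ((2 * m%:R + 2) / (2 * m%:R + 1)).
Proof.
have p0 := return_prob_gt0 m.
have pi0 := @pi_gt0 R.
have a0 : 0 < 2 * m%:R + 1 :> R by rewrite ltr_wpDl// mulr_ge0.
have b0 : 0 < 2 * m%:R + 2 :> R by rewrite ltr_wpDl// mulr_ge0.
have pa : 0 < return_prob m * (2 * m%:R + 1) by apply: mulr_gt0.
have O := J_odd m.
have JO : J m.*2.+1 = 2 / (return_prob m * (2 * m%:R + 1)).
  by rewrite -[X in _ = X / _]O -mulrA mulfK// mulf_neq0 ?gt_eqF.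
apply/andP; split.
  have := J_decr m.*2; rewrite J_even JO.
  rewrite ler_pdivrMr// => H.
  rewrite ler_pdivrMr// ler_pdivrMr//.
  by apply: le_trans H _; rewrite le_eqVlt; apply/orP; left; apply/eqP; ring.
have := J_decr m.*2.+1; rewrite -doubleS J_even JO return_probS.
rewrite ler_pdivlMr// => H.
rewrite -(ler_pM2l (_ : 0 < pi * (2 * m%:R + 1) ^+ 2 / (2 * m%:R + 2))); last first.
  by rewrite divr_gt0// mulr_gt0// exprn_gt0.
apply: le_trans (_ : _ <= 2) _.
  apply: le_trans _ H; rewrite le_eqVlt; apply/orP; left; apply/eqP.
  by field; rewrite gt_eqF.
rewrite le_eqVlt; apply/orP; left; apply/eqP.
move: (2 * m%:R : R) a0 b0 (pi : R) pi0 => x a0 b0 y y0.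
by field; rewrite (gt_eqF a0) (gt_eqF b0) gt_eqF.
Qed.

End wallis.

(** * The simple random walk *)

Section coin_walk.
Context {R : realType}.
Local Open Scope ring_scope.
Implicit Types (f : R -> R) (c s : R).

(** The transition operator of the random walk with steps [s] and [- s]. *)
Definition coin s f : R -> R := fun c => (f (c + s) + f (c - s)) / 2.

Lemma iter_coin_scale s f n c :
  iter n (coin s) f (s * c) = iter n (coin 1) (fun x => f (s * x)) c.
Proof.
elim: n c => [//|n IH] c; rewrite !iterS [LHS]/coin [RHS]/coin.
by rewrite -!IH mulrDr mulrBr mulr1.
Qed.

Lemma iter_coin_lin s f g (a b : R) n c :
  iter n (coin s) (fun x => a * f x + b * g x) c =
  a * iter n (coin s) f c + b * iter n (coin s) g c.
Proof. by elim: n c => //= n IH c; rewrite /coin !IH; field. Qed.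

Lemma iter_coin_affine s (a b : R) n c :
  iter n (coin s) (fun x => a * x + b) c = a * c + b.
Proof. by elim: n c => //= n IH c; rewrite /coin !IH; field. Qed.

Lemma le_iter_coin s f g n c : (forall x, f x <= g x) ->
  iter n (coin s) f c <= iter n (coin s) g c.
Proof.
move=> fg; elim: n c => //= n IH c.
by rewrite /coin ler_pM2r ?invr_gt0// lerD.
Qed.

Lemma eq_iter_coin s f g n c : (forall x, f x = g x) ->
  iter n (coin s) f c = iter n (coin s) g c.
Proof. by move=> fg; congr (iter n _ _ c); exact/funext. Qed.

Lemma iter_coin_bin f n c :
  iter n (coin 1) f c =
  (2 ^+ n)^-1 * \sum_(i < n.+1) 'C(n, i)%:R * f (c + n%:R - 2 * i%:R).
Proof.
elim: n c => [|n IH] c /=.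
  by rewrite big_ord1 expr0 invr1 bin0 !mul1r mulr0 subr0 addr0.
rewrite [LHS]/coin !IH -mulrDr mulrC mulrA -invfM -exprS; congr (_ * _).
rewrite [in RHS]big_ord_recl [X in _ = _ + X](eq_bigr (fun i : 'I_n.+1 =>
  'C(n, i.+1)%:R * f (c + n.+1%:R - 2 * i.+1%:R) +
  'C(n, i)%:R * f (c + n.+1%:R - 2 * i.+1%:R))); last first.
  by move=> i _; rewrite lift0 binS natrD mulrDl.
rewrite big_split/= addrA; congr (_ + _).
  rewrite bin0 -[LHS]addr0.
  rewrite [in RHS]big_ord_recr/= bin_small// mul0r addr0.
  rewrite big_ord_recl/= bin0 addr0; congr (_ * f _ + _).
    by rewrite -natr1; ring.
  by apply: eq_bigr => i _; congr (_ * f _); rewrite /bump/= add1n -natr1; ring.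
by apply: eq_bigr => i _; congr (_ * f _); rewrite -2!natr1; ring.
Qed.

(** The modulus of the walk drifts only at the origin, where it increases by
    one. So its mean is the expected number of earlier visits to the origin, a
    sum of return probabilities that [return_probS] makes telescope. *)
Lemma iter_coin_normr n :
  iter n (coin 1) (fun x => `|x|) 0 =
  (uphalf n)%:R * 2 * return_prob (uphalf n) :> R.
Proof.
pose bump x := (coin 1 (fun x => `|x|) x - `|x| : R).
have bump0 : bump 0 = 1 by rewrite /bump /coin add0r sub0r normrN normr1 normr0; field.
have bump1 x : 1 <= `|x| -> bump x = 0.
  rewrite /bump /coin; have [x0|x0] := leP 0 x.
    by rewrite ger0_norm// => x1; rewrite ger0_norm ?ger0_norm; [field|lra..].
  by rewrite ltr0_norm// => x1; rewrite ler0_norm ?ler0_norm; [field|lra..].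
have step m : iter m.+1 (coin 1) (fun x => `|x|) 0 =
    iter m (coin 1) (fun x => `|x|) 0 + iter m (coin 1) bump 0.
  rewrite iterSr.
  have := iter_coin_lin 1 (fun x => `|x|) bump 1 1 m 0; rewrite !mul1r => <-.
  by apply: eq_iter_coin => x; rewrite !mul1r /bump addrC subrK.
have even_bump m : iter m.*2 (coin 1) bump 0 = return_prob m.
  have mm : (m < m.*2.+1)%N by rewrite ltnS -addnn leq_addr.
  rewrite iter_coin_bin (bigD1 (Ordinal mm))//= big1.
    rewrite addr0 add0r -mul2n natrM subrr bump0 mulr1 mulrC exprM.
    by rewrite /return_prob -mul2n; congr (_ / _ ^+ _); ring.
  move=> i iNm; rewrite bump1 ?mulr0// add0r.
  have -> : (m.*2)%:R = 2 * m%:R :> R by rewrite -mul2n natrM.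
  rewrite -mulrBr normrM.
  have : (1 : R) <= `|m%:R - i%:R|.
    have {}iNm : (i != m :> nat) by [].
    have [im|mi] := ltnP i m.
      by rewrite ger0_norm ?subr_ge0 ?ler_nat 1?ltnW// lerBrDl natr1 ler_nat.
    have {iNm}mi : (m < i)%N by rewrite ltn_neqAle eq_sym iNm.
    by rewrite distrC ger0_norm ?subr_ge0 ?ler_nat 1?ltnW// lerBrDl natr1 ler_nat.
  by rewrite ger0_norm//; lra.
have odd_bump m : iter m.*2.+1 (coin 1) bump 0 = 0.
  rewrite iter_coin_bin big1 ?mulr0// => i _; rewrite bump1 ?mulr0// add0r.
  have -> : (m.*2.+1)%:R = 2 * m%:R + 1 :> R by rewrite -natr1 -mul2n natrM.
  have [im|mi] := leqP i m.
    have : (i%:R <= m%:R :> R) by rewrite ler_nat.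
    by move=> ?; rewrite ger0_norm; lra.
  have : (m%:R + 1 <= i%:R :> R) by rewrite natr1 ler_nat.
  by move=> ?; rewrite ler0_norm; lra.
have E m : iter m.*2 (coin 1) (fun x => `|x|) 0 = m%:R * 2 * return_prob m.
  elim: m => [|m IH]; first by rewrite /= normr0 !mul0r.
  rewrite doubleS step step odd_bump addr0 IH even_bump return_probS.
  rewrite -[m.+1%:R]natr1; field.
  have m0 : (0 : R) <= m%:R by [].
  by rewrite gt_eqF//; lra.
have [e|o] := boolP (~~ odd n).
  have n2 : n = (n./2).*2 by rewrite -[LHS]odd_double_half (negbTE e).
  by rewrite n2 E uphalf_double.
have n2 : n = (n./2).*2.+1 by rewrite -[LHS]odd_double_half (negbNE o).
move: (n./2) n2 => k ->.
have -> : uphalf k.*2.+1 = k.+1 by rewrite uphalfE /= doubleK.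
by rewrite -E doubleS [RHS]step odd_bump addr0.
Qed.

End coin_walk.

Section coin_walk_asymptotics.
Context {R : realType}.
Local Open Scope ring_scope.

Lemma iter_coin_normr_sqr_bounds n : (0 < n)%N ->
  2 / pi - 4 / pi / n%:R <= iter n (coin 1) (fun x : R => `|x|) 0 ^+ 2 / n%:R
    <= 2 / pi + 4 / pi / n%:R.
Proof.
move=> n0; rewrite iter_coin_normr; set m := uphalf n.
have nm : n%:R <= 2 * m%:R :> R by rewrite -natrM ler_nat /m; lia.
have mn : 2 * m%:R <= n%:R + 1 :> R by rewrite -natrM natr1 ler_nat /m; lia.
have m1 : 1 <= m%:R :> R by rewrite ler1n /m; lia.
have n1 : 1 <= n%:R :> R by rewrite ler1n.
have /andP[lo up] := @return_prob_bounds R m.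
have pi0 := @pi_gt0 R.
set x := m%:R in nm mn m1 lo up *; set y := n%:R in nm mn n1 *.
set p2 := return_prob m ^+ 2 in lo up.
have -> : (x * 2 * return_prob m) ^+ 2 = 4 * x ^+ 2 * p2 by rewrite /p2; ring.
have y0 : 0 < y by lra.
have x2 : 0 <= 4 * x ^+ 2 by rewrite mulr_ge0// sqr_ge0.
have a0 : 0 < 2 * x + 1 by lra.
clearbody x y p2; move: (pi : R) pi0 lo up => q pi0 lo up.
apply/andP; split.
  rewrite ler_pdivlMr//; apply: le_trans (ler_wpM2l x2 lo).
  have -> : (2 / q - 4 / q / y) * y = (2 * y - 4) / q.
    by field; rewrite ?(gt_eqF y0) ?(gt_eqF pi0) ?(gt_eqF a0).
  have -> : 4 * x ^+ 2 * (2 / q / (2 * x + 1)) = (8 * x ^+ 2 / (2 * x + 1)) / q.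
    by field; rewrite ?(gt_eqF y0) ?(gt_eqF pi0) ?(gt_eqF a0).
  rewrite ler_pM2r ?invr_gt0// ler_pdivlMr//; nra.
rewrite ler_pdivrMr//; apply: le_trans (ler_wpM2l x2 up) _.
have -> : (2 / q + 4 / q / y) * y = (2 * y + 4) / q.
  by field; rewrite ?(gt_eqF y0) ?(gt_eqF pi0) ?(gt_eqF a0).
have -> : 4 * x ^+ 2 * (2 / q / (2 * x + 1) * ((2 * x + 2) / (2 * x + 1))) =
    (8 * x ^+ 2 * (2 * x + 2) / (2 * x + 1) ^+ 2) / q.
  by field; rewrite ?(gt_eqF y0) ?(gt_eqF pi0) ?(gt_eqF a0).
rewrite ler_pM2r ?invr_gt0// ler_pdivrMr ?exprn_gt0//.
apply: le_trans (_ : _ <= (4 * x + 2) * (2 * x + 1) ^+ 2) _; first nra.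
by rewrite ler_pM2r ?exprn_gt0//; lra.
Qed.

Lemma iter_coin_normr_asymp :
  iter n (coin 1) (fun x : R => `|x|) 0 / Num.sqrt n%:R @[n --> \oo] -->
  Num.sqrt (2 / pi : R).
Proof.
have w0 n : 0 <= iter n (coin 1) (fun x : R => `|x|) 0.
  by rewrite iter_coin_normr mulr_ge0 ?mulr_ge0// ltW// return_prob_gt0.
have -> : (fun n => iter n (coin 1) (fun x : R => `|x|) 0 / Num.sqrt n%:R) =
    (fun n => Num.sqrt (iter n (coin 1) (fun x : R => `|x|) 0 ^+ 2 / n%:R)).
  by apply/funext => n; rewrite sqrtrM ?sqr_ge0// sqrtr_sqr ger0_norm// sqrtrV.
apply: (@continuous_cvg _ _ _ _ _ _ (@Num.sqrt R)); first exact: sqrt_continuous.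
have c0 (a : R) : a / n%:R @[n --> \oo] --> (0 : R).
  rewrite -[X in _ --> X](mulr0 a); apply: cvgM; first exact: cvg_cst.
  by rewrite -(cvg_shiftS (fun n => (n%:R)^-1 : R)); exact: cvg_harmonic.
apply: (@squeeze_cvgr _ _ _ _ (fun n => 2 / pi - 4 / pi / n%:R)
                              (fun n => 2 / pi + 4 / pi / n%:R)).
- by near=> n; apply: iter_coin_normr_sqr_bounds; near: n; exists 1%N.
- rewrite -[X in _ --> X]subr0; apply: cvgB; [exact: cvg_cst|exact: c0].
- rewrite -[X in _ --> X]addr0; apply: cvgD; [exact: cvg_cst|exact: c0].
Unshelve. all: by end_near. Qed.

End coin_walk_asymptotics.

(** * Test functions with a cubic remainder *)

Section cubic_taylor.
Context {R : realType}.
Local Open Scope ring_scope.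
Implicit Types (f : R -> R) (c h s L : R).

(** The constant [L] is uniform in the base point, so that averages of
    translates stay in the class; the coefficients [a] and [b] stand for the
    derivatives. *)
Definition cubic_taylor L f := forall c, exists a b, forall h,
  `|f (c + h) - f c - a * h - b * h ^+ 2| <= L * `|h| ^+ 3.

Lemma cubic_taylor_coin L s f : cubic_taylor L f -> cubic_taylor L (coin s f).
Proof.
move=> Lf c; have [a1 [b1 H1]] := Lf (c + s); have [a2 [b2 H2]] := Lf (c - s).
exists ((a1 + a2) / 2), ((b1 + b2) / 2) => h.
have -> : coin s f (c + h) - coin s f c - (a1 + a2) / 2 * h - (b1 + b2) / 2 * h ^+ 2 =
    ((f (c + s + h) - f (c + s) - a1 * h - b1 * h ^+ 2) +
     (f (c - s + h) - f (c - s) - a2 * h - b2 * h ^+ 2)) / 2.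
  by rewrite /coin [c + h + s]addrAC [c + h - s]addrAC; field.
rewrite normrM [X in _ * X]ger0_norm ?invr_ge0// ler_pdivrMr//.
apply: le_trans (ler_normD _ _) _.
by have := H1 h; have := H2 h; lra.
Qed.

(** A smooth function within [e] of [2 * max x 0]. *)
Definition smooth_pos (e x : R) : R := x + Num.sqrt (x ^+ 2 + e ^+ 2).

Lemma smooth_pos_ge e x : x + `|x| <= smooth_pos e x.
Proof. by rewrite lerD2l -sqrtr_sqr ler_sqrt ?addr_ge0 ?sqr_ge0// lerDl sqr_ge0. Qed.

Lemma smooth_pos_ge0 e x : 0 <= smooth_pos e x.
Proof.
apply: le_trans (smooth_pos_ge e x).
by rewrite -lerBlDl sub0r; have := ler_norm (- x); rewrite normrN.
Qed.

Lemma smooth_pos_le e x : 0 <= e -> smooth_pos e x <= x + `|x| + e.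
Proof.
move=> e0; rewrite -addrA lerD2l -(@ler_pXn2r _ 2)// ?nnegrE ?sqrtr_ge0 ?addr_ge0//.
rewrite sqr_sqrtr ?addr_ge0 ?sqr_ge0// sqrrD real_normK ?num_real// lerD2r lerDl.
by rewrite mulrn_wge0// mulr_ge0.
Qed.

(** Let [A] and [B] be the values of [sqrt (x ^ 2 + e ^ 2)] at [c] and [c + h].
    As [B ^ 2] is a polynomial in [h], the remainder is a polynomial in [A],
    [B - A], [c] and [h] over [8 * A ^ 3], which gives the bound if [|h| <= A];
    otherwise the terms of the expansion are bounded separately. *)
Lemma cubic_taylor_smooth_pos e : 0 < e -> cubic_taylor (3 / e ^+ 2) (smooth_pos e).
Proof.
move=> e0 c; set A := Num.sqrt (c ^+ 2 + e ^+ 2).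
have ce0 x : 0 < x ^+ 2 + e ^+ 2 by rewrite ltr_wpDl ?sqr_ge0// exprn_gt0.
have A0 : 0 < A by rewrite sqrtr_gt0.
have A2 : A ^+ 2 = c ^+ 2 + e ^+ 2 by rewrite sqr_sqrtr// ltW.
have cA : `|c| <= A.
  by rewrite -sqrtr_sqr /A ler_sqrt ?(ltW (ce0 _))// lerDl sqr_ge0.
exists (1 + c / A), (e ^+ 2 / (2 * A ^+ 3)) => h.
set B := Num.sqrt ((c + h) ^+ 2 + e ^+ 2).
have B0 : 0 < B by rewrite sqrtr_gt0.
have B2 : B ^+ 2 = A ^+ 2 + 2 * c * h + h ^+ 2.
  by rewrite sqr_sqrtr ?ltW// A2; ring.
have BA : `|B - A| <= `|h|.
  (* the square root of [x ^ 2 + e ^ 2] is 1-Lipschitz *)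
  have E : (B - A) * (B + A) = h * ((c + h) + c).
    by rewrite -subr_sqr B2; ring.
  have chB : `|c + h| <= B.
    by rewrite -sqrtr_sqr /B ler_sqrt ?(ltW (ce0 _))// lerDl sqr_ge0.
  have AB0 : 0 < B + A by rewrite addr_gt0.
  rewrite -(ler_pM2r AB0) -{1}(gtr0_norm AB0) -normrM E normrM ler_wpM2l//.
  by apply: le_trans (ler_normD _ _) _; rewrite lerD.
rewrite /smooth_pos -/A -/B.
have eA : e ^+ 2 <= A ^+ 2 by rewrite A2 lerDr sqr_ge0.
have e2 : 0 < e ^+ 2 by rewrite exprn_gt0.
have A20 : 0 < A ^+ 2 by rewrite exprn_gt0.
suff H : `|B - A - c / A * h - e ^+ 2 / (2 * A ^+ 3) * h ^+ 2| <= 3 / A ^+ 2 * `|h| ^+ 3.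
  apply: le_trans (_ : _ <= 3 / A ^+ 2 * `|h| ^+ 3) _.
    by apply: le_trans H; rewrite le_eqVlt; apply/orP; left; apply/eqP; congr `|_|; ring.
  by rewrite ler_wpM2r ?exprn_ge0// ler_wpM2l// lef_pV2 ?posrE.
have h0 := normr_ge0 h.
have [hA|Ah] := leP `|h| A.
  have -> : B - A - c / A * h - e ^+ 2 / (2 * A ^+ 3) * h ^+ 2 =
     ((B - A) ^+ 3 * (B + 3 * A) - 4 * c * h ^+ 3 - h ^+ 4) / (8 * A ^+ 3).
    have e2E : e ^+ 2 = A ^+ 2 - c ^+ 2 by rewrite A2; ring.
    have -> : (B - A) ^+ 3 * (B + 3 * A) =
       (B ^+ 2) ^+ 2 - 6 * A ^+ 2 * B ^+ 2 + 8 * A ^+ 3 * B - 3 * A ^+ 4 by ring.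
    by rewrite B2 e2E; field; rewrite gt_eqF.
  have A3 : 0 < 8 * A ^+ 3 by rewrite mulr_gt0// exprn_gt0.
  rewrite normrM [X in _ * X]gtr0_norm ?invr_gt0// ler_pdivrMr//.
  have -> : 3 / A ^+ 2 * `|h| ^+ 3 * (8 * A ^+ 3) = 24 * A * `|h| ^+ 3.
    by field; rewrite gt_eqF.
  have h3 : 0 <= `|h| ^+ 3 by rewrite exprn_ge0.
  have BA3 : `|B - A| ^+ 3 <= `|h| ^+ 3 by rewrite lerXn2r ?nnegrE.
  have BlA : B <= 2 * A.
    by move: BA; rewrite ler_norml => /andP[_]; lra.
  apply: le_trans (ler_normB _ _) _; rewrite normrX.
  have t1 : `|(B - A) ^+ 3 * (B + 3 * A) - 4 * c * h ^+ 3| <= 9 * A * `|h| ^+ 3.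
    apply: le_trans (ler_normB _ _) _.
    have -> : `|(B - A) ^+ 3 * (B + 3 * A)| = `|B - A| ^+ 3 * (B + 3 * A).
      have B3 : 0 <= B + 3 * A by lra.
      by rewrite normrM normrX (ger0_norm B3).
    have -> : `|4 * c * h ^+ 3| = 4 * `|c| * `|h| ^+ 3.
      by rewrite normrM normrX normrM ger0_norm.
    have : `|B - A| ^+ 3 * (B + 3 * A) <= `|h| ^+ 3 * (5 * A).
      by apply: ler_pM => //; lra.
    have : 4 * `|c| * `|h| ^+ 3 <= 4 * A * `|h| ^+ 3.
      by rewrite ler_wpM2r// ler_wpM2l.
    lra.
  have t2 : `|h| ^+ 4 <= A * `|h| ^+ 3 by rewrite exprS ler_wpM2r.
  have := mulr_ge0 (ltW A0) h3; lra.
have t1 : `|c / A * h| <= `|h|.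
  rewrite normrM ler_piMl// normrM normfV (gtr0_norm A0).
  by rewrite ler_pdivrMr// mul1r.
have t2 : `|e ^+ 2 / (2 * A ^+ 3) * h ^+ 2| <= `|h| ^+ 2 / (2 * A).
  rewrite normrM normrX (@ger0_norm _ (_ / _)); last first.
    by rewrite divr_ge0 ?sqr_ge0// mulr_ge0// exprn_ge0// ltW.
  rewrite mulrC ler_wpM2l ?exprn_ge0//.
  rewrite ler_pdivrMr ?mulr_gt0 ?exprn_gt0//.
  have -> : (2 * A)^-1 * (2 * A ^+ 3) = A ^+ 2 by field; rewrite gt_eqF.
  by [].
apply: le_trans (_ : _ <= `|h| + `|h| + `|h| ^+ 2 / (2 * A)) _.
  apply: le_trans (ler_normB _ _) _; apply: lerD => //.
  by apply: le_trans (ler_normB _ _) _; apply: lerD.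
have -> : 3 / A ^+ 2 * `|h| ^+ 3 = `|h| * (3 * (`|h| / A) ^+ 2).
  by field; rewrite gt_eqF.
have -> : `|h| + `|h| + `|h| ^+ 2 / (2 * A) = `|h| * (2 + (`|h| / A) / 2).
  by field; rewrite gt_eqF.
rewrite ler_wpM2l//.
have : 1 <= `|h| / A by rewrite ler_pdivlMr// mul1r ltW.
set r := `|h| / A; nra.
Qed.

End cubic_taylor.

(** * Sums of independent variables *)

Section independence.
Context {R : realType} d (T : measurableType d) (P : probability T R).
Context d' (U : measurableType d') (mu : probability U R).
Variable Y : nat -> T -> U.
Hypothesis mY : forall k, measurable_fun setT (Y k).
Hypothesis Y_law : forall k A, measurable A -> P (Y k @^-1` A) = mu A.
Hypothesis Y_indep : forall (J : {fset nat}) (A : nat -> set U),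
  (forall k, k \in J -> measurable (A k)) ->
  P (\bigcap_(k in [set` J]) (Y k @^-1` A k)) =
  \big[*%E/1]_(k <- J) P (Y k @^-1` A k).
Implicit Types (s : seq nat) (k : nat).

(** A pi-system generating the events of the past, on which independence is a
    product formula. *)
Definition rectangles s : set (set T) :=
  [set E | exists2 A : nat -> set U, (forall k, measurable (A k)) &
    E = \bigcap_(k in [set` s]) (Y k @^-1` A k)].

Lemma rectangles_setI s : setI_closed (rectangles s).
Proof.
move=> _ _ [A mA ->] [B mB ->]; exists (fun k => A k `&` B k).
  by move=> k; exact: measurableI.
apply/seteqP; split => w /=.
  by move=> [hA hB] k ks; split; [exact: hA|exact: hB].
by move=> h; split => k ks; have [] := h k ks.
Qed.

Lemma rectangles_setT s : rectangles s setT.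
Proof. by exists (fun=> setT) => //; apply/seteqP; split. Qed.

Lemma rectangles_preimage s j A : j \in s -> measurable A ->
  rectangles s (Y j @^-1` A).
Proof.
move=> js mA; exists (fun k => if k == j then A else setT).
  by move=> k; case: ifP.
apply/seteqP; split => w /= h.
  by move=> k _; rewrite /preimage/=; case: eqP => // ->.
by have := h j js; rewrite /preimage/= eqxx.
Qed.

Lemma measurable_rectangles s : rectangles s `<=` measurable.
Proof.
move=> _ [A mA ->]; apply: bigcap_measurableType => k _.
exact: measurable_preimage.
Qed.

(** The same points as [T], with the smaller sigma-algebra of the variables
    indexed by [s]: Fubini's theorem applies to functions of these and of one
    more variable. *)
Definition past s : measurableType _ := g_sigma_algebraType (rectangles s).

Lemma measurable_past s (A : set (past s)) : measurable A ->
  measurable (A : set T).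
Proof.
have H := @smallest_sub _ (sigma_algebra setT) (rectangles s) (@measurable _ T)
  (sigma_algebra_measurable T) (@measurable_rectangles s).
exact: H.
Qed.

Lemma measurable_fun_past d2 (V : measurableType d2) s (f : past s -> V) :
  measurable_fun setT f -> measurable_fun setT (f : T -> V).
Proof.
move=> mf _ A mA; rewrite setTI; apply: (@measurable_past s).
exact: measurable_preimage mf mA.
Qed.

Lemma measurable_past_coord s j : j \in s ->
  measurable_fun setT (Y j : past s -> U).
Proof.
move=> js _ A mA; rewrite setTI; apply: sub_sigma_algebra.
exact: rectangles_preimage.
Qed.

Let indep_rectangles s k E B : k \notin s -> rectangles s E -> measurable B ->
  P (E `&` Y k @^-1` B) = P E * mu B.
Proof.
move=> ks [A mA ->] mB.
pose J := [fset j | j in s]%fset.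
have JE j : (j \in J) = (j \in s) by rewrite !inE.
have kJ : k \notin J by rewrite JE.
pose A' j := if j == k then B else A j.
have mA' j : measurable (A' j) by rewrite /A'; case: ifP.
have E1 : \bigcap_(j in [set` s]) (Y j @^-1` A j) =
    \bigcap_(j in [set` J]) (Y j @^-1` A j).
  by apply/seteqP; split => w h j /=; move: (h j); rewrite /= JE.
have E2 : \bigcap_(j in [set` J]) (Y j @^-1` A j) `&` Y k @^-1` B =
    \bigcap_(j in [set` (k |` J)%fset]) (Y j @^-1` A' j).
  apply/seteqP; split => w /=.
    move=> [h1 h2] j /=; rewrite !inE => /orP[/eqP->|js].
      by rewrite /preimage/= /A' eqxx.
    have jk : j != k by apply: contraNneq ks => <-.
    by rewrite /preimage/= /A' (negbTE jk); apply: h1; rewrite /= JE.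
  move=> h; split.
    move=> j /= jJ; have jk : j != k by apply: contraNneq kJ => <-.
    have := h j; rewrite /= in_fset1U jJ orbT => /(_ isT).
    by rewrite /preimage/= /A' (negbTE jk).
  have := h k; rewrite /= in_fset1U eqxx => /(_ isT).
  by rewrite /preimage/= /A' eqxx.
rewrite E1 E2 !Y_indep//.
rewrite big_fsetU1//= muleC -(Y_law k mB) /A' eqxx; congr (_ * _).
rewrite big_seq [RHS]big_seq; apply: eq_bigr => j jJ.
by rewrite ifN//; apply: contraNneq kJ => <-.
Qed.

(** Both sides are finite measures of [E] that agree on the rectangles. *)
Lemma indep_past s k (E : set (past s)) B : k \notin s -> measurable E ->
  measurable B -> P (E `&` Y k @^-1` B) = P E * mu B.
Proof.
move=> ks mE mB.
have mYB : measurable (Y k @^-1` B) by exact: measurable_preimage.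
have b0 : (0 <= fine (mu B))%R by rewrite fine_ge0.
pose m1 : {measure set T -> \bar R} := mrestr P mYB.
pose m2 : {measure set T -> \bar R} := mscale (NngNum b0) P.
have m2E A : m2 A = P A * mu B.
  rewrite /m2/= /mscale/= muleC fineK//.
  by rewrite ge0_fin_numE// (le_lt_trans (probability_le1 _ mB))// ltry.
rewrite -m2E -[LHS]/(m1 E).
apply: (@g_sigma_algebra_measure_unique _ _ _ (rectangles s) _ (fun=> setT)) => //.
- exact: measurable_rectangles.
- by move=> _; exact: rectangles_setT.
- by apply/seteqP; split => // x _; exists 0%N.
- exact: rectangles_setI.
- move=> A rA; rewrite m2E /m1/= /mrestr; exact: (indep_rectangles ks rA mB).
- move=> _; rewrite /m1 /= /mrestr; apply: le_lt_trans (probability_le1 _ _) _.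
    by rewrite setTI.
  exact: ltry.
Qed.

Lemma integral_cst_prob d2 (V : measurableType d2) (Q : probability V R) (r : R) :
  \int[Q]__ r%:E = r%:E.
Proof.
rewrite integral_cst// [X in _ * X](_ : _ = 1) ?mule1//.
exact: probability_setT.
Qed.

Let iota s : T -> past s := id.

Let miota s : measurable_fun setT (iota s).
Proof. by move=> _ A mA; rewrite setTI; exact: measurable_past mA. Qed.

Lemma ge0_integral_past s (f : past s -> \bar R) :
  measurable_fun setT f -> (forall w, 0 <= f w) ->
  \int[pushforward P (iota s)]_w f w = \int[P]_w f w.
Proof.
move=> mf f0.
by rewrite (ge0_integral_pushforward (@miota s)).
Qed.

(** By [indep_past] the past and the further variable have the product law. *)
Lemma integral_indep1 s k (F : past s * U -> \bar R) : k \notin s ->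
  measurable_fun setT F -> (forall x, 0 <= F x) ->
  \int[P]_w F (w, Y k w) = \int[P]_w \int[mu]_u F (w, u).
Proof.
move=> ks mF F0.
pose pair_ w : past s * U := (w, Y k w).
have mpair : measurable_fun setT pair_.
  by apply: measurable_fun_pair => //; exact: miota.
pose iota' : {mfun T >-> past s} := HB.pack (iota s)
  (isMeasurableFun.Build _ _ _ _ (iota s) (@miota s)).
pose P' := distribution P iota'.
have E A : measurable A -> (P' \x mu) A = pushforward P pair_ A.
  move=> mA.
  apply: (@product_measure_unique _ _ _ _ R P' mu
     (pushforward P pair_ : {measure set (past s * U) -> \bar R})) => //.
  by move=> A1 A2 mA1 mA2; exact: (indep_past ks mA1 mA2).
have := @ge0_integral_pushforward _ _ _ _ R _ mpair P setT F measurableT mF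
  (fun x _ => F0 x).
rewrite preimage_setT => <-.
transitivity (\int[P' \x mu]_x F x).
  apply: eq_measure_integral => A mA _; exact/esym/E.
rewrite fubini_tonelli1//.
apply: (@ge0_integral_past s (fun w => \int[mu]_u F (w, u))).
  exact: measurable_fun_fubini_tonelli_F.
by move=> w; exact: integral_ge0.
Qed.

Lemma integral_indep2 s k (F : past s * U -> \bar R) : k \notin s ->
  measurable_fun setT F -> (forall x, 0 <= F x) ->
  \int[P]_w F (w, Y k w) = \int[mu]_u \int[P]_w F (w, u).
Proof.
move=> ks mF F0; rewrite (integral_indep1 ks)//.
pose iota' : {mfun T >-> past s} := HB.pack (iota s)
  (isMeasurableFun.Build _ _ _ _ (iota s) (@miota s)).
pose P' := distribution P iota'.
transitivity (\int[P']_w \int[mu]_u F (w, u)).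
  symmetry; apply: ge0_integral_past; last by move=> w; exact: integral_ge0.
  exact: measurable_fun_fubini_tonelli_F.
rewrite (@fubini_tonelli _ _ _ _ R P' mu)//.
apply: eq_integral => u _.
apply: (@ge0_integral_past s (fun w => F (w, u))) => //.
exact: measurable_fun_pair1.
Qed.

Lemma measurable_past_sum d2 (V : measurableType d2) s (g : V * U -> R) :
  measurable_fun setT g ->
  measurable_fun setT
    (fun x : past s * V => \sum_(j <- s) g (x.2, Y j x.1))%R.
Proof.
move=> mg.
suff H t : {subset t <= s} -> measurable_fun setT
    (fun x : past s * V => \sum_(j <- t) g (x.2, Y j x.1))%R by exact: H.
elim: t => [|j t IH] ts.
  by under eq_fun do rewrite big_nil; exact: measurable_cst.
under eq_fun do rewrite big_cons.
apply: measurable_funD; last by apply: IH => i it; apply: ts; rewrite inE it orbT.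
apply: (measurableT_comp mg); apply: measurable_fun_pair => //.
apply: (measurableT_comp (f := (Y j : past s -> U))) => //.
by apply: measurable_past_coord; apply: ts; rewrite inE eqxx.
Qed.

Section iid_sums.
Variable g : U -> R.
Hypothesis mg : measurable_fun setT g.

Let S s w := (\sum_(j <- s) g (Y j w))%R.

Lemma measurable_iid_sum s : measurable_fun setT (S s).
Proof.
rewrite /S; elim: s => [|j s IH]; first by under eq_fun do rewrite big_nil; exact: measurable_cst.
under eq_fun do rewrite big_cons.
by apply: measurable_funD => //; exact: measurableT_comp.
Qed.

Let measurable_past_iid_sum s : measurable_fun setT (S s : past s -> R).
Proof.
have mg2 : measurable_fun setT (g \o snd : unit * U -> R) by exact: measurableT_comp.
have H := @measurable_past_sum _ unit s (g \o snd) mg2.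
exact: (@measurable_fun_pair1 _ _ _ _ _ _ _ tt H).
Qed.

Lemma integral_iid_sumS s k (phi : R -> \bar R) : k \notin s ->
  measurable_fun setT phi -> (forall x, 0 <= phi x) ->
  \int[P]_w phi (S (k :: s) w) = \int[P]_w \int[mu]_u phi (g u + S s w)%R.
Proof.
move=> ks mphi phi0.
rewrite -(@integral_indep1 s k (fun x => phi (g x.2 + S s x.1)%R))//.
  by apply: eq_integral => w _; rewrite /S big_cons.
apply: (measurableT_comp mphi); apply: measurable_funD.
  exact: measurableT_comp.
exact: (measurableT_comp (@measurable_past_iid_sum s)).
Qed.

(** The hypothesis on [g] says at once that it has mean zero, so that cross
    terms vanish, and variance [v]. *)
Lemma integral_sqr_iid_sum (v : R) s (c : R) : uniq s -> (0 <= v)%R ->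
  (forall c, \int[mu]_u ((c + g u) ^+ 2)%:E = (c ^+ 2 + v)%:E) ->
  \int[P]_w ((c + S s w) ^+ 2)%:E = (c ^+ 2 + (size s)%:R * v)%:E.
Proof.
move=> + v0 Hg; elim: s => [_|k s IH /=/andP[ks us]].
  under eq_integral do rewrite /S big_nil addr0.
  by rewrite integral_cst_prob mul0r addr0.
rewrite (@integral_iid_sumS _ _ (fun x => ((c + x) ^+ 2)%:E))//; last 2 first.
- by apply/measurable_EFinP; apply: measurable_funX; exact: measurable_funD.
- by move=> x; rewrite lee_fin sqr_ge0.
transitivity (\int[P]_w (((c + S s w) ^+ 2)%:E + v%:E)).
  apply: eq_integral => w _; rewrite -EFinD -Hg; apply: eq_integral => u _.
  by congr (_ ^+ 2)%:E; ring.
rewrite ge0_integralD//=; last 2 first.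
- by move=> w _; rewrite lee_fin sqr_ge0.
- apply/measurable_EFinP; apply: measurable_funX; apply: measurable_funD => //.
  exact: measurable_iid_sum.
rewrite integral_cst_prob IH// -EFinD; congr EFin.
by rewrite -natr1; ring.
Qed.

Lemma chebyshev_iid_sum (v t : R) s : uniq s -> (0 <= v)%R -> (0 < t)%R ->
  (forall c, \int[mu]_u ((c + g u) ^+ 2)%:E = (c ^+ 2 + v)%:E) ->
  P [set w | (t <= `|S s w|)%R] <= ((size s)%:R * v / t ^+ 2)%:E.
Proof.
move=> us v0 t0 Hg.
have mS : measurable [set w | (t <= `|S s w|)%R].
  rewrite (_ : [set w | _] = (fun w => `|S s w|%R) @^-1` `[t, +oo[%classic).
    apply: measurable_preimage => //; apply: measurableT_comp => //.
    exact: measurable_iid_sum.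
  by apply/seteqP; split => w /=; rewrite in_itv/= andbT.
have mS2 D : measurable_fun D (fun w => ((S s w) ^+ 2)%:E).
  apply: measurable_funTS; apply/measurable_EFinP; apply: measurable_funX.
  exact: measurable_iid_sum.
have t2 : (0 < t ^+ 2)%R by rewrite exprn_gt0.
rewrite mulrC EFinM lee_pdivlMl//.
have := integral_sqr_iid_sum 0 us v0 Hg; rewrite expr0n add0r => <-.
under eq_integral do rewrite add0r.
apply: (@le_trans _ _ (\int[P]_(w in [set w | (t <= `|S s w|)%R]) ((S s w) ^+ 2)%:E)).
  rewrite -integral_cst//; apply: ge0_le_integral => //.
  - by move=> w _; rewrite lee_fin ltW.
  - by move=> w /= tS; rewrite lee_fin -[leRHS]real_normK ?num_real//; apply: lerXn2r; rewrite ?nnegrE// ltW.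
apply: ge0_subset_integral => // w _; by rewrite lee_fin sqr_ge0.
Qed.

End iid_sums.

(** The terms are exchanged one at a time, integrating out one variable and
    applying the induction hypothesis to the resulting function of the
    others. *)
Lemma iid_sum_law (g g' : U -> R) s (phi : R -> \bar R) : uniq s ->
  measurable_fun setT g -> measurable_fun setT g' ->
  (forall psi : R -> \bar R, measurable_fun setT psi -> (forall x, 0 <= psi x) ->
     \int[mu]_u psi (g u) = \int[mu]_u psi (g' u)) ->
  measurable_fun setT phi -> (forall x, 0 <= phi x) ->
  \int[P]_w phi (\sum_(j <- s) g (Y j w))%R =
  \int[P]_w phi (\sum_(j <- s) g' (Y j w))%R.
Proof.
move=> + mg mg' gg'.
elim: s phi => [|k s IH] phi /=; first by under eq_integral do rewrite big_nil;
  under [in RHS]eq_integral do rewrite big_nil.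
move=> /andP[ks us] mphi phi0.
have mshift (c : R) : measurable_fun setT (fun x : R => phi (x + c)%R).
  by apply: (measurableT_comp mphi); exact: measurable_funD.
rewrite (integral_iid_sumS mg ks mphi phi0) (integral_iid_sumS mg' ks mphi phi0).
transitivity (\int[P]_w \int[mu]_u phi (g' u + \sum_(j <- s) g (Y j w))%R).
  by apply: eq_integral => w _; exact: (gg' (fun x => phi (x + _)%R)).
apply: (IH (fun x => \int[mu]_u phi (g' u + x)%R)) => //; last first.
  by move=> x; exact: integral_ge0.
pose F (x : R * U) := phi (g' x.2 + x.1)%R.
have mF : measurable_fun setT F.
  apply: (measurableT_comp mphi); apply: measurable_funD => //.
  exact: measurableT_comp.
by apply: (@measurable_fun_fubini_tonelli_F _ _ _ _ _ mu F) => // x; exact: phi0.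
Qed.

(** Lindeberg's replacement argument: the terms are exchanged one at a time
    for steps of the coin walk. After an exchange the remaining terms see the
    test function averaged by [coin], which is still in the class
    [cubic_taylor L]. *)
Lemma lindeberg (g : U -> R) (s : seq nat) (L K sigma : R) :
  measurable_fun setT g -> (0 <= K)%R ->
  (forall psi : R -> R, measurable_fun setT psi -> (forall x, 0 <= psi x)%R ->
     cubic_taylor L psi -> forall c,
     (coin sigma psi c)%:E <= \int[mu]_u (psi (c + g u)%R)%:E + K%:E /\
     \int[mu]_u (psi (c + g u)%R)%:E <= (coin sigma psi c + K)%:E) ->
  uniq s -> forall psi : R -> R, measurable_fun setT psi ->
  (forall x, 0 <= psi x)%R -> cubic_taylor L psi -> forall c,
  (iter (size s) (coin sigma) psi c)%:E <=
    \int[P]_w (psi (c + \sum_(j <- s) g (Y j w))%R)%:E + ((size s)%:R * K)%:E /\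
  \int[P]_w (psi (c + \sum_(j <- s) g (Y j w))%R)%:E <=
    (iter (size s) (coin sigma) psi c + (size s)%:R * K)%:E.
Proof.
move=> mg K0 HK; elim: s => [_|k s IH /= /andP[ks us]] psi mpsi psi0 Lpsi c.
  under eq_integral do rewrite big_nil addr0.
  by rewrite integral_cst_prob/= !mul0r adde0 addr0.
have mcoin : measurable_fun setT (coin sigma psi).
  apply: measurable_funM => //; apply: measurable_funD;
  by apply: measurableT_comp => //; apply: measurable_funD.
have coin0 x : (0 <= coin sigma psi x)%R.
  by rewrite divr_ge0// addr_ge0.
have Lcoin := cubic_taylor_coin sigma Lpsi.
have [IH1 IH2] := IH us (coin sigma psi) mcoin coin0 Lcoin c.
have mphi : measurable_fun setT (fun x => (psi (c + x)%R)%:E).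
  apply/measurable_EFinP; apply: measurableT_comp => //; exact: measurable_funD.
rewrite (@integral_iid_sumS g mg s k (fun x => (psi (c + x)%R)%:E))//;
  last by move=> x; rewrite lee_fin.
set S := fun w => (\sum_(j <- s) g (Y j w))%R.
pose F x := \int[mu]_u (psi (c + (g u + x))%R)%:E.
have FE x : F x = \int[mu]_u (psi (c + x + g u)%R)%:E.
  by apply: eq_integral => u _; congr (psi _)%:E; ring.
rewrite -/S -[X in _ <= X + _ /\ X <= _]/(\int[P]_w F (S w)).
have F0 x : 0 <= F x by apply: integral_ge0 => u _; rewrite lee_fin.
have mFS : measurable_fun setT (fun w => F (S w)).
  apply: (@measurableT_comp _ _ _ _ _ _ F); last exact: measurable_iid_sum.
  pose G (x : R * U) := (psi (c + (g x.2 + x.1))%R)%:E.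
  have mG : measurable_fun setT G.
    apply/measurable_EFinP; apply: measurableT_comp => //.
    apply: measurable_funD => //; apply: measurable_funD => //.
    exact: measurableT_comp.
  by apply: (@measurable_fun_fubini_tonelli_F _ _ _ _ _ mu G) => // x; rewrite lee_fin.
have mcS : measurable_fun setT (fun w => (coin sigma psi (c + S w))%:E).
  apply/measurable_EFinP; apply: measurableT_comp => //.
  by apply: measurable_funD => //; exact: measurable_iid_sum.
have HK' x := HK psi mpsi psi0 Lpsi x.
rewrite -iterS iterSr -natr1 mulrDl mul1r; split.
  apply: (le_trans IH1); rewrite EFinD addeA addeAC leeD2r//.
  apply: (@le_trans _ _ (\int[P]_w (F (S w) + K%:E))).
    apply: ge0_le_integral => //.
    - by move=> w _; rewrite lee_fin.
    - by apply: emeasurable_funD.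
    - by move=> w _; rewrite FE; have [] := HK' (c + S w)%R.
  by rewrite ge0_integralD//= integral_cst_prob.
rewrite addrA EFinD.
apply: (@le_trans _ _ (\int[P]_w ((coin sigma psi (c + S w))%:E + K%:E))).
  apply: ge0_le_integral => //.
  - by apply: emeasurable_funD.
  - by move=> w _; rewrite FE -EFinD; have [] := HK' (c + S w)%R.
rewrite ge0_integralD//=; last by move=> w _; rewrite lee_fin.
by rewrite integral_cst_prob leeD2r.
Qed.

End independence.

(** * The logarithmic series under rotations *)

Section log_series.
Context {R : realType}.
Local Open Scope ring_scope.
Implicit Types p q u : plane R.

(** Multiplication of complex numbers. *)
Definition cmul p q : plane R := rotate p.1 p.2 q.
Definition cpow p k : plane R := iter k (cmul p) (1, 0).

Lemma cmulA p q u : cmul p (cmul q u) = cmul (cmul p q) u.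
Proof. by rewrite /cmul /rotate /=; congr pair; ring. Qed.

Lemma sqn_cmul p q : sqn (cmul p q) = sqn p * sqn q.
Proof. by rewrite /sqn /cmul /rotate /=; ring. Qed.

Lemma sqn_cpow p k : sqn (cpow p k) = sqn p ^+ k.
Proof.
elim: k => [|k IH]; first by rewrite /sqn /= expr0 expr1n expr0n/= addr0.
by rewrite /cpow iterS -/(cpow p k) sqn_cmul IH exprS.
Qed.

Lemma cpowS p k : cpow p k.+1 = cmul p (cpow p k). Proof. by []. Qed.

Lemma cpow_cmul p q k : cpow (cmul p q) k = cmul (cpow p k) (cpow q k).
Proof.
elim: k => [|k IH]; first by rewrite /cmul /rotate /=; congr pair; ring.
by rewrite !cpowS IH /cmul /rotate /=; congr pair; ring.
Qed.

Lemma cpowD p k l : cpow p (k + l) = cmul (cpow p k) (cpow p l).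
Proof.
elim: k => [|k IH]; first by rewrite add0n /cmul /rotate /=; case: (cpow p l) => a b /=; congr pair; ring.
by rewrite addSn !cpowS IH cmulA.
Qed.

Lemma cpow_cos (x : R) k : cpow (cos x, sin x) k = (cos (k%:R * x), sin (k%:R * x)).
Proof.
elim: k => [|k IH]; first by rewrite mul0r cos0 sin0.
rewrite cpowS IH /cmul /rotate/= -natr1 mulrDl mul1r cosD sinD.
by congr pair; ring.
Qed.

Lemma ler_norm_fst p : `|p.1| <= nrm p.
Proof.
by rewrite -sqrtr_sqr ler_sqrt ?addr_ge0 ?sqr_ge0// lerDl sqr_ge0.
Qed.

Lemma nrm_cpow p k : nrm (cpow p k) = nrm p ^+ k.
Proof.
apply/eqP; rewrite -(@eqrXn2 _ 2)// ?exprn_ge0 ?nrm_ge0//.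
by rewrite sqr_nrm sqn_cpow exprAC sqr_nrm.
Qed.

Lemma nrm_cmul p q : nrm (cmul p q) = nrm p * nrm q.
Proof.
apply/eqP; rewrite -(@eqrXn2 _ 2)// ?mulr_ge0 ?nrm_ge0//.
by rewrite exprMn !sqr_nrm sqn_cmul.
Qed.

(** The partial sums of the real part of [- log (1 - q)]. *)
Definition log_sum K q : R := \sum_(0 <= k < K) (cpow q k.+1).1 / k.+1%:R.

Lemma log_sumS K q : log_sum K.+1 q = log_sum K q + (cpow q K.+1).1 / K.+1%:R.
Proof. by rewrite /log_sum big_nat_recr. Qed.

Let D q (t : R) : R := 1 - t * 2 * q.1 + t ^+ 2 * sqn q.

Let DE q t : D q t = sqn (1 - t * q.1, - (t * q.2)).
Proof. by rewrite /D /sqn /=; ring. Qed.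

Let sqrt_D_ge q t : 0 <= t <= 1 -> nrm q < 1 ->
  1 - nrm q <= nrm (1 - t * q.1, - (t * q.2)).
Proof.
move=> /andP[t0 t1] q1.
have H := nrmD (1 - t * q.1, - (t * q.2)) (t * q.1, t * q.2).
have e1 : nrm (1, 0) = 1 :> R by rewrite /nrm /sqn/= expr1n expr0n/= addr0 sqrtr1.
have e2 : nrm (t * q.1, t * q.2) = t * nrm q.
  rewrite /nrm (_ : sqn _ = t ^+ 2 * sqn q); last by rewrite /sqn/=; ring.
  by rewrite sqrtrM ?sqr_ge0// sqrtr_sqr ger0_norm.
move: H; rewrite /= subrK addNr e1 e2 => H.
have : t * nrm q <= nrm q by rewrite ler_piMl ?nrm_ge0.
by move: H; lra.
Qed.

Let D_gt0 q t : 0 <= t <= 1 -> nrm q < 1 -> 0 < D q t.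
Proof.
move=> t01 q1; rewrite DE -sqr_nrm exprn_gt0//.
by apply: lt_le_trans (sqrt_D_ge t01 q1); rewrite subr_gt0.
Qed.

(** Along the segment from [0] to [q] the derivative of the remainder is a
    geometric tail. *)
Lemma ln_dst_series K q (rho : R) : nrm q <= rho -> rho < 1 ->
  `|ln (dst (1, 0) q) + log_sum K q| <= rho ^+ K.+1 / (1 - rho).
Proof.
move=> qr r1; have q1 : nrm q < 1 by exact: le_lt_trans r1.
(* [G K] is the remainder at [t * q]; its derivative [dG K] is the real part of
   [- t ^ K * q ^ K.+1 / (1 - t * q)]. *)
pose G K (t : R) := ln (D q t) / 2 + \sum_(0 <= k < K) (cpow q k.+1).1 / k.+1%:R * t ^+ k.+1.
pose dG K (t : R) := - (t ^+ K * (cmul (cpow q K.+1) (1 - t * q.1, t * q.2)).1) / D q t.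
have dGE (t : R) : 0 <= t <= 1 -> is_derive t (1 : R) (G K) (dG K t).
  move=> t01; have D0 := D_gt0 t01 q1.
  elim: K => [|k IH].
    have dD : is_derive t (1 : R) (D q) (- (2 * q.1) + (2 * t) * sqn q).
      have H : is_derive t (1 : R) (cst 1 - (2 * q.1) \*: id + sqn q \*: (id ^+ 2))
        (0 - (2 * q.1) *: 1 + sqn q *: ((2%:R * t ^+ 1) *: 1)) by apply: is_deriveD.
      have -> : D q = cst 1 - (2 * q.1) \*: id + sqn q \*: (id ^+ 2).
        apply/funext => x; rewrite /D.
        by transitivity (1 - (2 * q.1) * x + sqn q * x ^+ 2); first ring.
      apply: is_derive_eq H _.
      transitivity (0 - (2 * q.1) * 1 + sqn q * ((2%:R * t ^+ 1) * 1)); first by [].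
      by ring.
    have dL : is_derive t (1 : R) ((@ln R) \o D q) ((D q t)^-1 * (- (2 * q.1) + (2 * t) * sqn q)).
      exact: (is_derive1_comp (is_derive1_ln D0) dD).
    have -> : G 0 = 2^-1 \*: ((@ln R) \o D q).
      by apply/funext => x; rewrite /G big_geq// addr0 mulrC.
    have H : is_derive t (1 : R) (2^-1 \*: ((@ln R) \o D q))
       (2^-1 *: ((D q t)^-1 * (- (2 * q.1) + (2 * t) * sqn q))) by apply: is_deriveZ.
    apply: is_derive_eq H _.
    transitivity (2^-1 * ((D q t)^-1 * (- (2 * q.1) + (2 * t) * sqn q))); first by [].
    rewrite /dG /cpow /cmul /rotate /= /sqn.
    by field; rewrite gt_eqF.
  have -> : G k.+1 = G k + ((cpow q k.+1).1 / k.+1%:R) \*: (id ^+ k.+1).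
    apply/funext => x; rewrite /G big_nat_recr//= addrA.
    have idX m : (@id R ^+ m) x = x ^+ m.
      by elim: m => [//|m IHm]; rewrite !exprS -IHm.
    transitivity (ln (D q x) / 2 + \sum_(0 <= i < k) (cpow q i.+1).1 / i.+1%:R * x ^+ i.+1 +
      (cpow q k.+1).1 / k.+1%:R * (@id R ^+ k.+1) x); last by [].
    by rewrite idX.
  have H : is_derive t (1 : R) (G k + ((cpow q k.+1).1 / k.+1%:R) \*: (id ^+ k.+1))
     (dG k t + ((cpow q k.+1).1 / k.+1%:R) *: ((k.+1%:R * t ^+ k) *: 1)) by apply: is_deriveD.
  apply: is_derive_eq H _.
  transitivity (dG k t + ((cpow q k.+1).1 / k.+1%:R) * ((k.+1%:R * t ^+ k) * 1)); first by [].
  rewrite /dG (cpowS _ k.+1).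
  move: (cpow q k.+1) => A; rewrite exprS /cmul /rotate/=.
  have DE' : D q t = 1 - t * 2 * q.1 + t ^+ 2 * (q.1 ^+ 2 + q.2 ^+ 2) by [].
  have k0 : (k.+1%:R : R) != 0 by rewrite pnatr_eq0.
  rewrite DE' in D0 *; move: (k.+1%:R : R) k0 (t ^+ k) => n k0 T.
  by field; rewrite k0 gt_eqF.
have cG : {within `[0, 1], continuous (G K)}.
  apply: continuous_in_subspaceT => t; rewrite inE/= in_itv/= => /dGE H.
  by apply: differentiable_continuous; apply/derivable1_diffP; apply: ex_derive.
have [|c c01 Gc] := @MVT R (G K) (dG K) 0 1 ltr01 _ cG.
  by move=> t; rewrite in_itv/= => /andP[t0 t1]; apply: dGE; rewrite !ltW.
have G0 : G K 0 = 0.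
  rewrite /G /D mul0r mul0r expr0n mul0r subr0 addr0 ln1 mul0r add0r.
  by apply: big1 => k _; rewrite expr0n mulr0.
have G1 : G K 1 = ln (dst (1, 0) q) + log_sum K q.
  rewrite /G /log_sum; congr (_ + _); last by apply: eq_bigr => k _; rewrite expr1n mulr1.
  have d0 : 0 < dst (1, 0) q.
    rewrite lt_neqAle dst_ge0 eq_sym dst_eq0 andbT; apply/eqP => qE.
    by move: q1; rewrite qE /nrm /sqn/= expr1n expr0n/= addr0 sqrtr1 ltxx.
  have -> : D q 1 = dst (1, 0) q ^+ 2 by rewrite /dst sqr_nrm /D /sqn/=; ring.
  by rewrite lnXn// -[X in X / _]mulr_natr mulfK.
rewrite -G1 -[G K 1]subr0 -G0 Gc subr0 mulr1.
move: c01; rewrite in_itv/= => /andP[c0 c1].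
have c01 : 0 <= c <= 1 by rewrite !ltW.
have Dc := D_gt0 c01 q1.
rewrite /dG normrM normrN normrM normfV (gtr0_norm Dc) normrX (gtr0_norm c0).
set v := (1 - c * q.1, c * q.2).
have vD : nrm v ^+ 2 = D q c by rewrite sqr_nrm DE /sqn /v/= sqrrN.
have v1 : 1 - nrm q <= nrm v.
  have := sqrt_D_ge c01 q1; rewrite /nrm.
  by rewrite (_ : sqn (1 - c * q.1, - (c * q.2)) = sqn v)// /sqn/= sqrrN.
have v0 : 0 < nrm v by apply: lt_le_trans v1; rewrite subr_gt0.
have H1 : `|(cmul (cpow q K.+1) v).1| <= rho ^+ K.+1 * nrm v.
  apply: le_trans (ler_norm_fst _) _; rewrite nrm_cmul nrm_cpow.
  by rewrite ler_wpM2r ?nrm_ge0// lerXn2r ?nnegrE ?nrm_ge0// (le_trans (nrm_ge0 q)).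
have rho0 : 0 <= rho by exact: le_trans (nrm_ge0 q) qr.
rewrite -vD ler_pdivrMr ?exprn_gt0//.
apply: le_trans (_ : _ <= rho ^+ K.+1 * nrm v) _.
  rewrite -[leRHS]mul1r ler_pM ?exprn_ge0 ?normr_ge0// ?(ltW c0)//.
  by rewrite exprn_ile1// ltW.
rewrite expr2 mulrA ler_wpM2r ?(ltW v0)// -mulrA ler_peMr ?exprn_ge0//.
by rewrite mulrC ler_pdivlMr ?subr_gt0// mul1r; apply: le_trans v1; rewrite lerB.
Qed.

Lemma cvg_geometric0 (B rho : R) : 0 <= rho < 1 ->
  B * rho ^+ n @[n --> \oo] --> (0 : R).
Proof.
move=> /andP[r0 r1]; rewrite -[X in _ --> X](mulr0 B).
by apply: cvgM; [exact: cvg_cst | apply: cvg_expr; rewrite ger0_norm].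
Qed.

Lemma le_geometric0 (x B rho : R) : 0 <= rho < 1 ->
  (forall n, x <= B * rho ^+ n) -> x <= 0.
Proof.
move=> r01 H; have cv := @cvg_geometric0 B rho r01; rewrite -(cvg_lim _ cv)//.
by apply: limr_ge; [apply/cvg_ex; exists 0|exact: nearW].
Qed.

End log_series.

Section bounded_expectations.
Context {R : realType} d (T : measurableType d) (mu : probability T R).
Implicit Types f g : T -> R.

Definition bounded_mfun f :=
  measurable_fun setT f /\ exists B : R, forall x, (`|f x| <= B)%R.

Lemma bounded_mfun_integrable f : bounded_mfun f -> mu.-integrable setT (EFin \o f).
Proof.
move=> [mf [B fB]]; apply: measurable_bounded_integrable => //.
  by apply: le_lt_trans (probability_le1 _ _) _ => //; exact: ltry.
exists B; split; first exact: num_real.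
by move=> M BM x _; rewrite /= (le_trans (fB x))// ltW.
Qed.

Lemma bounded_mfunD f g : bounded_mfun f -> bounded_mfun g ->
  bounded_mfun (fun x => f x + g x)%R.
Proof.
move=> [mf [B fB]] [mg [B' gB]]; split; first exact: measurable_funD.
exists (B + B')%R => x; exact: le_trans (ler_normD _ _) (lerD _ _).
Qed.

Lemma bounded_mfunM f g : bounded_mfun f -> bounded_mfun g ->
  bounded_mfun (fun x => f x * g x)%R.
Proof.
move=> [mf [B fB]] [mg [B' gB]]; split; first exact: measurable_funM.
by exists (B * B')%R => x; rewrite normrM ler_pM.
Qed.

Lemma bounded_mfun_cst (c : R) : bounded_mfun (fun=> c).
Proof. by split => //; exists `|c|%R. Qed.

Lemma Rintegral_cst_prob (c : R) : (\int[mu]__ c = c)%R.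
Proof. by rewrite /Rintegral integral_cst_prob. Qed.

End bounded_expectations.

Section rotation_averages.
Context {R : realType} (mu : probability (plane R) R).
Hypothesis mu_disc : disc_law mu.
Local Open Scope ring_scope.
Implicit Types p u : plane R.

Lemma Rintegral_rotate (a b : R) (f : plane R -> R) : a ^+ 2 + b ^+ 2 = 1 ->
  bounded_mfun f -> \int[mu]_p f (rotate a b p) = \int[mu]_p f p.
Proof.
move=> ab1 bf; have [mf [B fB]] := bf.
have bc := @bounded_mfun_cst R _ (plane R) B.
have bfr : bounded_mfun (fun p => f (rotate a b p)).
  split; first exact: measurableT_comp mf (measurable_rotate a b).
  by exists B => p.
apply: (@addIr _ (\int[mu]__ B)).
rewrite -!RintegralD//; try exact: bounded_mfun_integrable.
congr fine.
have f0 p : (0 <= (f p + B)%:E)%E.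
  by rewrite lee_fin -lerBlDr sub0r; move: (fB p); rewrite ler_norml => /andP[].
have mfB : measurable_fun setT (fun p => (f p + B)%:E).
  by apply/measurable_EFinP; exact: measurable_funD.
exact: (ge0_integral_rotate mu_disc ab1 mfB f0).
Qed.

(** The rotation by the angle [pi / m] changes the sign of [F]. *)
Lemma Rintegral_equivariant (m : nat) (F : plane R -> plane R) : (0 < m)%N ->
  bounded_mfun (fun p => (F p).1) ->
  (forall u p, sqn u = 1 -> F (cmul u p) = cmul (cpow u m) (F p)) ->
  \int[mu]_p (F p).1 = 0.
Proof.
move=> m0 bF HF.
pose x : R := pi / m%:R; pose u : plane R := (cos x, sin x).
have su : sqn u = 1 by rewrite /sqn cos2Dsin2.
have mx : m%:R * x = pi by rewrite /x mulrC divfK// pnatr_eq0 -lt0n.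
have um : cpow u m = (-1, 0) by rewrite /u cpow_cos mx cospi sinpi.
have FN p : (F (rotate u.1 u.2 p)).1 = - (F p).1.
  by rewrite -[rotate _ _ p]/(cmul u p) HF// um /cmul /rotate/=; ring.
have := Rintegral_rotate su bF.
under eq_Rintegral do rewrite FN.
rewrite (_ : \int[mu]_p (- (F p).1) = - \int[mu]_p (F p).1); last first.
  under eq_Rintegral do rewrite -mulN1r.
  by rewrite RintegralZl ?mulN1r//; exact: bounded_mfun_integrable.
lra.
Qed.

Section series_moments.
Variables (q : plane R -> plane R) (rho : R).
Hypothesis mq : measurable_fun setT q.
Hypothesis q_rot : forall u p, sqn u = 1 -> q (cmul u p) = cmul u (q p).
Hypothesis q_rho : forall p, nrm (q p) <= rho.
Hypothesis rho1 : rho < 1.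

Let rho0 : 0 <= rho. Proof. exact: le_trans (nrm_ge0 (q (0, 0))) (q_rho _). Qed.

Let measurable_cpow k : measurable_fun setT (fun p => cpow (q p) k).
Proof.
elim: k => [|k IH]; first exact: measurable_cst.
have m1 : measurable_fun setT (fun p => (q p).1) by exact: measurableT_comp mq.
have m2 : measurable_fun setT (fun p => (q p).2) by exact: measurableT_comp mq.
have m3 : measurable_fun setT (fun p => (cpow (q p) k).1) by exact: measurableT_comp IH.
have m4 : measurable_fun setT (fun p => (cpow (q p) k).2) by exact: measurableT_comp IH.
apply: measurable_fun_pair.
  by apply: measurable_funB; apply: measurable_funM.
by apply: measurable_funD; apply: measurable_funM.
Qed.

Let bounded_cpow k : bounded_mfun (fun p => (cpow (q p) k).1).
Proof.
split; first exact: measurableT_comp (measurable_cpow k).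
exists 1 => p; apply: le_trans (ler_norm_fst _) _; rewrite nrm_cpow.
by rewrite exprn_ile1 ?nrm_ge0// (le_trans (q_rho p))// ltW.
Qed.

Let bounded_log_sum K : bounded_mfun (fun p => log_sum K (q p)).
Proof.
elim: K => [|K IH].
  rewrite (_ : (fun _ => _) = fun=> 0); first exact: bounded_mfun_cst.
  by apply/funext => p; rewrite /log_sum big_geq.
under eq_fun do rewrite log_sumS.
apply: bounded_mfunD => //; apply: bounded_mfunM => //; exact: bounded_mfun_cst.
Qed.

Let L p := ln (dst (1, 0) (q p)).

Let bounded_L : bounded_mfun L.
Proof.
split.
  apply: measurableT_comp; first exact: measurable_ln.
  exact: measurable_dst.
exists (rho ^+ 1 / (1 - rho)) => p.
have := ln_dst_series 0 (q_rho p) rho1.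
by rewrite /log_sum big_geq// addr0.
Qed.

Let integral_cpow k : (0 < k)%N -> \int[mu]_p (cpow (q p) k).1 = 0.
Proof.
move=> k0; apply: Rintegral_equivariant k0 (bounded_cpow k) _ => u p u1.
by rewrite q_rot// cpow_cmul.
Qed.

Let int_bounded f : bounded_mfun f -> mu.-integrable setT (EFin \o f).
Proof. exact: bounded_mfun_integrable. Qed.

Let integral_log_sum K : \int[mu]_p log_sum K (q p) = 0.
Proof.
elim: K => [|K IH].
  under eq_Rintegral do rewrite /log_sum big_geq//.
  by rewrite Rintegral_cst_prob.
under eq_Rintegral do rewrite log_sumS.
have b := bounded_cpow K.+1.
have bb : bounded_mfun (fun p => (cpow (q p) K.+1).1 / K.+1%:R).
  by apply: bounded_mfunM => //; exact: bounded_mfun_cst.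
rewrite RintegralD//; try exact: int_bounded.
by rewrite IH RintegralZr ?integral_cpow ?mul0r ?addr0//; exact: int_bounded.
Qed.

Let normr_Rintegral_le f (B : R) : bounded_mfun f -> (forall p, `|f p| <= B) ->
  `|\int[mu]_p f p| <= B.
Proof.
move=> bf fB; apply: le_trans (le_normr_Rintegral _ _) _ => //.
  exact: int_bounded.
rewrite -[leRHS](Rintegral_cst_prob mu B); apply: le_Rintegral => //.
  by apply: integrable_norm; exact: int_bounded.
by apply: int_bounded; exact: bounded_mfun_cst.
Qed.

(** The mean value property of a harmonic function: the powers of [q] have mean
    zero by [Rintegral_equivariant]. *)
Lemma Rintegral_ln_1B : \int[mu]_p ln (dst (1, 0) (q p)) = 0.
Proof.
have r01 : 0 <= rho < 1 by rewrite rho0.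
apply/eqP; rewrite -normr_le0; apply/(@le_geometric0 _ _ (rho / (1 - rho)) rho) => // K.
have -> : \int[mu]_p L p = \int[mu]_p (L p + log_sum K (q p)).
  by rewrite RintegralD ?integral_log_sum ?addr0//; exact: int_bounded.
apply: normr_Rintegral_le; first exact: bounded_mfunD.
move=> p; have := ln_dst_series K (q_rho p) rho1.
by rewrite exprS mulrAC.
Qed.

Let conj p : plane R := (p.1, - p.2).

Let prodE a b : a.1 * b.1 = ((cmul a b).1 + (cmul a (conj b)).1) / 2 :> R.
Proof. by rewrite /cmul /rotate/=; field. Qed.

Let bounded_conj k l : bounded_mfun (fun p => (cmul (cpow (q p) k) (conj (cpow (q p) l))).1).
Proof.
have m k' : measurable_fun setT (fun p => (cpow (q p) k').1).
  exact: measurableT_comp (measurable_cpow k').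
have m' k' : measurable_fun setT (fun p => (cpow (q p) k').2).
  exact: measurableT_comp (measurable_cpow k').
split.
  apply: measurable_funB; apply: measurable_funM.
  - exact: m.
  - exact: m.
  - exact: m'.
  - by apply: measurable_funN; exact: m'.
exists 1 => p; apply: le_trans (ler_norm_fst _) _; rewrite nrm_cmul.
have -> : nrm (conj (cpow (q p) l)) = nrm (cpow (q p) l).
  by rewrite /nrm /sqn /conj/= sqrrN.
have le1 k' : nrm (cpow (q p) k') <= 1.
  by rewrite nrm_cpow exprn_ile1 ?nrm_ge0// (le_trans (q_rho p))// ltW.
by rewrite mulr_ile1 ?nrm_ge0.
Qed.

Let integral_cpow2 k l : (0 < l)%N ->
  \int[mu]_p ((cpow (q p) k).1 * (cpow (q p) l).1) =
  if k == l then (\int[mu]_p sqn (q p) ^+ k) / 2 else 0.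
Proof.
move=> l0.
wlog kl : k l l0 / (l <= k)%N.
  move=> H; have [/H|] := leqP l k; first exact.
  have [k0|k0] := posnP k.
    rewrite k0 => _; rewrite eq_sym gtn_eqF//.
    under eq_Rintegral do rewrite mul1r.
    exact: integral_cpow.
  move=> /ltnW lk; under eq_Rintegral do rewrite mulrC.
  by rewrite (H l k k0 lk) eq_sym; case: eqP => // ->.
under eq_Rintegral do rewrite prodE -cpowD.
have b1 := bounded_cpow (k + l); have b2 := bounded_conj k l.
rewrite RintegralZr//; last by apply: int_bounded; exact: bounded_mfunD.
rewrite RintegralD//; try exact: int_bounded.
rewrite integral_cpow ?addn_gt0 ?l0 ?orbT// add0r.
case: (eqVneq k l) => [->|kNl].
  congr (_ / _); apply: eq_Rintegral => p _.
  by rewrite -sqn_cpow /cmul /rotate /sqn/=; ring.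
have {kNl}kl : (l < k)%N by rewrite ltn_neqAle eq_sym kNl.
rewrite (Rintegral_equivariant (m := k - l) (F := fun p =>
  cmul (cpow (q p) k) (conj (cpow (q p) l)))) ?mul0r ?subn_gt0//.
move=> u p u1; rewrite q_rot// !cpow_cmul.
rewrite -{1}(subnK (ltnW kl)) cpowD.
set a := cpow u (k - l); set v := cpow u l.
have v1 : sqn v = 1 by rewrite sqn_cpow u1 expr1n.
set b := cpow (q p) k; set c := cpow (q p) l.
have E : cmul (cmul (cmul a v) b) (conj (cmul v c)) =
   (sqn v * (cmul a (cmul b (conj c))).1, sqn v * (cmul a (cmul b (conj c))).2).
  by rewrite /cmul /rotate /conj /sqn/=; congr pair; ring.
by rewrite E v1 !mul1r; case: (cmul a _).
Qed.

Let integral_log_sum_cpow K l : (K < l)%N ->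
  \int[mu]_p (log_sum K (q p) * (cpow (q p) l).1) = 0.
Proof.
have bc k : bounded_mfun (fun p => (cpow (q p) k).1) := bounded_cpow k.
elim: K => [|K IH] Kl.
  under eq_Rintegral do rewrite /log_sum big_geq// mul0r.
  by rewrite Rintegral_cst_prob.
have l0 : (0 < l)%N by exact: leq_ltn_trans Kl.
under eq_Rintegral do rewrite log_sumS mulrDl mulrAC.
have b1 : bounded_mfun (fun p => log_sum K (q p) * (cpow (q p) l).1).
  exact: bounded_mfunM.
have b2 : bounded_mfun (fun p => (cpow (q p) K.+1).1 * (cpow (q p) l).1).
  exact: bounded_mfunM.
have b3 : bounded_mfun (fun p => (cpow (q p) K.+1).1 * (cpow (q p) l).1 / K.+1%:R).
  by apply: bounded_mfunM => //; exact: bounded_mfun_cst.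
rewrite RintegralD//; try exact: int_bounded.
rewrite IH ?(ltnW Kl)// RintegralZr//; last exact: int_bounded.
by rewrite integral_cpow2// ltn_eqF// mul0r addr0.
Qed.

Let integral_log_sum_sqr K : \int[mu]_p (log_sum K (q p) ^+ 2) =
  \sum_(0 <= k < K) (\int[mu]_p sqn (q p) ^+ k.+1) / 2 / k.+1%:R ^+ 2.
Proof.
elim: K => [|K IH].
  under eq_Rintegral do rewrite /log_sum big_geq// expr0n.
  by rewrite Rintegral_cst_prob big_geq.
rewrite big_nat_recr//= -IH.
set c := fun p => (cpow (q p) K.+1).1; set n := K.+1%:R.
have bc : bounded_mfun c := bounded_cpow K.+1.
have n0 : n != 0 :> R by rewrite pnatr_eq0.
have bl := bounded_log_sum K.
transitivity (\int[mu]_p (log_sum K (q p) * log_sum K (q p) +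
   (log_sum K (q p) * c p * (2 / n) + c p * c p * n^-1 ^+ 2))).
  by apply: eq_Rintegral => p _; rewrite log_sumS -/n -/(c p); field.
have b1 := bounded_mfunM bl bl.
have b2 := bounded_mfunM bl bc.
have b3 := bounded_mfunM bc bc.
have b2' : bounded_mfun (fun p => log_sum K (q p) * c p * (2 / n)).
  by apply: bounded_mfunM b2 _; exact: bounded_mfun_cst.
have b3' : bounded_mfun (fun p => c p * c p * n^-1 ^+ 2).
  by apply: bounded_mfunM b3 _; exact: bounded_mfun_cst.
have b4 := bounded_mfunD b2' b3'.
rewrite RintegralD//; try exact: int_bounded.
rewrite RintegralD//; try exact: int_bounded.
rewrite RintegralZr//; last exact: int_bounded.
rewrite RintegralZr//; last exact: int_bounded.
by rewrite integral_log_sum_cpow// mul0r add0r integral_cpow2// eqxx exprVn.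
Qed.

(** Parseval's identity with a geometric error: distinct powers of [q] are
    orthogonal, and a real part has half the square norm. *)
Lemma Rintegral_ln_1B_sqr K :
  `|\int[mu]_p (ln (dst (1, 0) (q p)) ^+ 2) -
    \sum_(0 <= k < K) (\int[mu]_p sqn (q p) ^+ k.+1) / 2 / k.+1%:R ^+ 2| <=
  3 / (1 - rho) ^+ 2 * rho ^+ K.
Proof.
have r0 : 0 < 1 - rho by rewrite subr_gt0.
rewrite -integral_log_sum_sqr -/(L _).
have bl := bounded_log_sum K.
have b1 := bounded_mfunM bl bl; have b2 := bounded_mfunM bounded_L bounded_L.
have b3 : bounded_mfun (fun p => L p * L p - log_sum K (q p) * log_sum K (q p)).
  under eq_fun do rewrite -mulN1r.
  by apply: bounded_mfunD => //; apply: bounded_mfunM => //; exact: bounded_mfun_cst.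
rewrite -RintegralB//; try by [exact: (int_bounded b1)|exact: (int_bounded b2)].
apply: normr_Rintegral_le; first exact: b3.
move=> p; rewrite subr_sqr normrM.
have H1 := ln_dst_series K (q_rho p) rho1.
have H0 := ln_dst_series 0 (q_rho p) rho1.
rewrite /log_sum big_geq// addr0 -/(log_sum K (q p)) -/(L p) in H0.
rewrite -/(L p) in H1.
have e1 : rho ^+ K.+1 / (1 - rho) <= rho ^+ K / (1 - rho).
  by rewrite ler_pM2r ?invr_gt0// exprS ler_piMl ?exprn_ge0// ltW.
have e2 : rho ^+ K.+1 / (1 - rho) <= 1 / (1 - rho).
  by rewrite ler_pM2r ?invr_gt0// exprn_ile1// ltW.
have e3 : rho ^+ 1 / (1 - rho) <= 1 / (1 - rho).
  by rewrite ler_pM2r ?invr_gt0// exprn_ile1// ltW.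
have H2 : `|L p - log_sum K (q p)| <= 3 / (1 - rho).
  have -> : L p - log_sum K (q p) = L p + L p - (L p + log_sum K (q p)) by ring.
  apply: le_trans (ler_normB _ _) _.
  have := ler_normD (L p) (L p); rewrite (_ : 3 / (1 - rho) = 1 / (1 - rho) * 3); last by ring.
  lra.
rewrite (_ : 3 / (1 - rho) ^+ 2 * rho ^+ K = 3 / (1 - rho) * (rho ^+ K / (1 - rho))).
  by apply: ler_pM => //; exact: le_trans H1 e1.
by field; rewrite gt_eqF.
Qed.

End series_moments.
End rotation_averages.

(** * Square integrable functions *)

Section square_integrable.
Context {R : realType} d (T : measurableType d) (mu : probability T R).
Local Open Scope ring_scope.
Implicit Types f g : T -> R.

Definition square_integrable f :=
  measurable_fun setT f /\ (\int[mu]_x (f x ^+ 2)%:E < +oo)%E.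

Lemma integrable_cst_prob (c : R) : mu.-integrable setT (EFin \o (fun=> c)).
Proof. exact: bounded_mfun_integrable (bounded_mfun_cst _ c). Qed.

Lemma integrableD_EFin f g : mu.-integrable setT (EFin \o f) ->
  mu.-integrable setT (EFin \o g) -> mu.-integrable setT (EFin \o (fun x => f x + g x)).
Proof. by move=> If Ig; exact: (integrableD measurableT If Ig). Qed.

Lemma integrableZ_EFin (c : R) f : mu.-integrable setT (EFin \o f) ->
  mu.-integrable setT (EFin \o (fun x => c * f x)).
Proof. by move=> If; exact: (integrableZl measurableT c If). Qed.

Lemma square_integrable_sqr f : square_integrable f ->
  mu.-integrable setT (EFin \o (fun x => f x ^+ 2)).
Proof.
move=> [mf foo]; apply/integrableP; split.
  by apply/measurable_EFinP; exact: measurable_funX.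
apply: le_lt_trans foo; rewrite le_eqVlt; apply/predU1P; left.
by apply: eq_integral => x _; rewrite /= ger0_norm// sqr_ge0.
Qed.

Lemma square_integrableM f g : square_integrable f -> square_integrable g ->
  mu.-integrable setT (EFin \o (fun x => f x * g x)).
Proof.
move=> sf sg; have [mf _] := sf; have [mg _] := sg.
apply: le_integrable (integrableD_EFin (square_integrable_sqr sf) (square_integrable_sqr sg)) => //.
  by apply/measurable_EFinP; exact: measurable_funM.
move=> x _; rewrite /= lee_fin [leRHS]ger0_norm ?addr_ge0 ?sqr_ge0// normrM.
rewrite -(real_normK (num_real (f x))) -(real_normK (num_real (g x))).
have := sqr_ge0 (`|f x| - `|g x|); have := sqr_ge0 `|f x|; have := sqr_ge0 `|g x|.
by nra.
Qed.

Lemma square_integrable_cst (c : R) : square_integrable (fun=> c).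
Proof. by split => //; rewrite integral_cst_prob ltry. Qed.

Lemma square_integrable_int f : square_integrable f -> mu.-integrable setT (EFin \o f).
Proof.
move=> sf; have := square_integrableM sf (square_integrable_cst 1).
by rewrite (_ : (fun x => f x * 1) = f)//; apply/funext => x; rewrite mulr1.
Qed.

Lemma square_integrableD f g : square_integrable f -> square_integrable g ->
  square_integrable (fun x => f x + g x).
Proof.
move=> sf sg; have [mf foo] := sf; have [mg goo] := sg; split; first exact: measurable_funD.
have I := integrableD_EFin (square_integrable_sqr sf) (square_integrable_sqr sg).
have I2 := integrableZ_EFin 2 I.
apply: le_lt_trans (integrable_lty measurableT I2).
apply: ge0_le_integral => //=.
- by move=> x _; rewrite lee_fin sqr_ge0.
- by apply/measurable_EFinP; apply: measurable_funX; exact: measurable_funD.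
- exact: measurable_int I2.
- by move=> x _; rewrite lee_fin; have := sqr_ge0 (f x - g x); nra.
Qed.

Lemma square_integrableZ (c : R) f : square_integrable f ->
  square_integrable (fun x => c * f x).
Proof.
move=> sf; have [mf _] := sf; split; first exact: measurable_funM.
apply: le_lt_trans (integrable_lty measurableT (integrableZ_EFin (c ^+ 2) (square_integrable_sqr sf))).
rewrite le_eqVlt; apply/predU1P; left.
by apply: eq_integral => x _; rewrite /= exprMn.
Qed.

Lemma square_integrable_bounded f : bounded_mfun f -> square_integrable f.
Proof.
move=> [mf [B fB]]; split => //.
apply: (@le_lt_trans _ _ (\int[mu]__ (B ^+ 2)%:E)%E); last by rewrite integral_cst_prob ltry.
apply: ge0_le_integral => //=.
- by move=> x _; rewrite lee_fin sqr_ge0.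
- by apply/measurable_EFinP; exact: measurable_funX.
- move=> x _; rewrite lee_fin -(real_normK (num_real (f x))).
  by rewrite lerXn2r ?nnegrE ?(le_trans _ (fB x)).
Qed.

Lemma EFin_Rintegral f : mu.-integrable setT (EFin \o f) ->
  (\int[mu]_x (f x)%:E = (\int[mu]_x f x)%R%:E)%E.
Proof. by move=> If; rewrite /Rintegral fineK//; exact: integrable_fin_num. Qed.

Lemma EFin_Rintegral_sqr f : square_integrable f ->
  (\int[mu]_x (f x ^+ 2)%:E = (\int[mu]_x (f x ^+ 2))%R%:E)%E.
Proof. by move=> sf; rewrite -EFin_Rintegral//; exact: square_integrable_sqr. Qed.

Lemma Rintegral_sqrD f (c : R) : square_integrable f ->
  \int[mu]_x ((c + f x) ^+ 2) =
  c ^+ 2 + 2 * c * (\int[mu]_x f x) + \int[mu]_x (f x ^+ 2).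
Proof.
move=> sf; have I1 := square_integrable_int sf; have I2 := square_integrable_sqr sf.
have Ic := integrable_cst_prob (c ^+ 2); have I3 := integrableZ_EFin (2 * c) I1.
transitivity (\int[mu]_x (c ^+ 2 + 2 * c * f x + f x ^+ 2)).
  by apply: eq_Rintegral => x _; ring.
rewrite RintegralD//; last exact: integrableD_EFin.
by rewrite RintegralD// RintegralZl// Rintegral_cst_prob.
Qed.

Lemma integral_sqr_centred g : square_integrable g -> \int[mu]_x g x = 0 ->
  forall c, (\int[mu]_x ((c + g x) ^+ 2)%:E = (c ^+ 2 + \int[mu]_x (g x ^+ 2))%R%:E)%E.
Proof.
move=> sg g0 c; rewrite (@EFin_Rintegral_sqr (fun x => c + g x)); last first.
  by apply: square_integrableD => //; exact: square_integrable_cst.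
by rewrite Rintegral_sqrD// g0 mulr0 addr0.
Qed.

Lemma Rintegral_centred f : mu.-integrable setT (EFin \o f) ->
  \int[mu]_x (f x - \int[mu]_x f x) = 0.
Proof.
move=> If; set m := \int[mu]_x f x; have Ic := integrable_cst_prob (- m).
by rewrite RintegralD// Rintegral_cst_prob subrr.
Qed.

Lemma Rintegral_variance_le f : square_integrable f ->
  \int[mu]_x ((f x - \int[mu]_x f x) ^+ 2) <= \int[mu]_x (f x ^+ 2).
Proof.
move=> sf; set m := \int[mu]_x f x.
under eq_Rintegral do rewrite addrC.
rewrite Rintegral_sqrD// -/m; have := sqr_ge0 m; rewrite !expr2; lra.
Qed.

Lemma ae_le_Rintegral f g : mu.-integrable setT (EFin \o f) ->
  mu.-integrable setT (EFin \o g) -> {ae mu, forall x, f x <= g x} ->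
  \int[mu]_x f x <= \int[mu]_x g x.
Proof.
move=> If Ig fg; rewrite -subr_ge0 -RintegralB//.
have Igf := integrableB measurableT Ig If.
have -> : \int[mu]_x (g x - f x) = \int[mu]_x `|g x - f x|.
  congr fine; apply: ae_eq_integral => //=.
  - exact: measurable_int Igf.
  - by apply/measurable_EFinP/measurableT_comp => //; apply/measurable_EFinP; exact: measurable_int Igf.
  - by apply: filterS fg => x /= xfg _; rewrite ger0_norm ?subr_ge0.
exact: Rintegral_ge0.
Qed.

Lemma ae_eq_Rintegral f g : measurable_fun setT f -> measurable_fun setT g ->
  {ae mu, forall x, f x = g x} -> \int[mu]_x f x = \int[mu]_x g x.
Proof.
move=> mf mg fg; congr fine; apply: ae_eq_integral => //=; try exact/measurable_EFinP.
by apply: filterS fg => x /= xfg _; rewrite xfg.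
Qed.

(** The term of first order integrates to zero and that of second order to the
    variance; only the third moment remains. *)
Lemma normr_Rintegral_cubic_taylor f (L c A B K : R) (psi : R -> R) :
  square_integrable f -> measurable_fun setT psi ->
  (\int[mu]_x (`|f x| ^+ 3)%:E <= K%:E)%E ->
  \int[mu]_x f x = 0 -> 0 <= L ->
  (forall h, `|psi (c + h) - psi c - A * h - B * h ^+ 2| <= L * `|h| ^+ 3) ->
  mu.-integrable setT (EFin \o (fun x => psi (c + f x))) /\
  `|\int[mu]_x psi (c + f x) - psi c - B * \int[mu]_x (f x ^+ 2)| <= L * K.
Proof.
move=> sf mpsi fK f0 L0 HL; have [mf _] := sf.
have I1 := square_integrable_int sf; have I2 := square_integrable_sqr sf.
have m3 : measurable_fun setT (fun x => `|f x| ^+ 3).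
  by apply: measurable_funX; exact: measurableT_comp mf.
have I3 : mu.-integrable setT (EFin \o (fun x => `|f x| ^+ 3)).
  apply/integrableP; split; first exact/measurable_EFinP.
  apply: le_lt_trans (ltry K); apply: le_trans fK; rewrite le_eqVlt; apply/predU1P; left.
  by apply: eq_integral => x _; rewrite /= ger0_norm// exprn_ge0.
pose q x := psi c + A * f x + B * f x ^+ 2; pose r x := psi (c + f x) - q x.
have Iq : mu.-integrable setT (EFin \o q).
  apply: integrableD_EFin; last exact: integrableZ_EFin.
  by apply: integrableD_EFin; [exact: integrable_cst_prob | exact: integrableZ_EFin].
have rE x : `|r x| <= L * `|f x| ^+ 3.
  by apply: le_trans (HL (f x)); rewrite /r /q !opprD !addrA.
have mq : measurable_fun setT q by apply/measurable_EFinP; exact: measurable_int Iq.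
have mpf : measurable_fun setT (fun x => psi (c + f x)).
  by apply: measurableT_comp => //; exact: measurable_funD.
have mr : measurable_fun setT r by exact: measurable_funB.
have I3L := integrableZ_EFin L I3.
have Ir : mu.-integrable setT (EFin \o r).
  apply: le_integrable I3L => //; first exact/measurable_EFinP.
  by move=> x _; rewrite /= lee_fin (le_trans (rE x))// ler_norm.
have Ip : mu.-integrable setT (EFin \o (fun x => psi (c + f x))).
  have := integrableD_EFin Iq Ir.
  rewrite (_ : (fun x => q x + r x) = (fun x => psi (c + f x)))//.
  by apply/funext => x; rewrite addrC subrK.
split => //.
have qE : \int[mu]_x q x = psi c + B * \int[mu]_x (f x ^+ 2).
  rewrite /q RintegralD//; last exact: integrableZ_EFin.
    rewrite RintegralD//; [|exact: integrable_cst_prob|exact: integrableZ_EFin].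
    by rewrite Rintegral_cst_prob !RintegralZl// f0 mulr0 addr0.
  by apply: integrableD_EFin; [exact: integrable_cst_prob | exact: integrableZ_EFin].
rewrite -addrA -opprD -qE -RintegralB//.
apply: le_trans (le_normr_Rintegral _ _) _ => //.
apply: (@le_trans _ _ (\int[mu]_x (L * `|f x| ^+ 3))).
  apply: le_Rintegral => //; first exact: integrable_norm Ir.
  by move=> x _; exact: rE.
rewrite RintegralZl//; apply: ler_wpM2l => //.
by rewrite -lee_fin -EFin_Rintegral.
Qed.

End square_integrable.

(** * Regularity of the logarithmic potential *)

Section log_potential.
Context {R : realType} (mu : probability (plane R) R).
Hypothesis mu_disc : disc_law mu.
Local Open Scope ring_scope.
Implicit Types p u z w : plane R.

Lemma nrm_le1 z : sqn z <= 1 -> nrm z <= 1.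
Proof. by move=> z1; rewrite -(@ler_pXn2r _ 2)// ?nnegrE ?nrm_ge0// sqr_nrm expr1n. Qed.

Lemma nrm_lt1 z : sqn z < 1 -> nrm z < 1.
Proof. by move=> z1; rewrite -(@ltr_pXn2r _ 2)// ?nnegrE ?nrm_ge0// sqr_nrm expr1n. Qed.

Lemma measurable_ln_dst d (T : measurableType d) (f g : T -> plane R) (s : T -> R) :
  measurable_fun setT f -> measurable_fun setT g -> measurable_fun setT s ->
  measurable_fun setT (fun x => ln (dst (f x) (g x) + s x)).
Proof.
move=> mf mg ms; apply: measurableT_comp; first exact: measurable_ln.
by apply: measurable_funD => //; exact: measurable_dst.
Qed.

Lemma dst_le2 z p : sqn z <= 1 -> sqn p < 1 -> dst z p <= 2.
Proof.
move=> /nrm_le1 z1 /nrm_lt1 p1; have := dst_triangle (0, 0) z p.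
by rewrite (dstC z (0, 0)) !dst0p; move: z1 p1; lra.
Qed.

Let measurable_ln_dst0 z : measurable_fun setT (fun p => ln (dst z p)).
Proof.
apply: measurableT_comp; first exact: measurable_ln.
exact: measurable_dst.
Qed.

Let measurable_inv_dst z : measurable_fun setT (fun p => (dst z p)^-1).
Proof.
apply: measurable_inv_ge0 => [p|]; first exact: dst_ge0.
exact: measurable_dst.
Qed.

(** Distances in the disc are at most [2] and have inverse moment at most [4],
    so that [normr_ln_cube] gives [162 = 27 * (2 + 4)]. *)
Lemma disc_law_ln_cube z : sqn z <= 1 ->
  (\int[mu]_p (`|ln (dst z p)| ^+ 3)%:E <= 162%:E)%E.
Proof.
move=> z1; have mi := measurable_inv_dst z.
apply: (@le_trans _ _ (\int[mu]_p (54%:E + 27%:E * (dst z p)^-1%:E)))%E.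
  apply: ae_ge0_le_integral => //.
  - apply/measurable_EFinP; apply: measurable_funX; exact: measurableT_comp.
  - by move=> p _; rewrite lee_fin addr_ge0// mulr_ge0// invr_ge0 dst_ge0.
  - by apply/measurable_EFinP; apply: measurable_funD => //; exact: measurable_funM.
  apply: filterS (disc_law_ae mu_disc) => p p1 _; rewrite lee_fin.
  have d2 := dst_le2 z1 p1.
  have [d0|] := ltP 0 (dst z p); first by have := normr_ln_cube d0; lra.
  rewrite le_eqVlt ltNge dst_ge0 orbF => /eqP ->.
  by rewrite ln0// normr0 expr0n/= invr0; lra.
rewrite ge0_integralD//; last 2 first.
- by move=> p _; rewrite lee_fin mulr_ge0// invr_ge0 dst_ge0.
- by apply/measurable_EFinP; exact: measurable_funM.
rewrite integral_cst_prob ge0_integralZl_EFin//; last 2 first.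
- by move=> p _; rewrite lee_fin invr_ge0 dst_ge0.
- exact/measurable_EFinP.
apply: le_trans (leeD2l _ (lee_wpmul2l _ (disc_law_inv_dst mu_disc z))) _ => //.
by rewrite -EFinM -EFinD lee_fin; lra.
Qed.

Lemma square_integrable_ln_dst z : sqn z <= 1 ->
  square_integrable mu (fun p => ln (dst z p)).
Proof.
move=> z1; split => //.
have m3 : measurable_fun setT (fun p => `|ln (dst z p)| ^+ 3).
  by apply: measurable_funX; exact: measurableT_comp.
apply: (@le_lt_trans _ _ (\int[mu]_p (1%:E + (`|ln (dst z p)| ^+ 3)%:E)))%E.
  apply: ge0_le_integral => //.
  - by move=> p _; rewrite lee_fin sqr_ge0.
  - by apply/measurable_EFinP; exact: measurable_funX.
  - by apply/measurable_EFinP; exact: measurable_funD.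
  - move=> p _; rewrite lee_fin -(real_normK (num_real (ln _))).
    exact: sqr_le_1Dcube.
rewrite ge0_integralD//; last first.
  exact/measurable_EFinP.
rewrite integral_cst_prob; apply: le_lt_trans (leeD2l _ (disc_law_ln_cube z1)) _.
by rewrite -EFinD ltry.
Qed.

(** [ln_diff_sqr] leaves two inverse moments, and [32 = 4 * (4 + 4)]. So the
    potential is 1/2-Hoelder in mean square; the shift [s] takes care of all
    points within [s] of [z] at once. *)
Lemma disc_law_ln_dst_sqr z w (s : R) : 0 <= s ->
  (\int[mu]_p ((ln (dst z p + s) - ln (dst w p)) ^+ 2)%:E <= (32 * (dst z w + s))%:E)%E.
Proof.
move=> s0; set c := 4 * (dst z w + s).
have c0 : 0 <= c by rewrite mulr_ge0// addr_ge0// dst_ge0.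
have mz := measurable_inv_dst z; have mw := measurable_inv_dst w.
apply: (@le_trans _ _ (\int[mu]_p (c%:E * ((dst z p)^-1%:E + (dst w p)^-1%:E))))%E.
  apply: ae_ge0_le_integral => //.
  - by move=> p _; rewrite lee_fin sqr_ge0.
  - apply/measurable_EFinP; apply: measurable_funX; apply: measurable_funB => //.
    exact: measurable_ln_dst.
  - by move=> p _; rewrite lee_fin mulr_ge0// addr_ge0// invr_ge0 dst_ge0.
  - by apply/measurable_EFinP; apply: measurable_funM => //; exact: measurable_funD.
  apply: filterS2 (disc_law_dst_gt0 mu_disc z) (disc_law_dst_gt0 mu_disc w) => p z0 w0 _.
  have zs0 : 0 < dst z p + s by exact: ltr_wpDr.
  rewrite lee_fin; apply: le_trans (ln_diff_sqr zs0 w0) _.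
  rewrite /c ler_pM ?mulr_ge0// ?addr_ge0 ?invr_ge0 ?(ltW w0) ?(ltW zs0)//.
    rewrite ler_pM2l// addrAC; apply: le_trans (ler_normD _ _) _.
    by rewrite (ger0_norm s0) lerD2r ler_dist_dst.
  by rewrite lerD2r lef_pV2 ?posrE// lerDl.
rewrite ge0_integralZl_EFin//; last 2 first.
- by move=> p _; rewrite lee_fin addr_ge0// invr_ge0 dst_ge0.
- by apply/measurable_EFinP; exact: measurable_funD.
rewrite ge0_integralD//; last 4 first.
- by move=> p _; rewrite lee_fin invr_ge0 dst_ge0.
- exact/measurable_EFinP.
- by move=> p _; rewrite lee_fin invr_ge0 dst_ge0.
- exact/measurable_EFinP.
apply: le_trans (lee_wpmul2l _ (leeD (disc_law_inv_dst mu_disc z) (disc_law_inv_dst mu_disc w))) _.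
  by rewrite lee_fin.
by rewrite -EFinD -EFinM lee_fin /c; lra.
Qed.

Lemma square_integrable_ln_dstD z (s : R) : sqn z <= 1 -> 0 <= s ->
  square_integrable mu (fun p => ln (dst z p + s)).
Proof.
move=> z1 s0.
have -> : (fun p => ln (dst z p + s)) =
    (fun p => (ln (dst z p + s) - ln (dst z p)) + ln (dst z p)).
  by apply/funext => p; rewrite subrK.
apply: square_integrableD (square_integrable_ln_dst z1); split.
  by apply: measurable_funB => //; exact: measurable_ln_dst.
by apply: le_lt_trans (disc_law_ln_dst_sqr z z s0) _; rewrite ltry.
Qed.

Let integrable_inv_dst z : mu.-integrable setT (EFin \o (fun p => (dst z p)^-1)).
Proof.
apply/integrableP; split; first exact/measurable_EFinP.
apply: (@le_lt_trans _ _ 4%:E); last by rewrite ltry.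
apply: le_trans (disc_law_inv_dst mu_disc z); rewrite le_eqVlt; apply/predU1P; left.
by apply: eq_integral => x _; rewrite /= ger0_norm// invr_ge0 dst_ge0.
Qed.

(** From [ln (1 + s / a) <= s / a] and the inverse moment. *)
Lemma disc_law_ln_dstD_le z (s : R) : sqn z <= 1 -> 0 <= s ->
  \int[mu]_p ln (dst z p + s) <= \int[mu]_p ln (dst z p) + 4 * s.
Proof.
move=> z1 s0; have I1 := square_integrable_int (square_integrable_ln_dst z1).
have Ii := integrable_inv_dst z; have IsZ := integrableZ_EFin s Ii.
apply: (@le_trans _ _ (\int[mu]_p (ln (dst z p) + s * (dst z p)^-1))).
  apply: ae_le_Rintegral.
  - exact: square_integrable_int (square_integrable_ln_dstD z1 s0).
  - exact: integrableD_EFin.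
  apply: filterS (disc_law_dst_gt0 mu_disc z) => p p0.
  have -> : dst z p + s = dst z p * (1 + s / dst z p).
    by rewrite mulrDr mulr1 mulrCA divff ?gt_eqF// mulr1.
  have sd : 0 <= s / dst z p by rewrite divr_ge0// ltW.
  rewrite lnM ?posrE ?ltr_wpDr// lerD2l; apply: le_ln1Dx.
  by apply: lt_le_trans sd; rewrite ltrN10.
rewrite RintegralD// lerD2l RintegralZl// mulrC ler_wpM2r//.
by rewrite -lee_fin -EFin_Rintegral//; exact: disc_law_inv_dst.
Qed.

(** The rotation that takes [1] to [u] preserves [mu]. *)
Lemma ln_dst_law u (psi : measurableTypeR R -> \bar R) : sqn u = 1 -> measurable_fun setT psi ->
  (forall x, 0 <= psi x)%E ->
  (\int[mu]_p psi (ln (dst u p)) = \int[mu]_p psi (ln (dst (1, 0)%R p)))%E.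
Proof.
move=> u1 mpsi psi0.
have m v : measurable_fun setT (fun p => psi (ln (dst v p))).
  exact: (measurableT_comp mpsi (measurable_ln_dst0 v)).
rewrite -(@ge0_integral_rotate _ _ mu_disc u.1 u.2 _ u1 (m u))//.
apply: eq_integral => p _; congr (psi (ln _)).
have -> : dst u (rotate u.1 u.2 p) = nrm (cmul u (1 - p.1, 0 - p.2)).
  by rewrite /dst /cmul /rotate/=; congr nrm; congr pair; ring.
by rewrite nrm_cmul /nrm u1 sqrtr1 mul1r.
Qed.

End log_potential.

(** * Mean and variance of the logarithmic potential *)

Section dominated.
Context {R : realType} d (T : measurableType d) (mu : probability T R).
Local Open Scope ring_scope.

Lemma Rintegral_dominated_cvg (f_ : nat -> T -> R) (f g : T -> R) :
  (forall n, measurable_fun setT (f_ n)) -> measurable_fun setT f ->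
  {ae mu, forall x, f_ n x @[n --> \oo] --> f x} ->
  mu.-integrable setT (EFin \o g) ->
  {ae mu, forall x, forall n, `|f_ n x| <= g x} ->
  \int[mu]_x f_ n x @[n --> \oo] --> \int[mu]_x f x.
Proof.
move=> mf_ mf f_f Ig fg.
have [||||| If _ H] := @dominated_convergence _ _ R mu setT measurableT
  (fun n p => (f_ n p)%:E) (EFin \o f) (EFin \o g).
- by move=> n; exact/measurable_EFinP.
- exact/measurable_EFinP.
- by apply: filterS f_f => p fp _; apply/fine_cvgP; split; [exact: nearW|exact: fp].
- exact: Ig.
- by apply: filterS fg => p fp n _; rewrite lee_fin.
by apply: fine_cvg; rewrite -(EFin_Rintegral If).
Qed.

End dominated.

Section log_potential_mean.
Context {R : realType} (mu : probability (plane R) R).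
Hypothesis mu_disc : disc_law mu.
Local Open Scope ring_scope.
Implicit Types p u z w : plane R.

Let conj p : plane R := (p.1, - p.2).

Lemma derivable_xlnx (s : R) : 0 < s ->
  is_derive s (1 : R) (fun t : R => t * ln t - t) (ln s).
Proof.
move=> s0; have H : is_derive s (1 : R) (id * (@ln R) - id)
   (s *: s^-1 + ln s *: 1 - 1).
  apply: is_deriveB; apply: is_deriveM; exact: is_derive1_ln.
apply: is_derive_eq H _.
transitivity (s * s^-1 + ln s * 1 - 1); first by [].
by rewrite divff ?gt_eqF//; ring.
Qed.

Lemma integral_ln (a : R) : 0 < a <= 1 ->
  (\int[lebesgue_measure]_(s in `]a, 1%R]) (- ln s)%:E = (1 - a + a * ln a)%:E)%E.
Proof.
move=> /andP[a0]; rewrite le_eqVlt => /predU1P[->|a1].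
  by rewrite set_itvoc0 integral_set0 subrr ln1 mulr0 addr0.
pose F (t : R) := - (t * ln t - t).
have dF (s : R) : 0 < s -> is_derive s (1 : R) F (- ln s).
  by move=> s0; apply: is_deriveN; exact: derivable_xlnx.
have cF (s : R) : 0 < s -> {for s, continuous F}.
  by move=> /dF ?; apply: differentiable_continuous; apply/derivable1_diffP; apply: ex_derive.
have cl : {within `[a, 1], continuous (fun s : R => - ln s)}.
  apply: continuous_in_subspaceT => t; rewrite inE/= in_itv/= => /andP[ta _].
  by apply: cvgN; apply: continuous_ln; exact: lt_le_trans ta.
have H := @continuous_FTC2 R (fun s => - ln s) F a 1 a1 cl.
rewrite integral_itv_obnd_cbnd; last first.
  apply/measurable_EFinP; apply: measurable_funTS; apply: measurableT_comp => //.
rewrite H.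
- rewrite -EFinB; congr EFin; rewrite /F ln1; ring.
- split.
  + by move=> s; rewrite in_itv/= => /andP[sa _]; have := dF s (lt_trans a0 sa) => ?; exact: ex_derive.
  + by apply: cvg_at_right_filter; exact: cF.
  + by apply: cvg_at_left_filter; exact: cF.
- move=> s; rewrite in_itv/= => /andP[sa _]; rewrite derive1E.
  by have := dF s (lt_trans a0 sa) => ?; exact: derive_val.
Qed.

Lemma integral_ln_max (a : R) : 0 < a <= 1 ->
  (\int[lebesgue_measure]_(s in `]0%R, 1%R]) (- ln (Num.max a (Num.min s 1)))%:E =
   (1 - a)%:E)%E.
Proof.
move=> /andP[a0 a1].
have mf : measurable_fun setT (fun s : R => - ln (Num.max a (Num.min s 1))).
  apply: measurableT_comp => //; apply: measurableT_comp; first exact: measurable_ln.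
  by apply: measurable_maxr => //; exact: measurable_minr.
have -> : `]0%R, 1%R]%classic = `]0, a]%classic `|` `]a, 1]%classic :> set R.
  by rewrite -itv_bndbnd_setU// ?bnd_simp ?(ltW a0).
rewrite integral_setU_EFin//=; last 2 first.
- exact: measurable_funTS.
- apply/eqP; rewrite -subset0 => s [/=]; rewrite !in_itv/= => /andP[_ sa] /andP[as_ _].
  by move: (lt_le_trans as_ sa); rewrite ltxx.
under eq_integral => s.
  rewrite inE/= in_itv/= => /andP[s0 sa].
  rewrite (min_idPl (le_trans sa a1)) (max_idPl sa); over.
under [X in (_ + X)%E]eq_integral => s.
  rewrite inE/= in_itv/= => /andP[s0 sa].
  rewrite (min_idPl sa) (max_idPr (ltW s0)); over.
rewrite integral_ln ?a0// integral_cst//= lebesgue_measure_itv/= lte_fin a0 -EFinB subr0.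
by rewrite -EFinM -EFinD; congr EFin; ring.
Qed.

Lemma integral_pow (b : R) k : 0 <= b ->
  (\int[lebesgue_measure]_(s in `]0%R, b]) (s ^+ k.+1)%:E = (b ^+ k.+2 / k.+2%:R)%:E)%E.
Proof.
rewrite le_eqVlt => /predU1P[<-|b0].
  by rewrite set_itvoc0 integral_set0 exprS mul0r mul0r.
pose F (s : R) := s ^+ k.+2 / k.+2%:R.
have dF (s : R) : is_derive s (1 : R) F (s ^+ k.+1).
  have idX m x : (@id R ^+ m) x = x ^+ m by elim: m => [//|m IHm]; rewrite !exprS -IHm.
  have H : is_derive s (1 : R) (k.+2%:R^-1 \*: (@id R ^+ k.+2))
      (k.+2%:R^-1 *: ((k.+2%:R * s ^+ k.+1) *: 1)).
    exact: is_deriveZ.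
  have -> : F = k.+2%:R^-1 \*: (@id R ^+ k.+2).
    apply/funext => x; rewrite /F mulrC.
    by transitivity (k.+2%:R^-1 * (@id R ^+ k.+2) x); [rewrite idX|].
  apply: is_derive_eq H _.
  transitivity (k.+2%:R^-1 * ((k.+2%:R * s ^+ k.+1) * 1)); first by [].
  by rewrite mulr1 mulKf// pnatr_eq0.
have cF (s : R) : {for s, continuous F}.
  by apply: differentiable_continuous; apply/derivable1_diffP; apply: ex_derive.
rewrite integral_itv_obnd_cbnd; last first.
  by apply/measurable_EFinP; apply: measurable_funTS; exact: measurable_funX.
rewrite (@continuous_FTC2 R (fun s => s ^+ k.+1) F 0 b b0).
- by rewrite -EFinB; congr EFin; rewrite /F expr0n/= mul0r subr0.
- by apply: continuous_subspaceT => s; exact: exprn_continuous.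
- split.
  + by move=> s _; have ? := dF s; exact: ex_derive.
  + by apply: cvg_at_right_filter; exact: cF.
  + by apply: cvg_at_left_filter; exact: cF.
- by move=> s _; rewrite derive1E; have ? := dF s; exact: derive_val.
Qed.

Section reduced_ratio.
Variable z : plane R.
Hypothesis z0 : 0 < sqn z.
Hypothesis z1 : sqn z <= 1.

(** [q p] is the quotient of the smaller of [p] and [z] by the larger one, up
    to conjugation: it has modulus at most one, rotates with [p], and [|z - p|]
    is [|1 - q p|] times the larger modulus [sqrt (S p)]. *)
Let S p := Num.max (sqn z) (sqn p).
Let q p : plane R := ((cmul p (conj z)).1 / S p, (cmul p (conj z)).2 / S p).
(** The cut at modulus [rho < 1] makes the logarithmic series converge
    uniformly. *)
Let qcut rho p : plane R := if nrm (q p) <= rho then q p else (0, 0).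

Let S0 p : 0 < S p. Proof. by rewrite lt_max z0. Qed.

Let sqn_q p : sqn (q p) = Num.min (sqn z) (sqn p) / S p.
Proof.
have -> : sqn (q p) = sqn z * sqn p / S p ^+ 2.
  by rewrite /q /cmul /rotate /sqn /conj/=; field; rewrite gt_eqF.
have -> : sqn z * sqn p = Num.min (sqn z) (sqn p) * S p.
  by rewrite /S; case: (leP (sqn z)) => _ //; rewrite mulrC.
by field; rewrite gt_eqF.
Qed.

Let dst_q p : dst z p = Num.sqrt (S p) * dst (1, 0) (q p).
Proof.
rewrite /dst /nrm -sqrtrM ?ltW//; congr Num.sqrt.
transitivity (S p * (1 + sqn (q p)) - 2 * (cmul p (conj z)).1); last first.
  by rewrite /q /sqn/=; field; rewrite gt_eqF.
rewrite sqn_q mulrDr mulr1 mulrCA divff ?gt_eqF// mulr1 /S.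
have -> : Num.max (sqn z) (sqn p) + Num.min (sqn z) (sqn p) = sqn z + sqn p.
  by case: (leP (sqn z)) => _; rewrite // addrC.
by rewrite /sqn /cmul /rotate /conj/=; ring.
Qed.

Let measurable_S : measurable_fun setT S.
Proof. by apply: measurable_maxr => //; exact: measurable_sqn. Qed.

Let measurable_q : measurable_fun setT q.
Proof.
have mi : measurable_fun setT (fun p => (S p)^-1).
  by apply: measurable_inv_ge0 => // p; exact: ltW.
apply: measurable_fun_pair; apply: measurable_funM => //.
  by apply: measurable_funB; apply: measurable_funM.
by apply: measurable_funD; apply: measurable_funM.
Qed.

Let measurable_qcut rho : measurable_fun setT (qcut rho).
Proof.
apply: measurable_fun_if => //; last exact: measurable_funTS.
apply: measurable_fun_ler => //.
exact: (measurableT_comp (@measurable_nrm R)).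
Qed.

Let q_rot u p : sqn u = 1 -> q (cmul u p) = cmul u (q p).
Proof.
move=> u1; rewrite /q (_ : S (cmul u p) = S p); last by rewrite /S sqn_cmul u1 mul1r.
by rewrite /cmul /rotate/=; congr pair; field; rewrite gt_eqF.
Qed.

Let qcut_rot rho u p : sqn u = 1 -> qcut rho (cmul u p) = cmul u (qcut rho p).
Proof.
move=> u1; rewrite /qcut q_rot// nrm_cmul {1}/nrm u1 sqrtr1 mul1r.
by case: ifP => // _; rewrite /cmul /rotate/=; congr pair; ring.
Qed.

Let qcut_le rho p : 0 <= rho -> nrm (qcut rho p) <= rho.
Proof.
move=> r0; rewrite /qcut; case: ifP => // _.
by rewrite /nrm /sqn/= expr0n/= addr0 sqrtr0.
Qed.

Let nrm_q_lt1 p : sqn p != sqn z -> nrm (q p) < 1.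
Proof.
move=> pz; apply: nrm_lt1; rewrite sqn_q ltr_pdivrMr// mul1r /S.
by move: pz; rewrite neq_lt; case: (ltgtP (sqn z)).
Qed.

(** For [p] in the disc, the logarithm of the larger modulus. *)
Let h p := ln (Num.max (sqn z) (Num.min (sqn p) 1)) / 2.

Let bounded_h : bounded_mfun h.
Proof.
have m : measurable_fun setT (fun p => Num.max (sqn z) (Num.min (sqn p) 1)).
  by apply: measurable_maxr => //; apply: measurable_minr => //; exact: measurable_sqn.
split.
  apply: measurable_funM => //; apply: measurableT_comp => //; exact: measurable_ln.
exists (- ln (sqn z)) => p; set m1 := Num.max (sqn z) (Num.min (sqn p) 1).
have m1z : sqn z <= m1 by rewrite le_max lexx.
have m11 : m1 <= 1 by rewrite ge_max z1 ge_min lexx orbT.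
have m10 : 0 < m1 by exact: lt_le_trans m1z.
have l1 : ln (sqn z) <= ln m1 by rewrite ler_ln.
have l2 : ln m1 <= 0 by exact: ln_le0.
by rewrite /h -/m1 ler0_norm; lra.
Qed.

(** Almost everywhere [ln |1 - q p|], by [FE]. *)
Let F p := ln (dst z p) + - h p.

Let F_square_integrable : square_integrable mu F.
Proof.
apply: square_integrableD; first exact: square_integrable_ln_dst.
apply: square_integrable_bounded.
have := bounded_mfunM (bounded_mfun_cst _ (- 1)) bounded_h.
by rewrite (_ : (fun p => -1 * h p) = (fun p => - h p))//; apply/funext => p; rewrite mulN1r.
Qed.

Let FE : {ae mu, forall p, F p = ln (dst (1, 0) (q p)) /\ nrm (q p) < 1}.
Proof.
have Hz : {ae mu, forall p, sqn p != sqn z}.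
  exists ([set p | sqn p <= sqn z] `\` [set p | sqn p < sqn z]); split.
  - apply: measurableD; [apply: measurable_ler_set|apply: measurable_ltr_set] => //;
      exact: measurable_sqn.
  - have mle : measurable [set p : plane R | sqn p <= sqn z].
      by apply: measurable_ler_set => //; exact: measurable_sqn.
    have mlt : measurable [set p : plane R | sqn p < sqn z].
      by apply: measurable_ltr_set => //; exact: measurable_sqn.
    rewrite measureD//; last first.
      by apply: le_lt_trans (probability_le1 mu mle) _; rewrite ltry.
    rewrite (_ : _ `&` _ = [set p : plane R | sqn p < sqn z]); last first.
      by apply/seteqP; split => p /=; [case|move=> H; split=> //; exact: ltW].
    have z01 : 0 <= sqn z <= 1 by rewrite ltW.
    have e1 := disc_law_sqn_le mu_disc z01; have e2 := disc_law_sqn_lt mu_disc z01.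
    by rewrite [X in (X - _)%E]e1 [X in (_ - X)%E]e2 -EFinB subrr.
  - move=> p /= /negP; rewrite negbK => /eqP ->; split=> //=; rewrite ltxx//.
apply: filterS3 Hz (disc_law_ae mu_disc) (disc_law_dst_gt0 mu_disc z) => p pz p1 d0.
split; last exact: nrm_q_lt1.
move: d0; rewrite /F dst_q => d0.
have s0 : 0 < Num.sqrt (S p) by rewrite sqrtr_gt0.
have q0 : 0 < dst (1, 0) (q p) by move: d0; rewrite pmulr_rgt0.
rewrite lnM ?posrE// addrAC /h (min_idPl (ltW p1)).
rewrite -/(S p); have -> : ln (S p) = ln (Num.sqrt (S p)) * 2.
  by rewrite -[in LHS](sqr_sqrtr (ltW (S0 p))) lnXn// mulr_natr.
by rewrite mulfK// subrr add0r.
Qed.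

Let rho n : R := 1 - n.+1%:R^-1.
Let rho01 n : 0 <= rho n /\ rho n < 1.
Proof.
split; last by rewrite ltrBlDr ltrDl invr_gt0.
by rewrite subr_ge0 invf_le1// ler1n.
Qed.

Let G n p := ln (dst (1, 0) (qcut (rho n) p)).

Let measurable_G n : measurable_fun setT (G n).
Proof.
apply: measurableT_comp; first exact: measurable_ln.
by apply: measurable_dst.
Qed.

Let ln_dst10 : ln (dst (1, 0) (0, 0)) = 0 :> R.
Proof. by rewrite /dst /nrm /sqn/= !subr0 expr1n expr0n/= addr0 sqrtr1 ln1. Qed.

Let G_le : {ae mu, forall p, forall n, `|G n p| <= `|F p|}.
Proof.
apply: filterS FE => p [-> _] n; rewrite /G /qcut; case: ifP => // _.
by rewrite ln_dst10 normr0.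
Qed.

Let G_cvg : {ae mu, forall p, G n p @[n --> \oo] --> F p}.
Proof.
apply: filterS FE => p [-> q1]; apply: cvg_near_cst.
have q1' : 0 < 1 - nrm (q p) by rewrite subr_gt0.
near=> n; rewrite /G /qcut ifT// /rho lerBrDr addrC -lerBrDr.
by apply: ltW; near: n; exact: near_infty_natSinv_lt (PosNum q1').
Unshelve. all: by end_near. Qed.

Let Rintegral_G n : \int[mu]_p G n p = 0.
Proof.
have [r0 r1] := rho01 n.
apply: (Rintegral_ln_1B mu_disc (measurable_qcut _) _ _ r1).
- exact: qcut_rot.
- by move=> p; exact: qcut_le.
Qed.

Let Rintegral_F : \int[mu]_p F p = 0.
Proof.
have [mF _] := F_square_integrable.
have IF := square_integrable_int F_square_integrable.
have := Rintegral_dominated_cvg measurable_G mF G_cvg (integrable_norm IF) G_le.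
under eq_fun do rewrite Rintegral_G.
by move=> /(@cvg_lim _ (@Rhausdorff R)) <-; rewrite lim_cst.
Qed.

Let sqr_G_cvg : \int[mu]_p (G n p ^+ 2) @[n --> \oo] --> \int[mu]_p (F p ^+ 2).
Proof.
have [mF _] := F_square_integrable.
have IF := square_integrable_sqr F_square_integrable.
apply: (Rintegral_dominated_cvg (g := fun p => F p ^+ 2)) => //.
- by move=> n; exact: measurable_funX.
- exact: measurable_funX.
- by apply: filterS G_cvg => p Gp; rewrite expr2; under eq_fun do rewrite expr2; exact: cvgM.
- apply: filterS G_le => p Gp n; rewrite ger0_norm ?sqr_ge0//.
  rewrite -(real_normK (num_real (G n p))) -(real_normK (num_real (F p))).
  by rewrite lerXn2r ?nnegrE.
Qed.

(** Jensen's formula averaged over the disc: [ln |1 - q|] has mean zero, so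
    there remains the mean of the logarithm of the larger modulus, an integral
    in [sqn p]. *)
Lemma Rintegral_ln_dst : \int[mu]_p ln (dst z p) = - ((1 - sqn z) / 2).
Proof.
have sl := square_integrable_ln_dst mu_disc z1.
have Il := square_integrable_int sl; have Ih := @bounded_mfun_integrable _ _ _ mu _ bounded_h.
have := Rintegral_F; rewrite /F RintegralB//.
move=> /eqP; rewrite subr_eq0 => /eqP ->.
have [mh _] := bounded_h.
pose g (s : R) := - ln (Num.max (sqn z) (Num.min s 1)).
have mg : measurable_fun setT (fun s : measurableTypeR R => (g s)%:E).
  apply/measurable_EFinP; apply: measurableT_comp => //.
  apply: measurableT_comp; first exact: measurable_ln.
  by apply: measurable_maxr => //; exact: measurable_minr.
have g0 (s : R) : (0 <= (g s)%:E)%E.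
  rewrite lee_fin oppr_ge0; apply: ln_le0.
  by rewrite ge_max z1 ge_min lexx orbT.
have z01 : 0 < sqn z <= 1 by rewrite z0.
have E : \int[mu]_p g (sqn p) = 1 - sqn z.
  by rewrite /Rintegral (disc_law_integral_sqn mu_disc mg g0) integral_ln_max.
have -> : \int[mu]_p h p = \int[mu]_p (- 2^-1 * g (sqn p)).
  by apply: eq_Rintegral => p _; rewrite /h /g; field.
rewrite RintegralZl ?E//; first by field.
have -> : (fun p => g (sqn p)) = (fun p => - 2 * h p).
  by apply/funext => p; rewrite /h /g; field.
exact: integrableZ_EFin.
Qed.

Section unit_modulus.
Hypothesis z_unit : sqn z = 1.

Let nrm_q p : sqn p < 1 -> nrm (q p) = nrm p.
Proof.
move=> p1; rewrite /nrm sqn_q /S z_unit (max_idPl (ltW p1)) divr1.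
by rewrite (min_idPr (ltW p1)).
Qed.

Let Rintegral_sqn_qcut (r : R) k : 0 <= r <= 1 ->
  \int[mu]_p (sqn (qcut r p) ^+ k.+1) = r ^+ (2 * k.+2) / k.+2%:R.
Proof.
move=> /andP[r0 r1].
pose g (s : R) : R := if s <= r ^+ 2 then (Num.max s 0) ^+ k.+1 else 0.
have mg : measurable_fun setT (fun s : measurableTypeR R => (g s)%:E).
  apply/measurable_EFinP; apply: measurable_fun_ifT => //.
    exact: measurable_fun_ler.
  by apply: measurable_funX; exact: measurable_maxr.
have g0 (s : R) : (0 <= (g s)%:E)%E.
  by rewrite lee_fin /g; case: ifP => // _; rewrite exprn_ge0// le_max lexx orbT.
rewrite (@ae_eq_Rintegral _ _ _ mu _ (fun p => g (sqn p))); last 3 first.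
- by apply: measurable_funX; apply: measurableT_comp (@measurable_sqn R) _; exact: measurable_qcut.
- by apply/measurable_EFinP; exact: (measurableT_comp mg (@measurable_sqn R)).
- apply: filterS (disc_law_ae mu_disc) => p p1; rewrite /qcut nrm_q// /g.
  rewrite -[nrm p <= r](@ler_pXn2r _ 2) ?nnegrE ?nrm_ge0// sqr_nrm.
  case: ifP => _; last by rewrite /sqn/= expr0n/= addr0 expr0n.
  rewrite (max_idPl (sqn_ge0 p)); congr (_ ^+ _).
  by rewrite -sqr_nrm nrm_q// sqr_nrm.
rewrite /Rintegral (disc_law_integral_sqn mu_disc mg g0).
have r20 : 0 <= r ^+ 2 by rewrite sqr_ge0.
have r21 : r ^+ 2 <= 1 by rewrite exprn_ile1.
have -> : `]0%R, 1%R]%classic = `]0, r ^+ 2]%classic `|` `]r ^+ 2, 1]%classic :> set R.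
  by rewrite -itv_bndbnd_setU// ?bnd_simp.
rewrite ge0_integral_setU//=; last 2 first.
- exact: measurable_funTS.
- apply/disj_setPS => s [/=]; rewrite !in_itv/= => /andP[_ sa] /andP[as_ _].
  by move: (lt_le_trans as_ sa); rewrite ltxx.
under eq_integral => s.
  rewrite inE/= in_itv/= => /andP[s0 sa].
  rewrite /g sa (max_idPl (ltW s0)); over.
under [X in (_ + X)%E]eq_integral => s.
  rewrite inE/= in_itv/= => /andP[sa _].
  rewrite /g leNgt sa; over.
by rewrite integral0 adde0 integral_pow//= -exprM.
Qed.

(** The terms of Parseval's series for [q] itself: [|q| ^ (2 (k + 1))] has mean
    [1 / (k + 2)]. *)
Let t k : R := 2^-1 / k.+1%:R ^+ 2 / k.+2%:R.

Let t_ge0 k : 0 <= t k. Proof. by rewrite !divr_ge0// ?exprn_ge0. Qed.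

Let V n := \int[mu]_p (G n p ^+ 2).

Let V_approx n K : `|V n - \sum_(0 <= k < K) rho n ^+ (2 * k.+2) * t k| <=
  3 / (1 - rho n) ^+ 2 * rho n ^+ K.
Proof.
have [r0 r1] := rho01 n.
have := Rintegral_ln_1B_sqr mu_disc (measurable_qcut (rho n))
  (@qcut_rot (rho n)) (fun p => qcut_le p r0) r1 K.
congr (`|_ - _| <= _); apply: eq_bigr => k _.
have r01 : 0 <= rho n <= 1 by rewrite r0 ltW.
rewrite Rintegral_sqn_qcut// /t.
have a0 : (k.+1%:R : R) != 0 by rewrite pnatr_eq0.
have b0 : (k.+2%:R : R) != 0 by rewrite pnatr_eq0.
by move: (k.+1%:R : R) (k.+2%:R : R) a0 b0 => a b a0 b0; field; rewrite a0 b0.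
Qed.

Let V_le n (B : R) : (forall K, \sum_(0 <= k < K) t k <= B) -> V n <= B.
Proof.
have [r0 r1] := rho01 n; have r01 : 0 <= rho n < 1 by rewrite r0.
move=> tB; rewrite -subr_le0.
apply: (@le_geometric0 _ _ (3 / (1 - rho n) ^+ 2) (rho n)) => // K.
have := V_approx n K; rewrite ler_distl => /andP[_].
suff : \sum_(0 <= k < K) rho n ^+ (2 * k.+2) * t k <= B by lra.
apply: le_trans (tB K); apply: ler_sum_nat => k _.
by rewrite ler_piMl// exprn_ile1// ltW.
Qed.

Let V_ge n K : \sum_(0 <= k < K) rho n ^+ (2 * k.+2) * t k <= V n.
Proof.
have [r0 r1] := rho01 n; have r01 : 0 <= rho n < 1 by rewrite r0.
rewrite -subr_le0.
apply: (@le_geometric0 _ _ (3 / (1 - rho n) ^+ 2) (rho n)) => // J.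
have rJ : rho n ^+ (J + K) <= rho n ^+ J.
  by rewrite exprD ler_piMr ?exprn_ge0// exprn_ile1// ltW.
have c0 : 0 <= 3 / (1 - rho n) ^+ 2 by rewrite divr_ge0// sqr_ge0.
have := V_approx n (J + K); rewrite ler_distl => /andP[+ _].
have : \sum_(0 <= k < K) rho n ^+ (2 * k.+2) * t k <=
    \sum_(0 <= k < J + K) rho n ^+ (2 * k.+2) * t k.
  rewrite [leRHS](big_cat_nat _ (n := K))//= ?leq_addl// lerDl.
  by apply: sumr_ge0 => k _; rewrite mulr_ge0// exprn_ge0.
have := ler_wpM2l c0 rJ; lra.
Qed.

Let rho_cvg1 : rho n @[n --> \oo] --> (1 : R).
Proof.
rewrite -[X in _ --> X]subr0; apply: cvgB; first exact: cvg_cst.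
exact: cvg_harmonic.
Qed.

Let W := \int[mu]_p (F p ^+ 2).

Let W_ge K : \sum_(0 <= k < K) t k <= W.
Proof.
have cv : (\sum_(0 <= k < K) rho n ^+ (2 * k.+2) * t k) @[n --> \oo] -->
    \sum_(0 <= k < K) t k.
  apply: cvg_big => //.
    by move=> x /=; exact: add_continuous.
  move=> k _; rewrite -[X in _ --> X]mul1r; apply: cvgM; last exact: cvg_cst.
  rewrite -[X in _ --> X](expr1n _ (2 * k.+2)).
  elim: (2 * k.+2)%N => [|m IH]; first by under eq_fun do rewrite expr0; exact: cvg_cst.
  by under eq_fun do rewrite exprS; rewrite exprS; exact: cvgM.
apply: ler_cvg_to cv sqr_G_cvg _; apply: nearW => n; exact: V_ge.
Qed.

Let W_le (B : R) : (forall K, \sum_(0 <= k < K) t k <= B) -> W <= B.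
Proof.
move=> tB; apply: ler_cvg_to sqr_G_cvg (cvg_cst B) _; apply: nearW => n; exact: V_le.
Qed.

(** Partial fractions: [1 / (k ^ 2 (k + 1)) = 1 / k ^ 2 - 1 / k + 1 / (k +
    1)]. *)
Let sum_tE K : \sum_(0 <= k < K) t k =
  (series (fun k : nat => (k.+1%:R `^ (- (2 : R)))) K - 1 + K.+1%:R^-1) / 2.
Proof.
elim: K => [|K IH]; first by rewrite /series /= !big_geq// invr1 add0r addNr mul0r.
rewrite big_nat_recr//= IH /series/= [in RHS]big_nat_recr//=.
rewrite powRN (_ : (2 : R) = 2%:R)// powR_mulrn// /t.
have h1 : (K.+1%:R : R) != 0 by rewrite pnatr_eq0.
have h2 : (K.+2%:R : R) = K.+1%:R + 1 by rewrite natr1.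
have h3 : (K.+1%:R + 1 : R) != 0 by rewrite -h2 pnatr_eq0.
rewrite h2; move: (K.+1%:R : R) h1 h3 (\sum_(0 <= i < K) _) => m h1 h3 x.
by field; rewrite h1 h3.
Qed.

Let WE : W = (zeta (2 : R) - 1) / 2.
Proof.
pose u : nat -> R := series (fun k : nat => (k.+1%:R `^ (- (2 : R)))).
have uE K : u K = 2 * (\sum_(0 <= k < K) t k) + 1 - K.+1%:R^-1.
  by rewrite sum_tE -/u; move: (u K) (K.+1%:R^-1 : R) => x y; field.
have u_nd : nondecreasing_seq u.
  apply/nondecreasing_seqP => n; rewrite /u /series/= big_nat_recr//= lerDl.
  exact: powR_ge0.
have u_cvg : cvgn u.
  apply: nondecreasing_is_cvgn => //; exists (2 * W + 1) => _ [K _ <-].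
  rewrite uE; have := W_ge K; have : 0 <= K.+1%:R^-1 :> R by rewrite invr_ge0.
  move: (\sum_(0 <= k < K) t k) (K.+1%:R^-1 : R) (W : R) => x y w; lra.
have uz : u K @[K --> \oo] --> zeta (2 : R) by exact: u_cvg.
have cvt : (u K - 1 + K.+1%:R^-1) / 2 @[K --> \oo] --> (zeta (2 : R) - 1) / 2.
  apply: cvgM; last exact: cvg_cst.
  rewrite -[X in _ --> X]addr0; apply: cvgD; last exact: cvg_harmonic.
  by apply: cvgB => //; exact: cvg_cst.
have t_nd : nondecreasing_seq (fun K => \sum_(0 <= k < K) t k).
  by apply/nondecreasing_seqP => n; rewrite big_nat_recr//= lerDl.
have cvt' : \sum_(0 <= k < K) t k @[K --> \oo] --> (zeta (2 : R) - 1) / 2.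
  by apply: cvg_trans cvt; under eq_fun do rewrite sum_tE.
apply/eqP; rewrite eq_le; apply/andP; split.
  apply: W_le => K; rewrite -(cvg_lim _ cvt')//.
  apply: (nondecreasing_cvgn_le t_nd); apply/cvg_ex; eexists; exact: cvt'.
apply: ler_cvg_to cvt' (cvg_cst W) _; apply: nearW => K; exact: W_ge.
Qed.

(** For [z] on the circle the larger modulus is one, so that the second moment
    is Parseval's series. *)
Lemma Rintegral_ln_dst_sqr : \int[mu]_p (ln (dst z p) ^+ 2) = (zeta (2 : R) - 1) / 2.
Proof.
rewrite -WE; apply: eq_Rintegral => p _; rewrite /F /h z_unit.
rewrite (max_idPl _) ?ln1 ?mul0r ?subr0//.
by rewrite ge_min lexx orbT.
Qed.

End unit_modulus.
End reduced_ratio.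
End log_potential_mean.

(** * Sums of logarithms of distances *)

Lemma measurable_smooth_pos (R : realType) (e : R) : measurable_fun setT (smooth_pos e).
Proof.
apply: measurable_funD => //; apply: measurable_sqrt.
by apply: measurable_funD => //; exact: measurable_funX.
Qed.

Section potential_sums.
Context {R : realType} d (T : measurableType d) (P : probability T R).
Context (mu : probability (plane R) R).
Hypothesis mu_disc : disc_law mu.
Variable Y : nat -> T -> plane R.
Hypothesis mY : forall k, measurable_fun setT (Y k).
Hypothesis Y_law : forall k A, measurable A -> P (Y k @^-1` A) = mu A.
Hypothesis Y_indep : forall (J : {fset nat}) (A : nat -> set (plane R)),
  (forall k, k \in J -> measurable (A k)) ->
  P (\bigcap_(k in [set` J]) (Y k @^-1` A k)) =
  \big[*%E/1]_(k <- J) P (Y k @^-1` A k).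
Local Open Scope ring_scope.
Implicit Types (s : seq nat) (f : plane R -> R).

(** Chebyshev's inequality, the variance being at most the second moment. *)
Lemma chebyshev_centred f (v t : R) s : uniq s -> square_integrable mu f ->
  \int[mu]_p (f p ^+ 2) <= v -> 0 < t ->
  (P [set w | (t <= `|\sum_(j <- s) (f (Y j w) - \int[mu]_p f p)|)%R] <=
   ((size s)%:R * v / t ^+ 2)%:E)%E.
Proof.
move=> us sf fv t0; have [mf _] := sf; set m := \int[mu]_p f p.
pose g p := f p - m.
have sg : square_integrable mu g.
  by apply: square_integrableD => //; exact: square_integrable_cst.
have [mg _] := sg.
have g0 : \int[mu]_p g p = 0 by exact/Rintegral_centred/square_integrable_int.
have v0 : 0 <= \int[mu]_p (g p ^+ 2) by apply: Rintegral_ge0 => p _; exact: sqr_ge0.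
have gv : \int[mu]_p (g p ^+ 2) <= v by exact: le_trans (Rintegral_variance_le sf) fv.
apply: le_trans (chebyshev_iid_sum mY Y_law Y_indep mg us v0 t0 (integral_sqr_centred sg g0)) _.
by rewrite lee_fin ler_pM2r ?invr_gt0 ?exprn_gt0// ler_wpM2l.
Qed.

Let sigma : R := Num.sqrt ((zeta (2 : R) - 1) / 2).
Let e1 : plane R := (1, 0).

Let sqn_e1 : sqn e1 = 1. Proof. by rewrite /sqn/= expr1n expr0n/= addr0. Qed.

Let g p := ln (dst e1 p).
Let sg : square_integrable mu g.
Proof. by apply: square_integrable_ln_dst; rewrite // sqn_e1. Qed.

Let mg : measurable_fun setT g. Proof. by case: sg. Qed.

Let g0 : \int[mu]_p g p = 0.
Proof. by rewrite Rintegral_ln_dst ?sqn_e1// subrr mul0r oppr0. Qed.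

Let sigma2 : \int[mu]_p (g p ^+ 2) = sigma ^+ 2.
Proof.
have e : \int[mu]_p (g p ^+ 2) = (zeta (2 : R) - 1) / 2.
  by apply: Rintegral_ln_dst_sqr; rewrite ?sqn_e1.
rewrite sqr_sqrtr -e//; apply: Rintegral_ge0 => p _; exact: sqr_ge0.
Qed.

Let Z s w := \sum_(j <- s) g (Y j w).

Lemma measurable_unit_sum s : measurable_fun setT (Z s).
Proof. exact: measurable_iid_sum. Qed.

Lemma integral_sqr_unit_sum s : uniq s ->
  (\int[P]_w (Z s w ^+ 2)%:E = ((size s)%:R * sigma ^+ 2)%:E)%E.
Proof.
move=> us; have s0 : 0 <= sigma ^+ 2 by exact: sqr_ge0.
have H := integral_sqr_centred sg g0; rewrite sigma2 in H.
have := @integral_sqr_iid_sum _ _ _ P _ _ mu Y mY Y_law Y_indep g mg (sigma ^+ 2) s 0 us s0 H.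
by under eq_integral do rewrite add0r; move=> ->; rewrite expr0n add0r.
Qed.

(** [3 / e ^ 2] is the constant of [cubic_taylor_smooth_pos], and [162] and
    [sigma ^ 3] bound the third absolute moments of a term and of a step of the
    walk. *)
Let K (e : R) := 3 / e ^+ 2 * (162 + sigma ^+ 3).

Let coin_step (L : R) (psi : R -> R) : 0 <= L -> measurable_fun setT psi ->
  (forall x, 0 <= psi x) -> cubic_taylor L psi -> forall c,
  ((coin sigma psi c)%:E <= \int[mu]_u (psi (c + g u)%R)%:E + (L * (162 + sigma ^+ 3))%:E)%E /\
  (\int[mu]_u (psi (c + g u)%R)%:E <= (coin sigma psi c + L * (162 + sigma ^+ 3))%:E)%E.
Proof.
move=> L0 mpsi psi0 Lpsi c; have [A [B H]] := Lpsi c.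
have e11 : sqn e1 <= 1 by rewrite sqn_e1.
have [Ip Hp] := normr_Rintegral_cubic_taylor sg mpsi (disc_law_ln_cube mu_disc e11) g0 L0 H.
rewrite EFin_Rintegral//; rewrite sigma2 in Hp.
have s0 : 0 <= sigma by exact: sqrtr_ge0.
have H1 := H sigma; have H2 := H (- sigma); rewrite normrN sqrrN in H2; rewrite (ger0_norm s0) in H1 H2.
rewrite -EFinD !lee_fin.
move: H1 H2 Hp; rewrite !ler_norml /coin => /andP[a1 a2] /andP[b1 b2] /andP[c1 c2].
move: (\int[mu]_p _) (psi c) (psi (c + sigma)) (psi (c - sigma)) (sigma ^+ 2) (sigma ^+ 3) a1 a2 b1 b2 c1 c2.
by move=> I p0 p1 p2 t2 t3 a1 a2 b1 b2 c1 c2; split; lra.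
Qed.

(** Lindeberg's replacement leads to the coin walk with the same variance,
    for which [smooth_pos] is within [e] of [x + |x|] and the mean of [x] is
    zero. *)
Lemma integral_smooth_pos_unit_sum (e : R) s : 0 < e -> uniq s ->
  let N := size s in
  let a := sigma * iter N (coin 1) (fun x => `|x|) 0 in
  ((a)%:E <= \int[P]_w (smooth_pos e (Z s w))%:E + (N%:R * K e)%:E)%E /\
  (\int[P]_w (smooth_pos e (Z s w))%:E <= (a + e + N%:R * K e)%:E)%E.
Proof.
move=> e0 us N a.
have L0 : 0 <= 3 / e ^+ 2 by rewrite divr_ge0// sqr_ge0.
have s0 : 0 <= sigma by exact: sqrtr_ge0.
have K0 : 0 <= K e by rewrite mulr_ge0// addr_ge0// exprn_ge0.
have msp := measurable_smooth_pos e.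
have [] := @lindeberg _ _ _ P _ _ mu Y mY Y_law Y_indep g s (3 / e ^+ 2) (K e) sigma mg K0
  (fun psi mpsi psi0 Lpsi => coin_step L0 mpsi psi0 Lpsi) us (smooth_pos e) msp
  (smooth_pos_ge0 e) (cubic_taylor_smooth_pos e0) 0.
have -> : (\int[P]_w (smooth_pos e (0 + \sum_(j <- s) g (Y j w))%R)%:E =
   \int[P]_w (smooth_pos e (Z s w))%:E)%E by apply: eq_integral => w _; rewrite add0r.
have aE : iter N (coin sigma) (fun x => `|x|) 0 = a.
  rewrite -[in LHS](mulr0 sigma) iter_coin_scale.
  rewrite (@eq_iter_coin _ _ _ (fun x => sigma * `|x| + 0 * `|x|)); last first.
    by move=> x; rewrite normrM ger0_norm// mul0r addr0.
  by rewrite iter_coin_lin mul0r addr0.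
have b1 : a <= iter N (coin sigma) (smooth_pos e) 0.
  apply: (@le_trans _ _ (iter N (coin sigma) (fun x => 1 * (1 * x + 0) + 1 * `|x|) 0)).
    by rewrite iter_coin_lin iter_coin_affine aE mulr0 add0r mulr0 add0r mul1r.
  by apply: le_iter_coin => x; rewrite !mul1r addr0; exact: smooth_pos_ge.
have b2 : iter N (coin sigma) (smooth_pos e) 0 <= a + e.
  apply: (@le_trans _ _ (iter N (coin sigma) (fun x => 1 * (1 * x + e) + 1 * `|x|) 0)).
    apply: le_iter_coin => x; rewrite !mul1r addrAC; exact: smooth_pos_le (ltW e0).
  by rewrite iter_coin_lin iter_coin_affine aE mulr0 add0r !mul1r addrC.
move=> H1 H2; split.
  by apply: le_trans H1; rewrite lee_fin.
by apply: le_trans H2 _; rewrite lee_fin lerD2r.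
Qed.

(** By [ln_dst_law] the terms have the same law for all [u] on the circle. *)
Lemma unit_sum_law u s (phi : R -> \bar R) : uniq s -> sqn u = 1 ->
  measurable_fun setT phi -> (forall x, 0 <= phi x)%E ->
  (\int[P]_w phi (\sum_(j <- s) ln (dst u (Y j w)))%R = \int[P]_w phi (Z s w))%E.
Proof.
move=> us u1 mphi phi0.
apply: (iid_sum_law mY Y_law Y_indep us (g := fun p => ln (dst u p)) (g' := g)) => //.
  by have [] : square_integrable mu (fun p => ln (dst u p))
    by apply: square_integrable_ln_dst; rewrite // u1.
by move=> psi mpsi psi0; exact: ln_dst_law.
Qed.

End potential_sums.

(** * Conditioning on one of the variables *)

Section independent_events.
Context {R : realType} d (T : measurableType d) (P : probability T R).
Context d' (U : measurableType d') (mu : probability U R).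
Variable Y : nat -> T -> U.
Hypothesis mY : forall k, measurable_fun setT (Y k).
Hypothesis Y_law : forall k A, measurable A -> P (Y k @^-1` A) = mu A.
Hypothesis Y_indep : forall (J : {fset nat}) (A : nat -> set U),
  (forall k, k \in J -> measurable (A k)) ->
  P (\bigcap_(k in [set` J]) (Y k @^-1` A k)) =
  \big[*%E/1]_(k <- J) P (Y k @^-1` A k).
Implicit Types (s : seq nat) (k : nat).

Lemma measurable_past_pair s k : measurable_fun setT (fun w : T => ((w : past Y s), Y k w)).
Proof.
apply: measurable_fun_pair => //.
by move=> _ B mB; rewrite setTI; exact: measurable_past mB.
Qed.

Lemma measurable_past_event s k (E : set (past Y s * U)) : measurable E ->
  measurable [set w : T | E (w, Y k w)].
Proof.
move=> mE; rewrite -[X in measurable X]setTI.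
by have := @measurable_past_pair s k measurableT E mE.
Qed.

Lemma measurable_past_slice s (E : set (past Y s * U)) u : measurable E ->
  measurable ([set w | E (w, u)] : set T).
Proof.
move=> mE; apply: measurable_past; first exact: mY.
by have := measurable_ysection u mE; rewrite ysectionE.
Qed.

Lemma prob_indic d2 (V : measurableType d2) (Q : probability V R) (A : set V) :
  measurable A -> Q A = \int[Q]_v (\1_A v)%:E.
Proof. by move=> mA; rewrite integral_indic// setIT. Qed.

Lemma prob_indep1 s k (E : set (past Y s * U)) : k \notin s -> measurable E ->
  P [set w | E (w, Y k w)] = \int[P]_w mu [set u | E (w, u)].
Proof.
move=> ks mE.
have mF : measurable_fun setT (fun x : past Y s * U => (\1_E x : R)%:E).
  by apply/measurable_EFinP; exact: measurable_indic.
have F0 (x : past Y s * U) : 0 <= (\1_E x : R)%:E by rewrite lee_fin.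
have H := integral_indep1 mY Y_law Y_indep ks mF F0.
transitivity (\int[P]_w (\1_E (w, Y k w) : R)%:E).
  by apply: (prob_indic P); exact: measurable_past_event.
rewrite H; apply: eq_integral => w _.
apply/esym/(prob_indic mu).
by have := measurable_xsection (w : past Y s) mE; rewrite xsectionE.
Qed.

Lemma prob_indep2 s k (E : set (past Y s * U)) : k \notin s -> measurable E ->
  P [set w | E (w, Y k w)] = \int[mu]_u P [set w | E (w, u)].
Proof.
move=> ks mE.
have mF : measurable_fun setT (fun x : past Y s * U => (\1_E x : R)%:E).
  by apply/measurable_EFinP; exact: measurable_indic.
have F0 (x : past Y s * U) : 0 <= (\1_E x : R)%:E by rewrite lee_fin.
have H := integral_indep2 mY Y_law Y_indep ks mF F0.
transitivity (\int[P]_w (\1_E (w, Y k w) : R)%:E).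
  by apply: (prob_indic P); exact: measurable_past_event.
rewrite H; apply: eq_integral => u _.
apply/esym/(prob_indic P); exact: measurable_past_slice.
Qed.

Lemma measurable_prob_slice1 s (E : set (past Y s * U)) : measurable E ->
  measurable_fun setT (fun w : T => mu [set u | E (w, u)]).
Proof.
move=> mE; have := measurable_fun_xsection mu mE.
rewrite (_ : (mu \o xsection E) = fun w => mu [set u | E (w, u)]); last first.
  by apply/funext => w; rewrite /= xsectionE.
exact: measurable_fun_past.
Qed.

Lemma measurable_prob_slice2 s (E : set (past Y s * U)) : measurable E ->
  measurable_fun setT (fun u => P [set w | E (w, u)]).
Proof.
move=> mE.
have miota : measurable_fun setT (fun w : T => (w : past Y s)).
  by move=> _ B mB; rewrite setTI; exact: measurable_past mB.
pose iota' : {mfun T >-> past Y s} := HB.pack (fun w : T => (w : past Y s))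
  (isMeasurableFun.Build _ _ _ _ _ miota).
have := measurable_fun_ysection (distribution P iota') mE.
rewrite (_ : (_ \o ysection E) = fun u => P [set w | E (w, u)])//.
by apply/funext => u; rewrite /= ysectionE.
Qed.

End independent_events.

(** * A net of depths *)

Section net.
Context {R : realType}.
Local Open Scope ring_scope.
Implicit Types (x y z : plane R) (t b : R) (s : seq nat) (i : nat).

(** The depth of a point: minus the mean of the logarithmic potential there, by
    [Rintegral_ln_dst]. *)
Definition tau x : R := (1 - sqn x) / 2.

Definition scale t x : plane R := (t * x.1, t * x.2).

Lemma nrm_scale t x : nrm (scale t x) = `|t| * nrm x.
Proof.
rewrite /nrm -sqrtr_sqr -sqrtrM ?sqr_ge0//; congr Num.sqrt.
by rewrite /sqn/=; ring.
Qed.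

Lemma dst_scale t t' x : dst (scale t x) (scale t' x) = `|t - t'| * nrm x.
Proof. by rewrite -nrm_scale /dst /scale/=; congr nrm; congr pair; ring. Qed.

Lemma measurable_scale d (T : measurableType d) (f : T -> R) (g : T -> plane R) :
  measurable_fun setT f -> measurable_fun setT g ->
  measurable_fun setT (fun w => scale (f w) (g w)).
Proof.
move=> mf mg; apply: measurable_fun_pair; apply: measurable_funM => //;
  exact: measurableT_comp.
Qed.

Lemma ln_prod s (f : nat -> R) : (forall j, 0 < f j) ->
  ln (\prod_(j <- s) f j) = \sum_(j <- s) ln (f j).
Proof.
move=> f0; elim: s => [|j s IH]; first by rewrite !big_nil ln1.
by rewrite !big_cons lnM ?posrE ?IH//; apply: prodr_gt0.
Qed.

(** A net of depths on a radius. As they grow quadratically, it has about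
    [b ^ (- 1 / 2)] points, while a step is at most a small fraction of the
    depth plus a multiple of [b]. *)
Definition depth b i : R := b * i%:R ^+ 2.
Definition step b i : R := b * (2 * i%:R + 1).
Definition net b i x := scale ((1 - depth b i) / nrm x) x.
Definition unit_dir x := scale (nrm x)^-1 x.

Lemma depthS b i : depth b i.+1 = depth b i + step b i.
Proof. by rewrite /depth /step -natr1; ring. Qed.

Lemma sqn_unit_dir x : 0 < sqn x -> sqn (unit_dir x) = 1.
Proof.
move=> x0; have n0 : 0 < nrm x by rewrite /nrm sqrtr_gt0.
rewrite -sqr_nrm nrm_scale ger0_norm ?invr_ge0 ?nrm_ge0//.
by rewrite mulVf ?gt_eqF// expr1n.
Qed.

Lemma nrm_net b i x : 0 < sqn x -> depth b i <= 1 -> nrm (net b i x) = 1 - depth b i.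
Proof.
move=> x0 d1; have n0 : 0 < nrm x by rewrite /nrm sqrtr_gt0.
rewrite nrm_scale ger0_norm ?divr_ge0 ?subr_ge0 ?nrm_ge0//.
by rewrite divfK ?gt_eqF.
Qed.

Lemma dst_net_unit_dir b i x : 0 < sqn x -> 0 <= b ->
  dst (net b i x) (unit_dir x) = depth b i.
Proof.
move=> x0 b0; have n0 : 0 < nrm x by rewrite /nrm sqrtr_gt0.
have d0 : 0 <= depth b i by rewrite mulr_ge0// sqr_ge0.
rewrite /net /unit_dir dst_scale.
rewrite (_ : _ - _ = - (depth b i / nrm x)); last by field; rewrite gt_eqF.
by rewrite normrN ger0_norm ?divr_ge0 ?nrm_ge0// divfK// gt_eqF.
Qed.

(** Let [dp], the distance from the point of the segment to the circle, be
    between [depth b i] and [depth b i.+1]: moving that point to the net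
    changes each distance by at most [step b i]. As [x] is farther along the
    radius, it is not deeper. *)
Lemma net_exists b (K : nat) x t s (y : nat -> plane R) : 0 < b ->
  1 <= depth b K.+1 -> 0 < sqn x < 1 -> 0 <= t <= 1 ->
  1 <= dst (scale t x) x * \prod_(j <- s) dst (scale t x) (y j) ->
  exists2 i, (i <= K)%N &
    tau x <= depth b i - depth b i ^+ 2 / 2 + step b i /\
    0 <= \sum_(j <- s) ln (dst (net b i x) (y j) + step b i).
Proof.
move=> b0 K1 /andP[x0 x1] /andP[t0 t1] H.
have n0 : 0 < nrm x by rewrite /nrm sqrtr_gt0.
have n1 : nrm x < 1 by exact: nrm_lt1.
pose dp := 1 - t * nrm x.
have tn : t * nrm x <= nrm x by rewrite ler_piMl// ltW.
have dp0 : 0 < dp by rewrite /dp; lra.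
have dp1 : dp <= 1 by rewrite /dp lerBlDr lerDl mulr_ge0// ltW.
have ex : exists m, dp <= depth b m by exists K.+1; exact: le_trans K1.
have [m dm Hm] := ex_minnP ex.
have mK : (m <= K.+1)%N by apply: Hm; exact: le_trans K1.
case: m dm Hm mK => [|i] dm Hm mK.
  by move: dm; rewrite /depth expr0n/= mulr0 leNgt dp0.
exists i => //.
have di : depth b i < dp by rewrite ltNge; apply/negP => /Hm; rewrite ltnn.
have di0 : 0 <= depth b i by rewrite mulr_ge0 ?(ltW b0)// sqr_ge0.
have st0 : 0 < step b i by rewrite mulr_gt0// ltr_wpDl// mulr_ge0.
rewrite depthS in dm; split.
  have : tau x <= dp - dp ^+ 2 / 2.
    rewrite (_ : dp - _ = (1 - (t * nrm x) ^+ 2) / 2); last by rewrite /dp; field.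
    rewrite /tau -sqr_nrm ler_pM2r ?invr_gt0// lerB// lerXn2r ?nnegrE ?mulr_ge0//; exact: ltW.
  have : depth b i ^+ 2 <= dp ^+ 2 by rewrite lerXn2r ?nnegrE// ltW.
  move: (depth b i ^+ 2) (dp ^+ 2) (depth b i) dm => A B D dm; lra.
have near j : dst (scale t x) (y j) <= dst (net b i x) (y j) + step b i.
  rewrite addrC; apply: le_trans (dst_triangle (net b i x) _ _) _; rewrite lerD2r.
  rewrite /net dst_scale (_ : _ - _ = (depth b i - dp) / nrm x); last first.
    by rewrite /dp; field; rewrite gt_eqF.
  rewrite normrM normfV (gtr0_norm n0) divfK ?gt_eqF//.
  by rewrite ltr0_norm ?subr_lt0// opprB lerBlDl.
have near0 j : 0 < dst (net b i x) (y j) + step b i by rewrite ltr_wpDl// dst_ge0.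
rewrite -ln_prod//; apply: ln_ge0; apply: (le_trans H).
have p0 : 0 <= \prod_(j <- s) dst (scale t x) (y j) by apply: prodr_ge0 => j _; exact: dst_ge0.
apply: (@le_trans _ _ (\prod_(j <- s) dst (scale t x) (y j))).
  rewrite ler_piMl//.
  have -> : dst (scale t x) x = dst (scale t x) (scale 1 x).
    by case: (x) => u v; rewrite /scale/= !mul1r.
  rewrite dst_scale ler0_norm ?subr_le0// opprB.
  have : 0 <= t * nrm x by rewrite mulr_ge0// ltW.
  by rewrite mulrBl mul1r; lra.
elim: (s) => [|j s' IH]; first by rewrite !big_nil.
by rewrite !big_cons ler_pM ?dst_ge0//; apply: prodr_ge0 => ? _; exact: dst_ge0.
Qed.

End net.

(** * The upper bound *)

Section depth_law.
Context {R : realType} (mu : probability (plane R) R).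
Hypothesis mu_disc : disc_law mu.
Local Open Scope ring_scope.

Lemma measurable_tau : measurable_fun setT (@tau R).
Proof.
apply: measurable_funM => //; apply: measurable_funB => //; exact: measurable_sqn.
Qed.

Lemma tau_leE (c : R) : [set x : plane R | tau x <= c] = ~` [set x | sqn x < 1 - 2 * c].
Proof.
apply/seteqP; split => x /=; rewrite /tau.
  by move=> H; apply/negP; rewrite -leNgt; lra.
by move=> /negP; rewrite -leNgt => H; lra.
Qed.

(** As [sqn] is uniform on the unit interval, [tau] is uniform on its lower
    half. *)
Lemma disc_law_tau_le (c : R) : 0 <= c <= 1 / 2 ->
  mu [set x | (tau x <= c)%R] = (2 * c)%:E.
Proof.
move=> c01; have mS : measurable [set x : plane R | (sqn x < 1 - 2 * c)%R].
  by apply: measurable_ltr_set => //; exact: measurable_sqn.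
rewrite tau_leE probability_setC//.
have c01' : 0 <= 1 - 2 * c <= 1 by lra.
have e := disc_law_sqn_lt mu_disc c01'.
by rewrite [X in (_ - X)%E]e -EFinB; congr EFin; ring.
Qed.

Lemma disc_law_tau_ub (c : R) :
  (mu [set x | (tau x <= c)%R] <= (2 * Num.max c 0)%:E)%E.
Proof.
have mT c' : measurable [set x : plane R | (tau x <= c')%R].
  by apply: measurable_ler_set => //; exact: measurable_tau.
have [c0|c0] := leP c 0.
  have z01 : 0 <= (0 : R) <= 1 / 2 by rewrite lexx/= divr_ge0.
  rewrite mulr0 -(mulr0 2) -(disc_law_tau_le z01).
  by apply: le_measure; rewrite ?inE// => x /=; move=> H; exact: le_trans c0.
have [c1|c1] := leP c (1 / 2).
  by rewrite disc_law_tau_le// (ltW c0).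
by apply: le_trans (probability_le1 mu (mT c)) _; rewrite lee_fin; lra.
Qed.

End depth_law.

Section upper_events.
Context {R : realType} d (T : measurableType d) (P : probability T R).
Context (mu : probability (plane R) R).
Hypothesis mu_disc : disc_law mu.
Variable Y : nat -> T -> plane R.
Hypothesis mY : forall k, measurable_fun setT (Y k).
Hypothesis Y_law : forall k A, measurable A -> P (Y k @^-1` A) = mu A.
Hypothesis Y_indep : forall (J : {fset nat}) (A : nat -> set (plane R)),
  (forall k, k \in J -> measurable (A k)) ->
  P (\bigcap_(k in [set` J]) (Y k @^-1` A k)) =
  \big[*%E/1]_(k <- J) P (Y k @^-1` A k).
Variables (s : seq nat) (k : nat).
Hypothesis us : uniq s.
Hypothesis ks : k \notin s.
Local Open Scope ring_scope.

Let sigma : R := Num.sqrt ((zeta (2 : R) - 1) / 2).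
Let Z w := \sum_(j <- s) ln (dst (1, 0) (Y j w)).
Let N : R := (size s)%:R.
Let r : R := Num.sqrt N.

Lemma unit_sum_ge_law u (a : R) : sqn u = 1 ->
  P [set w | (a <= \sum_(j <- s) ln (dst u (Y j w)))%R] = P [set w | (a <= Z w)%R].
Proof.
move=> u1.
have mg v : measurable_fun setT (fun p : plane R => ln (dst v p)).
  by apply: measurableT_comp; [exact: measurable_ln|exact: measurable_dst].
have mA v : measurable [set w | (a <= \sum_(j <- s) ln (dst v (Y j w)))%R].
  by apply: measurable_ler_set => //; exact: (measurable_iid_sum mY (mg v)).
pose phi (x : R) : \bar R := (\1_[set x : R | a <= x] x)%:E.
have mphi : measurable_fun setT phi.
  by apply/measurable_EFinP; apply: measurable_indic; exact: measurable_ler_set.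
have phi0 x : (0 <= phi x)%E by rewrite lee_fin.
rewrite (prob_indic P (mA u)) (prob_indic P (mA (1, 0))).
exact: (unit_sum_law mu_disc mY Y_law Y_indep us u1 mphi phi0).
Qed.

Hypothesis s0 : (0 < size s)%N.

Let N0 : 0 < N. Proof. by rewrite ltr0n. Qed.
Let r0 : 0 < r. Proof. by rewrite sqrtr_gt0. Qed.
Let r2 : r ^+ 2 = N. Proof. by rewrite sqr_sqrtr// ltW. Qed.

Variables (eps b : R).
Hypothesis eps0 : 0 < eps.
Hypothesis eps1 : eps < 1.
Hypothesis b0 : 0 < b.
Hypothesis stepb : forall i, 5 * step b i <= eps / 4 * depth b i + eps / r.

Let depth0 i : 0 <= depth b i. Proof. by rewrite mulr_ge0 ?(ltW b0)// sqr_ge0. Qed.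
Let step0 i : 0 < step b i. Proof. by rewrite mulr_gt0// ltr_wpDl// mulr_ge0. Qed.

(** The level which [Z] has to exceed for [x] to be isolated, lowered by a
    small fraction of itself and of its standard deviation. *)
Let thr x : R := (1 - eps) * N * tau x - 2 * eps * r.

Let Smain (w : T) x := \sum_(j <- s) ln (dst (unit_dir x) (Y j w)).
Let Snet i (w : T) x := \sum_(j <- s) ln (dst (net b i x) (Y j w) + step b i).

(** When the segment from the origin to a point of the disc leaves the
    lemniscate, [Emain] or some [Enet i] occurs, by [net_exists]. *)
Let Emain : set (past Y s * plane R) := [set v | 0 < sqn v.2 < 1 /\ thr v.2 <= Smain v.1 v.2].
Let Enet i : set (past Y s * plane R) :=
  [set v | [/\ 0 < sqn v.2 < 1,
    tau v.2 <= depth b i - depth b i ^+ 2 / 2 + step b i,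
    0 <= Snet i v.1 v.2 & Smain v.1 v.2 < thr v.2]].

Let measurable_inv_nrm : measurable_fun setT (fun x : plane R => (nrm x)^-1).
Proof.
apply: measurable_inv_ge0 => [p|]; first exact: nrm_ge0.
exact: measurable_nrm.
Qed.

Let measurable_Smain : measurable_fun setT (fun v : past Y s * plane R => Smain v.1 v.2).
Proof.
have mg : measurable_fun setT (fun v : plane R * plane R => ln (dst (unit_dir v.1) v.2)); last first.
  exact: (measurable_past_sum mg).
apply: measurableT_comp; first exact: measurable_ln.
apply: measurable_dst => //; apply: measurable_scale => //.
exact: (measurableT_comp measurable_inv_nrm).
Qed.

Let measurable_Snet i : measurable_fun setT (fun v : past Y s * plane R => Snet i v.1 v.2).
Proof.
have mg : measurable_fun setT
    (fun v : plane R * plane R => ln (dst (net b i v.1) v.2 + step b i)); last first.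
  exact: (measurable_past_sum mg).
apply: measurable_ln_dst => //; apply: measurable_scale => //.
by apply: measurable_funM => //; exact: (measurableT_comp measurable_inv_nrm).
Qed.

Let measurable_thr : measurable_fun setT (fun v : past Y s * plane R => thr v.2).
Proof.
apply: measurable_funB => //; apply: measurable_funM => //.
exact: (measurableT_comp measurable_tau).
Qed.

Let measurable_guard : measurable [set v : past Y s * plane R | 0 < sqn v.2 < 1].
Proof.
have ms : measurable_fun setT (fun v : past Y s * plane R => sqn v.2).
  exact: (measurableT_comp (@measurable_sqn R)).
rewrite (_ : [set _ | _] = [set v | 0 < sqn v.2] `&` [set v | sqn v.2 < 1]).
  by apply: measurableI; exact: measurable_ltr_set.
by apply/seteqP; split => v /= => [/andP[]|[-> ->]].
Qed.

Let measurable_Emain : measurable Emain.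
Proof. by apply: measurableI => //; exact: measurable_ler_set. Qed.

Let measurable_Enet i : measurable (Enet i).
Proof.
rewrite (_ : Enet i = [set v : past Y s * plane R | 0 < sqn v.2 < 1] `&`
  ([set v | tau v.2 <= depth b i - depth b i ^+ 2 / 2 + step b i] `&`
  ([set v | 0 <= Snet i v.1 v.2] `&` [set v | Smain v.1 v.2 < thr v.2]))).
  apply: measurableI => //; apply: measurableI.
    by apply: measurable_ler_set => //; exact: (measurableT_comp measurable_tau).
  by apply: measurableI; [exact: measurable_ler_set|exact: measurable_ltr_set].
by apply/seteqP; split => v /= => [[]|[? [? []]]].
Qed.

Let K (e : R) := 3 / e ^+ 2 * (162 + sigma ^+ 3).

(** The sum at the radial projection has the law of [Z] and is independent of
    the depth. Given [Z], the depth has to be at most about [Z / N], which by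
    [disc_law_tau_ub] has probability at most [2 Z^+ / N]; the mean of [2 Z^+]
    is that of [integral_smooth_pos_unit_sum]. *)
Let prob_main (e : R) : 0 < e ->
  (P [set w | Emain (w, Y k w)] <=
   ((sigma * iter (size s) (coin 1) (fun x => `|x|) 0 + e + N * K e + 4 * eps * r) /
     ((1 - eps) * N))%:E)%E.
Proof.
move=> e0.
pose E' : set (past Y s * plane R) := [set v | thr v.2 <= Z v.1].
have mZ : measurable_fun setT (fun v : past Y s * plane R => Z v.1).
  have mg : measurable_fun setT (fun v : plane R * plane R => ln (dst (1, 0) v.2)); last first.
    exact: (measurable_past_sum mg).
  by apply: measurableT_comp; [exact: measurable_ln|exact: measurable_dst].
have mE' : measurable E' by exact: measurable_ler_set.
apply: (@le_trans _ _ (P [set w | E' (w, Y k w)])).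
  rewrite (prob_indep2 mY Y_law Y_indep ks measurable_Emain).
  rewrite (prob_indep2 mY Y_law Y_indep ks mE').
  apply: ge0_le_integral => //.
  - exact: (measurable_prob_slice2 P mY measurable_Emain).
  - exact: (measurable_prob_slice2 P mY mE').
  move=> x _; have [x01|x01] := boolP (0 < sqn x < 1); last first.
    rewrite (_ : [set w | Emain (w, x)] = set0) ?measure0//.
    by apply/seteqP; split => // w [/=]; rewrite (negbTE x01).
  have x0 : 0 < sqn x by case/andP: x01.
  have -> : P [set w | E' (w, x)] = P [set w | (thr x <= Smain w x)%R].
    by rewrite -(unit_sum_ge_law (thr x) (sqn_unit_dir x0)).
  apply: le_measure; rewrite ?inE.
  - exact: (measurable_past_slice mY x measurable_Emain).
  - have := measurable_past_slice mY x (measurable_ler_set measurable_thr measurable_Smain).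
    exact.
  - by move=> w [].
have c0 : 0 < (1 - eps) * N by rewrite mulr_gt0// subr_gt0.
have msp : measurable_fun setT (fun w : T => smooth_pos e (Z w)).
  have mZ' : measurable_fun setT Z by exact: (measurable_unit_sum mu_disc mY s).
  exact: (measurableT_comp (measurable_smooth_pos e) mZ').
rewrite (prob_indep1 mY Y_law Y_indep ks mE').
apply: (@le_trans _ _ (\int[P]_w (((1 - eps) * N)^-1%:E * ((smooth_pos e (Z w))%:E + (4 * eps * r)%:E)))%E).
  apply: ge0_le_integral => //.
  - exact: (measurable_prob_slice1 mu mY mE').
  - apply/measurable_EFinP; apply: measurable_funM => //; exact: measurable_funD.
  move=> w _.
  have -> : [set u | E' (w, u)] = [set u | (tau u <= (Z w + 2 * eps * r) / ((1 - eps) * N))%R].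
    by apply/seteqP; split => u; rewrite /E' /thr/= ler_pdivlMr// (mulrC (tau u)) lerBlDr.
  apply: le_trans (disc_law_tau_ub mu_disc _) _; rewrite -EFinD -EFinM lee_fin.
  rewrite -[leRHS]mulrC ler_pdivlMr//.
  have -> : 2 * Num.max ((Z w + 2 * eps * r) / ((1 - eps) * N)) 0 * ((1 - eps) * N) =
      2 * Num.max (Z w + 2 * eps * r) 0.
    rewrite -mulrA maxr_pMl ?ltW// mul0r; congr (_ * Num.max _ _).
    by rewrite divfK// gt_eqF.
  have := smooth_pos_ge e (Z w).
  have er : 0 <= eps * r by rewrite mulr_ge0// ltW.
  have := ler_norm (Z w); have := ler_norm (- Z w); rewrite normrN.
  rewrite -!mulrA; move: (eps * r) er (smooth_pos e (Z w)) (`|Z w|) (Z w) => q q0 S A z.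
  by case: (leP (z + 2 * q)) => zq; lra.
have sp0 w : (0 <= (smooth_pos e (Z w))%:E)%E by rewrite lee_fin smooth_pos_ge0.
have er : 0 <= 4 * eps * r by rewrite !mulr_ge0// ltW.
rewrite ge0_integralZl_EFin//; last 3 first.
- by move=> w _; rewrite adde_ge0// lee_fin.
- by apply/measurable_EFinP; exact: measurable_funD.
- by rewrite invr_ge0 ltW.
rewrite ge0_integralD//; last exact/measurable_EFinP.
rewrite integral_cst_prob.
have [_ H] := integral_smooth_pos_unit_sum mu_disc mY Y_law Y_indep e0 us.
apply: le_trans (lee_wpmul2l _ (leeD2r _ H)) _.
  by rewrite lee_fin invr_ge0 ltW.
by rewrite -EFinD -EFinM lee_fin mulrC.
Qed.

(** The deviation enforced by [Enet i]. *)
Let theta i : R := eps * (N * depth b i / 4 + r).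

Let theta0 i : 0 < theta i.
Proof. by rewrite mulr_gt0// ltr_wpDl// divr_ge0// mulr_ge0// ltW. Qed.

Let sqn_net_le1 i x : 0 < sqn x -> depth b i <= 1 -> sqn (net b i x) <= 1.
Proof.
move=> x0 d1; rewrite -sqr_nrm nrm_net// exprn_ile1 ?subr_ge0// gerBl//.
Qed.

Let step_small i : N * (5 * step b i) <= eps / 4 * (N * depth b i) + eps * r.
Proof.
have := ler_wpM2l (ltW N0) (stepb i).
rewrite mulrDr (_ : N * (eps / r) = eps * r); last by rewrite -r2; field; rewrite gt_eqF.
by rewrite [N * (_ * depth b i)]mulrCA.
Qed.

(** Below the level, a nonnegative sum at the point of the net forces the sum
    of the differences of the potentials there and at the radial projection to
    deviate from its mean. Their second moment is bounded by
    [disc_law_ln_dst_sqr]. *)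
Let Enet_deviation i x : 0 < sqn x < 1 -> depth b i < 1 ->
  tau x <= depth b i - depth b i ^+ 2 / 2 + step b i ->
  (P [set w | Enet i (w, x)] <=
   (N * (32 * (depth b i + step b i)) / theta i ^+ 2)%:E)%E.
Proof.
move=> x01 d1' tx; have d1 := ltW d1'; have /andP[x0 x1] := x01.
have u1 := sqn_unit_dir x0; have z1 := sqn_net_le1 x0 d1.
pose F1 p := ln (dst (net b i x) p + step b i).
pose F2 p := ln (dst (unit_dir x) p).
have u1' : sqn (unit_dir x) <= 1 by rewrite u1.
have s1 : square_integrable mu F1.
  by apply: square_integrable_ln_dstD => //; exact: ltW.
have s2 : square_integrable mu F2 by exact: square_integrable_ln_dst.
pose f p := F1 p + -1 * F2 p.
have sf : square_integrable mu f.
  by apply: square_integrableD => //; exact: square_integrableZ.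
set v := 32 * (depth b i + step b i).
have fv : \int[mu]_p (f p ^+ 2) <= v.
  rewrite -lee_fin -EFin_Rintegral_sqr//.
  have := disc_law_ln_dst_sqr mu_disc (net b i x) (unit_dir x) (ltW (step0 i)).
  rewrite dst_net_unit_dir ?(ltW b0)//; apply: le_trans; rewrite le_eqVlt; apply/predU1P; left.
  by apply: eq_integral => p _; rewrite /f /F1 /F2 mulN1r.
have fm : \int[mu]_p f p <= - (depth b i - depth b i ^+ 2 / 2) + 4 * step b i.
  have I1 := square_integrable_int s1; have I2 := square_integrable_int s2.
  rewrite /f RintegralD//; last exact: integrableZ_EFin.
  rewrite RintegralZl//.
  have u0 : 0 < sqn (unit_dir x) by rewrite u1.
  have -> : \int[mu]_p F2 p = 0.
    by rewrite (Rintegral_ln_dst mu_disc u0 u1') u1 subrr mul0r oppr0.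
  rewrite mulr0 addr0; apply: le_trans (disc_law_ln_dstD_le mu_disc z1 (ltW (step0 i))) _.
  rewrite lerD2r.
  have nz : nrm (net b i x) = 1 - depth b i by exact: nrm_net.
  have zz : 0 < sqn (net b i x).
    by rewrite -sqr_nrm nz exprn_gt0// subr_gt0.
  rewrite (Rintegral_ln_dst mu_disc zz z1) -sqr_nrm nz lerN2.
  by rewrite le_eqVlt; apply/predU1P; left; field.
have H := chebyshev_centred mY Y_law Y_indep us sf fv (theta0 i).
apply: le_trans H; apply: le_measure; rewrite ?inE.
- exact: (measurable_past_slice mY x (measurable_Enet i)).
- apply: measurable_ler_set => //; apply: measurableT_comp => //.
  apply: (measurable_iid_sum mY (g := fun p => f p - \int[mu]_p f p)).
  by apply: measurable_funB => //; have [] := sf.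
move=> w [_ _ /= S1 S2].
have E : \sum_(j <- s) (f (Y j w) - \int[mu]_p f p) =
    Snet i w x - Smain w x - N * \int[mu]_p f p.
  rewrite sumrB big_const_seq count_predT iter_addr_0 mulr_natl -sumrB; congr (_ - _).
  by apply: eq_bigr => j _; rewrite /f mulN1r.
rewrite E; apply: le_trans (ler_norm _).
have tau_net' : depth b i / 2 <= depth b i - depth b i ^+ 2 / 2.
  have : depth b i ^+ 2 <= depth b i by rewrite expr2 ler_piMl.
  lra.
have h1 := ler_wpM2l (ltW N0) fm.
have h2 : N * ((1 - eps) * tau x) <=
    N * ((1 - eps) * (depth b i - depth b i ^+ 2 / 2) + step b i).
  rewrite ler_pM2l//; apply: (@le_trans _ _ ((1 - eps) * (depth b i - depth b i ^+ 2 / 2 + step b i))).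
    by rewrite ler_wpM2l// subr_ge0 ltW.
  by rewrite mulrDr lerD2l ler_piMl ?(ltW (step0 i))// gerBl ltW.
have h3 := ler_wpM2l (ltW (mulr_gt0 N0 eps0)) tau_net'.
have h4 := step_small i.
move: S1 S2 h1 h2 h3 h4; rewrite /thr /theta.
move: (Snet i w x) (Smain w x) (\int[mu]_p f p) (tau x) (depth b i) (step b i) (r : R) (N : R).
move=> A B m t D S r' N' S1 S2 h1 h2 h3 h4; lra.
Qed.

(** Both the probability that the point is not deeper than
    [depth b i + step b i] and the bound of [Enet_deviation] are proportional
    to this quantity, and [theta i] is at least of the order of [N] times it:
    the product is of order [1 / N], uniformly in [i]. *)
Let prob_net i : depth b i < 1 ->
  (P [set w | Enet i (w, Y k w)] <= (4096 / (eps ^+ 2 * N))%:E)%E.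
Proof.
move=> d1; have mE := measurable_Enet i.
rewrite (prob_indep2 mY Y_law Y_indep ks mE).
set c := N * (32 * (depth b i + step b i)) / theta i ^+ 2.
set A := [set x : plane R | tau x <= depth b i + step b i].
have mA : measurable A by apply: measurable_ler_set => //; exact: measurable_tau.
have ds0 : 0 <= depth b i + step b i by rewrite addr_ge0// ltW.
have c0 : 0 <= c by rewrite divr_ge0 ?sqr_ge0// !mulr_ge0// ltW.
apply: (@le_trans _ _ (\int[mu]_x (c%:E * (\1_A x)%:E))%E).
  apply: ge0_le_integral => //.
  - exact: (measurable_prob_slice2 P mY mE).
  - by apply/measurable_EFinP; exact: measurable_funM.
  move=> x _.
  have [x01|x01] := boolP (0 < sqn x < 1); last first.
    rewrite (_ : [set w | Enet i (w, x)] = set0) ?measure0//.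
      by rewrite -EFinM lee_fin mulr_ge0.
    by apply/seteqP; split => // w [/=]; rewrite (negbTE x01).
  have [tx|tx] := leP (tau x) (depth b i - depth b i ^+ 2 / 2 + step b i); last first.
    rewrite (_ : [set w | Enet i (w, x)] = set0) ?measure0//.
      by rewrite -EFinM lee_fin mulr_ge0.
    by apply/seteqP; split => // w [/= _]; rewrite leNgt tx.
  have -> : \1_A x = 1 :> R.
    rewrite indicE mem_set// /A/=; apply: le_trans tx _.
    by rewrite lerD2r gerBl divr_ge0// sqr_ge0.
  by rewrite mule1; exact: Enet_deviation.
rewrite ge0_integralZl_EFin//; last exact/measurable_EFinP.
rewrite -(prob_indic mu mA).
apply: le_trans (lee_wpmul2l _ (disc_law_tau_ub mu_disc _)) _ => //.
rewrite -EFinM lee_fin (max_idPl ds0).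
have h : N * (depth b i + step b i) <= 8 / eps * theta i.
  have -> : 8 / eps * theta i = 2 * (N * depth b i) + 8 * r.
    by rewrite /theta; field; rewrite gt_eqF.
  have h1 := step_small i; have h2 : 0 <= N * depth b i by rewrite mulr_ge0// ltW.
  have h3 : eps * (N * depth b i) <= N * depth b i by rewrite ler_piMl// ltW.
  have h4 : eps * r <= r by rewrite ler_piMl ?(ltW r0)// ltW.
  move: h1 h2 h3 h4 (ltW r0); rewrite mulrDr.
  move: (N * depth b i) => q; rewrite [N * (5 * _)]mulrCA.
  move: (N * step b i) (eps * r) (r : R) => t u r' h1 h2 h3 h4 h5; lra.
have h0 : 0 <= N * (depth b i + step b i) by rewrite mulr_ge0// ltW.
have hsq : (N * (depth b i + step b i)) ^+ 2 <= (8 / eps * theta i) ^+ 2.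
  by rewrite lerXn2r ?nnegrE// (le_trans h0).
have -> : c * (2 * (depth b i + step b i)) =
    64 / N / theta i ^+ 2 * (N * (depth b i + step b i)) ^+ 2.
  by rewrite /c; field; rewrite !gt_eqF// theta0.
apply: (@le_trans _ _ (64 / N / theta i ^+ 2 * (8 / eps * theta i) ^+ 2)).
  by rewrite ler_wpM2l// !divr_ge0 ?sqr_ge0// ltW.
by rewrite le_eqVlt; apply/predU1P; left; field; rewrite !gt_eqF// theta0.
Qed.

Let prob_null : P [set w | ~ (0 < sqn (Y k w) < 1)%R] = 0.
Proof.
have mle : measurable [set p : plane R | sqn p <= 0].
  by apply: measurable_ler_set => //; exact: measurable_sqn.
have mge : measurable [set p : plane R | 1 <= sqn p].
  by apply: measurable_ler_set => //; exact: measurable_sqn.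
have -> : [set w | ~ (0 < sqn (Y k w) < 1)%R] =
    Y k @^-1` ([set p | sqn p <= 0] `|` [set p | 1 <= sqn p]).
  apply/seteqP; split => w /=.
    by move/negP; rewrite negb_and -!leNgt => /orP.
  by move=> /orP H; apply/negP; rewrite negb_and -!leNgt.
rewrite Y_law; last exact: measurableU.
have z01 : 0 <= (0 : R) <= 1 by rewrite lexx ler01.
have e1 := disc_law_sqn_le mu_disc z01; have e2 := disc_law_setC mu_disc.
by apply: (@null_set_setU _ _ _ mu).
Qed.

(** [B] is the union of [Emain], of the [Enet i] and of the null event that the
    point is not in the punctured disc. *)
Lemma upper_event (e : R) (M : nat) : 0 < e -> 1 <= depth b M.+1 ->
  (forall i, (i <= M)%N -> depth b i < 1) ->
  exists B : set T, [/\ measurable B,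
    (P B <= ((sigma * iter (size s) (coin 1) (fun x => `|x|) 0 + e + N * K e + 4 * eps * r) /
     ((1 - eps) * N) + M.+1%:R * (4096 / (eps ^+ 2 * N)))%:E)%E &
    forall w, ~ B w -> forall t, 0 <= t <= 1 ->
      dst (scale t (Y k w)) (Y k w) * \prod_(j <- s) dst (scale t (Y k w)) (Y j w) < 1].
Proof.
move=> e0 M1 MK.
pose B0 := [set w | ~ (0 < sqn (Y k w) < 1)].
pose B1 := [set w | Emain (w, Y k w)].
pose B2 i := [set w | Enet i (w, Y k w)].
have m0 : measurable B0.
  rewrite (_ : B0 = ~` (Y k @^-1` [set p | 0 < sqn p < 1])); last by [].
  apply: measurableC; apply: measurable_preimage => //.
  rewrite (_ : [set p : plane R | 0 < sqn p < 1] = [set p | 0 < sqn p] `&` [set p | sqn p < 1]).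
    by apply: measurableI; apply: measurable_ltr_set => //; exact: measurable_sqn.
  by apply/seteqP; split => v /= => [/andP[]|[-> ->]].
have m1 : measurable B1 by exact: (measurable_past_event mY k measurable_Emain).
have m2 i : measurable (B2 i) by exact: (measurable_past_event mY k (measurable_Enet i)).
exists (B0 `|` B1 `|` \big[setU/set0]_(i < M.+1) B2 i); split.
- apply: measurableU; first exact: measurableU.
  by apply: bigsetU_measurable.
- apply: le_trans (measureU2 _ _ _) _ => //; [exact: measurableU|exact: bigsetU_measurable|].
  rewrite EFinD; apply: leeD.
    apply: le_trans (measureU2 _ _ _) _ => //.
    have := prob_main e0; rewrite -/B1 => H.
    by rewrite [X in (X + _)%E](prob_null : P B0 = 0) add0e.
  apply: le_trans (Boole_inequality _ _) _ => //.
  apply: (@le_trans _ _ (\sum_(i < M.+1) (4096 / (eps ^+ 2 * N))%:E)%E).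
    apply: lee_sum => i _; apply: prob_net; apply: MK.
    by rewrite -ltnS.
  by rewrite sumEFin lee_fin sumr_const card_ord -[leLHS]mulr_natl.
move=> w nB t t01; rewrite ltNge; apply/negP => H; apply: nB.
have [x01|x01] := boolP (0 < sqn (Y k w) < 1); last first.
  by left; left; rewrite /B0/=; apply/negP.
have [i iM [ti Si]] := net_exists b0 M1 x01 t01 H.
have [thr_le|thr_gt] := leP (thr (Y k w)) (Smain w (Y k w)).
  by left; right; split.
by right; rewrite -(bigcup_mkord M.+1 B2); exists i => //; split.
Qed.

End upper_events.

(** * The lower bound *)

Section lower_events.
Context {R : realType} d (T : measurableType d) (P : probability T R).
Context (mu : probability (plane R) R).
Hypothesis mu_disc : disc_law mu.
Variable Y : nat -> T -> plane R.
Hypothesis mY : forall k, measurable_fun setT (Y k).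
Hypothesis Y_law : forall k A, measurable A -> P (Y k @^-1` A) = mu A.
Hypothesis Y_indep : forall (J : {fset nat}) (A : nat -> set (plane R)),
  (forall k, k \in J -> measurable (A k)) ->
  P (\bigcap_(k in [set` J]) (Y k @^-1` A k)) =
  \big[*%E/1]_(k <- J) P (Y k @^-1` A k).
Variables (s : seq nat) (k : nat).
Hypothesis us : uniq s.
Hypothesis ks : k \notin s.
Local Open Scope ring_scope.

Let sigma : R := Num.sqrt ((zeta (2 : R) - 1) / 2).
Let Z w := \sum_(j <- s) ln (dst (1, 0) (Y j w)).
Let N : R := (size s)%:R.
Let r : R := Num.sqrt N.

Hypothesis s0 : (0 < size s)%N.

Let N0 : 0 < N. Proof. by rewrite ltr0n. Qed.
Let r0 : 0 < r. Proof. by rewrite sqrtr_gt0. Qed.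
Let r2 : r ^+ 2 = N. Proof. by rewrite sqr_sqrtr// ltW. Qed.

(* [L] is the level that the sum of the logarithms has to reach, and only points
   at depth at most [M / r] are retained. *)
Variables (eps L M : R).
Hypothesis eps0 : 0 < eps.
Hypothesis L0 : 0 <= L.
Hypothesis M0 : 0 < M.
Hypothesis Mr : M / r <= 1 / 2.

Let S (w : T) x := \sum_(j <- s) ln (dst x (Y j w)).
Let thr x : R := N * tau x + L + eps * r.
Let h : R := M / r.

Let E : set (past Y s * plane R) := [set v | L <= S v.1 v.2].
Let Ez : set (past Y s * plane R) := [set v | tau v.2 <= h /\ thr v.2 <= Z v.1].

Let measurable_S : measurable_fun setT (fun v : past Y s * plane R => S v.1 v.2).
Proof.
have mg : measurable_fun setT (fun v : plane R * plane R => ln (dst v.1 v.2)); last first.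
  exact: (measurable_past_sum mg).
by apply: measurableT_comp; [exact: measurable_ln|exact: measurable_dst].
Qed.

Let measurable_Z : measurable_fun setT (fun v : past Y s * plane R => Z v.1).
Proof.
have mg : measurable_fun setT (fun v : plane R * plane R => ln (dst (1, 0) v.2)); last first.
  exact: (measurable_past_sum mg).
by apply: measurableT_comp; [exact: measurable_ln|exact: measurable_dst].
Qed.

Let measurable_E : measurable E.
Proof. exact: measurable_ler_set. Qed.

Let measurable_Ez : measurable Ez.
Proof.
apply: measurableI; apply: measurable_ler_set => //.
  exact: (measurableT_comp measurable_tau).
apply: measurable_funD => //; apply: measurable_funD => //; apply: measurable_funM => //.
exact: (measurableT_comp measurable_tau).
Qed.

Let h0 : 0 < h. Proof. exact: divr_gt0. Qed.

Let c : R := 64 * h / eps ^+ 2.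

Let c0 : 0 <= c. Proof. by rewrite divr_ge0 ?sqr_ge0// mulr_ge0// ltW. Qed.

(** On the circle, the sum reaches [thr x] with the same probability for [Z].
    Moving it from the radial projection to [x] shifts it by [- N * tau x], up
    to [eps * r] except with probability at most [c], by Chebyshev's
    inequality. *)
Let slice_le x : 0 < sqn x < 1 ->
  (P [set w | Ez (w, x)] <= P [set w | E (w, x)] + (c * \1_[set x : plane R | (tau x <= h)%R] x)%:E)%E.
Proof.
move=> /andP[x0 x1]; have [tx|tx] := leP (tau x) h; last first.
  rewrite (_ : [set w | Ez (w, x)] = set0) ?measure0.
    by rewrite adde_ge0// lee_fin mulr_ge0.
  by apply/seteqP; split => // w [/=]; rewrite leNgt tx.
have -> : \1_[set x : plane R | (tau x <= h)%R] x = 1 :> R by rewrite indicE mem_set.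
rewrite mulr1.
have n0 : 0 < nrm x by rewrite /nrm sqrtr_gt0.
have n1 : nrm x < 1 by exact: nrm_lt1.
have u1 := sqn_unit_dir x0.
have u1' : sqn (unit_dir x) <= 1 by rewrite u1.
have u0 : 0 < sqn (unit_dir x) by rewrite u1.
pose F1 p := ln (dst x p); pose F2 p := ln (dst (unit_dir x) p).
have x1' := ltW x1.
have s1 : square_integrable mu F1 by exact: square_integrable_ln_dst.
have s2 : square_integrable mu F2 by exact: square_integrable_ln_dst.
pose f p := F1 p + -1 * F2 p.
have sf : square_integrable mu f.
  by apply: square_integrableD => //; exact: square_integrableZ.
have dx : dst x (unit_dir x) = 1 - nrm x.
  have -> : dst x (unit_dir x) = dst (scale 1 x) (unit_dir x).
    by case: (x) => a b; rewrite /scale/= !mul1r.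
  rewrite /unit_dir dst_scale ler0_norm; last by rewrite subr_le0 invf_ge1// ltW.
  by rewrite opprB mulrBl mul1r mulVf// gt_eqF.
have dtau : 1 - nrm x <= 2 * h.
  apply: le_trans (_ : _ <= 2 * tau x) _; last by rewrite ler_pM2l.
  rewrite /tau -sqr_nrm; have := ltW n0; move: n1; nra.
have fv : \int[mu]_p (f p ^+ 2) <= 64 * h.
  rewrite -lee_fin -EFin_Rintegral_sqr//.
  have := disc_law_ln_dst_sqr mu_disc x (unit_dir x) (lexx 0).
  rewrite addr0 dx => H.
  apply: (@le_trans _ _ (32 * (1 - nrm x))%:E); last by rewrite lee_fin; lra.
  apply: le_trans H; rewrite le_eqVlt; apply/predU1P; left.
  by apply: eq_integral => p _; rewrite /f /F1 /F2 mulN1r addr0.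
have fm : \int[mu]_p f p = - tau x.
  have I1 := square_integrable_int s1; have I2 := square_integrable_int s2.
  rewrite /f RintegralD//; last exact: integrableZ_EFin.
  rewrite RintegralZl// (Rintegral_ln_dst mu_disc u0 u1') u1 subrr mul0r oppr0 mulr0 addr0.
  exact: Rintegral_ln_dst.
have er : 0 < eps * r by rewrite mulr_gt0.
have H := chebyshev_centred mY Y_law Y_indep us sf fv er.
set D := [set w | _] in H.
have cE : (size s)%:R * (64 * h) / (eps * r) ^+ 2 = c.
  by rewrite -/N exprMn r2 /c; field; rewrite !gt_eqF.
rewrite cE in H.
have mD : measurable D.
  apply: measurable_ler_set => //; apply: measurableT_comp => //.
  apply: (measurable_iid_sum mY (g := fun p => f p - \int[mu]_p f p)).
  by apply: measurable_funB => //; have [] := sf.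
have mEx := measurable_past_slice mY x measurable_E.
apply: le_trans (leeD2l _ H).
have mtop : measurable [set w | (thr x <= S w (unit_dir x))%R].
  apply: measurable_ler_set => //.
  by apply: (measurable_iid_sum mY (g := F2)); have [] := s2.
apply: (@le_trans _ _ (P [set w | (thr x <= S w (unit_dir x))%R])).
  rewrite (unit_sum_ge_law mu_disc mY Y_law Y_indep us (thr x) u1).
  apply: le_measure; rewrite ?inE.
  - exact: (measurable_past_slice mY x measurable_Ez).
  - by apply: measurable_ler_set => //; exact: (measurable_unit_sum mu_disc mY s).
  - by move=> w [].
apply: le_trans (measureU2 _ mEx mD).
apply: le_measure; rewrite ?inE//; first exact: measurableU.
move=> w /= top; have [ED|ED] := leP (eps * r) `|\sum_(j <- s) (f (Y j w) - \int[mu]_p f p)|.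
  by right.
left; rewrite /E/=.
have SE : \sum_(j <- s) (f (Y j w) - \int[mu]_p f p) = S w x - S w (unit_dir x) + N * tau x.
  rewrite sumrB big_const_seq count_predT iter_addr_0 fm mulNrn opprK mulr_natl -sumrB.
  by congr (_ + _); apply: eq_bigr => j _; rewrite /f mulN1r.
move: ED; rewrite SE ltr_norml => /andP[ED _].
move: top ED; rewrite /thr; lra.
Qed.

Let K (e : R) := 3 / e ^+ 2 * (162 + sigma ^+ 3).

(** Given [Z], with [V] its excess over [L + eps * r], the probability is
    [2 min (h, V / N)]. By [2 min (h, v) >= 2 v - v ^ 2 / (2 h)] the
    restriction to small depths costs a multiple of the second moment of [Z]. *)
Let prob_Ez (e : R) : 0 < e ->
  (((sigma * iter (size s) (coin 1) (fun x => `|x|) 0 - N * K e - e - 2 * L - 2 * eps * r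
     - sigma ^+ 2 * r / (2 * M)) / N)%:E <= P [set w | Ez (w, Y k w)])%E.
Proof.
move=> e0; rewrite (prob_indep1 mY Y_law Y_indep ks measurable_Ez).
set a := sigma * _.
pose q := e + 2 * L + 2 * (eps * r).
have q0 : 0 <= q by rewrite !addr_ge0 ?mulr_ge0// ?mulr_ge0// ltW.
have er0 : 0 <= eps * r by rewrite mulr_ge0// ltW.
have mZ : measurable_fun setT (fun w : T => Z w) by exact: (measurable_unit_sum mu_disc mY s).
pose cz := r / (2 * M * N ^+ 2).
have cz0 : 0 <= cz by rewrite divr_ge0 ?mulr_ge0 ?sqr_ge0// ltW.
have slice w : (((smooth_pos e (Z w)) / N)%:E <=
    mu [set u | Ez (w, u)] + (cz * Z w ^+ 2 + q / N)%:E)%E.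
  pose V := Num.max (Z w - L - eps * r) 0.
  have V0 : 0 <= V by rewrite le_max lexx orbT.
  have VZ : V ^+ 2 <= Z w ^+ 2.
    rewrite -[leRHS]real_normK ?num_real// lerXn2r ?nnegrE// /V.
    rewrite ge_max normr_ge0 andbT; apply: le_trans (ler_norm _).
    by rewrite -addrA gerDl -opprD oppr_le0 addr_ge0.
  have sV : smooth_pos e (Z w) <= 2 * V + q.
    have V1 : Z w - L - eps * r <= V by rewrite le_max lexx.
    have := smooth_pos_le (Z w) (ltW e0); rewrite /q.
    move: (eps * r : R) (V : R) er0 V0 V1 (smooth_pos e (Z w) : R) => t v t0 v0 + A.
    have [H2|H2] := leP 0 (Z w); rewrite ?(ger0_norm H2) ?(ltr0_norm H2);
      move: (Z w : R) H2 => z H2 v1 H3; move: L0 e0; lra.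
  pose m := Num.min h (V / N).
  have m0 : 0 <= m by rewrite le_min ltW//= divr_ge0// ltW.
  have m12 : 0 <= m <= 1 / 2 by rewrite m0/= (le_trans _ Mr)// ge_min lexx.
  have mu_m : (2 * m)%:E = mu [set u | (tau u <= m)%R] by rewrite disc_law_tau_le.
  have key : 2 * V / N <= 2 * m + cz * Z w ^+ 2.
    have : 2 * V / N <= 2 * m + cz * V ^+ 2.
      have -> : cz * V ^+ 2 = (V / N) ^+ 2 / (2 * h).
        by rewrite /cz /h; field; rewrite !gt_eqF.
      rewrite -mulrA /m; case: (leP h (V / N)) => _; last first.
        by rewrite lerDl divr_ge0 ?sqr_ge0// mulr_ge0// ltW.
      move: (V / N : R) => v; rewrite -subr_ge0.
      have -> : 2 * h + v ^+ 2 / (2 * h) - 2 * v = (v - 2 * h) ^+ 2 / (2 * h).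
        by field; rewrite gt_eqF.
      by rewrite divr_ge0 ?sqr_ge0// mulr_ge0// ltW.
    move/le_trans; apply; rewrite lerD2l ler_wpM2l//.
  have sN : smooth_pos e (Z w) / N <= 2 * V / N + q / N.
    by rewrite -mulrDl ler_pM2r ?invr_gt0.
  have [V00|Vpos] := eqVneq V 0.
    apply: (@le_trans _ _ (0 + (cz * Z w ^+ 2 + q / N)%:E)%E); last by rewrite leeD2r.
    rewrite add0e lee_fin (le_trans sN)// V00 mulr0 mul0r add0r lerDr.
    by rewrite mulr_ge0// sqr_ge0.
  apply: (@le_trans _ _ (mu [set u | (tau u <= m)%R] + (cz * Z w ^+ 2 + q / N)%:E)%E).
    by rewrite -mu_m -EFinD lee_fin; move: sN key; lra.
  rewrite leeD2r//; apply: le_measure; rewrite ?inE.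
  - by apply: measurable_ler_set => //; exact: measurable_tau.
  - by have := measurable_xsection (w : past Y s) measurable_Ez; rewrite xsectionE.
  move=> u /=; rewrite le_min => /andP[uh uV]; split => //; rewrite /thr/=.
  have VE : V = Z w - L - eps * r.
    by move: Vpos; rewrite /V; case: (leP (Z w - L - eps * r) 0); rewrite ?eqxx.
  by move: uV; rewrite ler_pdivlMr// VE mulrC -!addrA -opprD lerBrDr.
have msp : measurable_fun setT (fun w : T => smooth_pos e (Z w)).
  exact: (measurableT_comp (measurable_smooth_pos e) mZ).
have mslice := measurable_prob_slice1 mu mY measurable_Ez.
have mZ2 : measurable_fun setT (fun w : T => Z w ^+ 2) by exact: measurable_funX.
have IZ2 : (\int[P]_w (Z w ^+ 2)%:E = (N * sigma ^+ 2)%:E)%E.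
  exact: (integral_sqr_unit_sum mu_disc mY Y_law Y_indep us).
have [Hlow _] := integral_smooth_pos_unit_sum mu_disc mY Y_law Y_indep e0 us.
have sp0 w : 0 <= smooth_pos e (Z w) by exact: smooth_pos_ge0.
have I1 : (\int[P]_w ((smooth_pos e (Z w)) / N)%:E <=
    \int[P]_w mu [set u | Ez (w, u)] + (cz * (N * sigma ^+ 2) + q / N)%:E)%E.
  apply: (@le_trans _ _ (\int[P]_w (mu [set u | Ez (w, u)] + (cz * Z w ^+ 2 + q / N)%:E))%E).
    apply: ge0_le_integral => //.
    - by move=> w _; rewrite lee_fin divr_ge0// ltW.
    - by apply/measurable_EFinP; exact: measurable_funM.
    - apply: emeasurable_funD => //; apply/measurable_EFinP.
      by apply: measurable_funD => //; exact: measurable_funM.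
  have cq0 w : 0 <= cz * Z w ^+ 2 + q / N.
    by apply: addr_ge0; [rewrite mulr_ge0// sqr_ge0|rewrite divr_ge0// ltW].
  rewrite ge0_integralD//; last 2 first.
  - by move=> w _; rewrite lee_fin.
  - by apply/measurable_EFinP; apply: measurable_funD => //; exact: measurable_funM.
  rewrite leeD2l// (_ : (fun w => (cz * Z w ^+ 2 + q / N)%:E) = fun w => ((cz%:E * (Z w ^+ 2)%:E) + (q / N)%:E)%E)//.
  rewrite ge0_integralD//; last 3 first.
  - by move=> w _; rewrite lee_fin mulr_ge0// sqr_ge0.
  - by apply/measurable_EFinP; exact: measurable_funM.
  - by move=> w _; rewrite lee_fin divr_ge0// ltW.
  rewrite integral_cst_prob ge0_integralZl_EFin//; last 2 first.
  - by move=> w _; rewrite lee_fin sqr_ge0.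
  - exact/measurable_EFinP.
  by rewrite IZ2.
have I2 : (((a - N * K e) / N)%:E <= \int[P]_w ((smooth_pos e (Z w)) / N)%:E)%E.
  rewrite (_ : (fun w => _) = fun w => (N^-1%:E * (smooth_pos e (Z w))%:E)%E); last first.
    by apply/funext => w; rewrite -EFinM mulrC.
  rewrite ge0_integralZl_EFin//; last 3 first.
  - by move=> w _; rewrite lee_fin.
  - exact/measurable_EFinP.
  - by rewrite invr_ge0 ltW.
  rewrite mulrC EFinM lee_pmul2l ?lte_fin ?invr_gt0//.
  by rewrite EFinB leeBlDr.
have := le_trans I2 I1; rewrite -leeBlDr// -EFinB.
apply: le_trans; rewrite lee_fin.
have -> : cz * (N * sigma ^+ 2) = sigma ^+ 2 * r / (2 * M) / N.
  by rewrite /cz; field; rewrite !gt_eqF.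
by rewrite le_eqVlt; apply/predU1P; left; rewrite /q; ring.
Qed.

Let prob_near (rho : R) j : 0 <= rho -> j != k ->
  (P [set w | (dst (Y j w) (Y k w) < rho)%R] <= (rho ^+ 2)%:E)%E.
Proof.
move=> rho0 jk.
pose F : set (past Y [:: j] * plane R) := [set v | dst (Y j v.1) v.2 < rho].
have mF : measurable F.
  apply: measurable_ltr_set => //; apply: measurable_dst => //.
  apply: (measurableT_comp (f := (Y j : past Y [:: j] -> plane R))) => //.
  by apply: measurable_past_coord; rewrite inE.
have kj : k \notin [:: j] by rewrite inE eq_sym.
rewrite -[X in P X]/([set w | F (w, Y k w)]) (prob_indep1 mY Y_law Y_indep kj mF).
apply: (@le_trans _ _ (\int[P]__ (rho ^+ 2)%:E)%E); last by rewrite integral_cst_prob.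
apply: ge0_le_integral => //.
- exact: (measurable_prob_slice1 mu mY mF).
- by move=> w _; exact: (disc_law_ball mu_disc (Y j w) rho0).
Qed.

(** [G] is obtained from [prob_Ez] and [slice_le] by removing the events, each
    of probability at most [rho ^ 2], that another point is within [rho] of the
    [k]-th one. *)
Lemma lower_event (e rho : R) : 0 < e -> 0 <= rho ->
  exists G : set T, [/\ measurable G,
    (((sigma * iter (size s) (coin 1) (fun x => `|x|) 0 - N * K e - e - 2 * L - 2 * eps * r
     - sigma ^+ 2 * r / (2 * M)) / N - 128 * (M / r) ^+ 2 / eps ^+ 2 - N * rho ^+ 2)%:E <= P G)%E &
    forall w, G w -> L <= \sum_(j <- s) ln (dst (Y k w) (Y j w)) /\
      forall j, j \in s -> rho <= dst (Y j w) (Y k w)].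
Proof.
move=> e0 rho0.
pose E0 := [set w | E (w, Y k w)].
pose C j := if j \in s then [set w | dst (Y j w) (Y k w) < rho] else set0.
have mE0 : measurable E0 by exact: (measurable_past_event mY k measurable_E).
have mC j : measurable (C j).
  rewrite /C; case: ifP => // _; apply: measurable_ltr_set => //; exact: measurable_dst.
pose D := \big[setU/set0]_(j <- s) C j.
have mD : measurable D by exact: bigsetU_measurable.
have PD : (P D <= (N * rho ^+ 2)%:E)%E.
  rewrite /D /N; elim: (s) => [|j t IH]; first by rewrite big_nil measure0 mul0r.
  rewrite big_cons; apply: le_trans (measureU2 _ _ _) _ => //; first exact: bigsetU_measurable.
  rewrite /= -natr1 mulrDl mul1r addrC EFinD; apply: leeD => //.
  rewrite /C; case: ifP => js; last by rewrite measure0 lee_fin sqr_ge0.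
  by apply: prob_near => //; apply: contraNneq ks => <-.
exists (E0 `\` D); split; first exact: measurableD.
  have := prob_Ez e0; set x := (_ / N) => Hx.
  have PE0 : (P [set w | Ez (w, Y k w)] <= P E0 + (128 * (M / r) ^+ 2 / eps ^+ 2)%:E)%E.
    rewrite (prob_indep2 mY Y_law Y_indep ks measurable_Ez).
    rewrite (prob_indep2 mY Y_law Y_indep ks measurable_E).
    set A := [set x : plane R | (tau x <= h)%R].
    have mA : measurable A by apply: measurable_ler_set => //; exact: measurable_tau.
    have mcA : measurable_fun setT (fun x : plane R => c * \1_A x).
      by apply: measurable_funM => //; exact: measurable_indic.
    apply: (@le_trans _ _ (\int[mu]_x (P [set w | E (w, x)] + (c * \1_A x)%:E))%E).
      apply: ae_ge0_le_integral => //.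
      - exact: (measurable_prob_slice2 P mY measurable_Ez).
      - by move=> x' _; rewrite adde_ge0// lee_fin mulr_ge0.
      - apply: emeasurable_funD; last exact/measurable_EFinP.
        exact: (measurable_prob_slice2 P mY measurable_E).
      have H0 : {ae mu, forall p : plane R, 0 < sqn p}.
        apply: filterS (disc_law_dst_gt0 mu_disc (0, 0)) => p; rewrite dst0p.
        by rewrite /nrm sqrtr_gt0.
      apply: filterS2 H0 (disc_law_ae mu_disc) => p p0 p1 _.
      by apply: slice_le; rewrite p0.
    rewrite ge0_integralD//; last 3 first.
    - exact: (measurable_prob_slice2 P mY measurable_E).
    - by move=> x' _; rewrite lee_fin mulr_ge0.
    - exact/measurable_EFinP.
    rewrite leeD2l//.
    rewrite (_ : (fun x => (c * \1_A x)%:E) = fun x => (c%:E * (\1_A x)%:E)%E)//.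
    rewrite ge0_integralZl_EFin//; last exact/measurable_EFinP/measurable_indic.
    rewrite -(prob_indic mu mA) disc_law_tau_le//; last by rewrite (ltW h0).
    rewrite -EFinM lee_fin le_eqVlt; apply/predU1P; left.
    by rewrite /c -/h; ring.
  have H : (P E0 <= P (E0 `\` D) + (N * rho ^+ 2)%:E)%E.
    apply: le_trans (leeD2l _ PD).
    apply: le_trans (measureU2 _ _ _) => //; last exact: measurableD.
    apply: le_measure; rewrite ?inE//; first by apply: measurableU => //; exact: measurableD.
    by move=> w Ew; have [Dw|nDw] := pselect (D w); [right|left].
  rewrite -addrA -opprD EFinB leeBlDr//.
  by rewrite (addrC _ (N * rho ^+ 2)) EFinD addeA; apply: le_trans Hx (le_trans PE0 (leeD2r _ H)).
move=> w [Ew nD]; split; first exact: Ew.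
move=> j js; rewrite leNgt; apply/negP => near; apply: nD.
rewrite /D -bigcup_seq; exists j => //; rewrite /C.
by rewrite (_ : j \in s).
Qed.

End lower_events.

Section isolation.
Context {R : realType}.
Local Open Scope ring_scope.

Lemma bernoulli_ge (a : R) n : 0 <= a <= 1 -> 1 - n%:R * a <= (1 - a) ^+ n.
Proof.
move=> /andP[a0 a1]; elim: n => [|n IH]; first by rewrite mul0r subr0.
rewrite exprS -natr1.
have := ler_wpM2l (_ : 0 <= 1 - a) IH; rewrite subr_ge0 => /(_ a1).
have : 0 <= n%:R * a * a by rewrite !mulr_ge0.
move: (n%:R : R) ((1 - a) ^+ n) => N q; nra.
Qed.

(** Around [x] on the circle of radius [1 / (2 n ^ 2)], each other distance
    decreases at most by the factor [1 - 1 / (2 n)], and their product by at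
    most a factor two. What remains of [4 n ^ 2] makes up for the radius. *)
Lemma isolating_circle (x : plane R) (y : nat -> plane R) (s : seq nat) :
  let n : R := (size s).+1%:R in
  ln (4 * n ^+ 2) <= \sum_(j <- s) ln (dst x (y j)) ->
  (forall j, j \in s -> n^-1 <= dst (y j) x) ->
  forall z, dst z x = (2 * n ^+ 2)^-1 -> 1 <= dst z x * \prod_(j <- s) dst z (y j).
Proof.
move=> n Hln Hd z zx.
have n0 : 0 < n by rewrite ltr0n.
have n1 : 1 <= n by rewrite ler1n.
pose a := (2 * n)^-1.
have a0 : 0 < a by rewrite invr_gt0 mulr_gt0.
have a1 : a <= 1 by rewrite invf_le1 ?mulr_gt0//; lra.
have rE : dst z x = n^-1 * a by rewrite zx /a; field; rewrite gt_eqF.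
have far j : j \in s -> 0 < dst x (y j) /\ dst x (y j) * (1 - a) <= dst z (y j).
  move=> /Hd; rewrite dstC => dj.
  have d0 : 0 < dst x (y j) by apply: lt_le_trans dj; rewrite invr_gt0.
  split => //.
  have := dst_triangle z x (y j); rewrite (dstC x z) rE.
  have := ler_wpM2r (ltW a0) dj.
  by rewrite mulrBr mulr1; move: (n^-1 * a) (dst x (y j) * a) => u v; lra.
have prod_far : (\prod_(j <- s) dst x (y j)) * (1 - a) ^+ size s <= \prod_(j <- s) dst z (y j).
  have: {subset s <= s} by [].
  elim: {1 3 4 5}(s) => [|j t IH] ts; first by rewrite !big_nil mul1r.
  have [d0 dj] := far j (ts j (mem_head _ _)).
  have {}IH : (\prod_(j <- t) dst x (y j)) * (1 - a) ^+ size t <= \prod_(j <- t) dst z (y j).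
    by apply: IH => i it; apply: ts; rewrite inE it orbT.
  rewrite !big_cons /= exprS mulrACA ler_pM// ?mulr_ge0 ?exprn_ge0 ?subr_ge0 ?dst_ge0//.
  by apply: prodr_ge0 => i _; exact: dst_ge0.
have prod_x : 4 * n ^+ 2 <= \prod_(j <- s) dst x (y j).
  have p0 : 0 < \prod_(j <- s) dst x (y j).
    rewrite big_seq; apply: prodr_gt0 => j js; by have [] := far j js.
  rewrite -ler_ln ?posrE ?mulr_gt0 ?exprn_gt0//; apply: le_trans Hln _.
  rewrite le_eqVlt; apply/predU1P; left.
  have: {subset s <= s} by [].
  elim: {1 3 4}(s) => [|j t IH] ts; first by rewrite !big_nil ln1.
  have ts' : {subset t <= s} by move=> i it; apply: ts; rewrite inE it orbT.
  rewrite !big_cons IH// lnM ?posrE//; first by have [] := far j (ts j (mem_head _ _)).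
  rewrite big_seq; apply: prodr_gt0 => i it; by have [] := far i (ts' i it).
have half : 1 / 2 <= (1 - a) ^+ size s.
  have a01 : 0 <= a <= 1 by rewrite ltW.
  apply: le_trans (bernoulli_ge (size s) a01).
  have : (size s)%:R * a <= 1 / 2.
    rewrite /a ler_pdivrMr ?mulr_gt0// mulrA divfK// mul1r.
    by rewrite ler_nat.
  lra.
apply: le_trans (_ : dst z x * (4 * n ^+ 2 * (1 / 2)) <= _).
  by rewrite zx; rewrite le_eqVlt; apply/predU1P; left; field; rewrite gt_eqF.
rewrite ler_wpM2l ?dst_ge0//; apply: le_trans prod_far.
by rewrite ler_pM// mulr_ge0// sqr_ge0.
Qed.

End isolation.

(** * The expected number of components *)

Section plane_of_complex.
Context {R : realType}.
Local Open Scope complex_scope.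
Local Open Scope ring_scope.
Local Notation C := (Cplx R).
Local Notation normc := (@Normc.normc R).

Definition pt (z : C) : plane R := (complex.Re z, complex.Im z).

Lemma normc_dst (z w : C) : normc (z - w) = dst (pt z) (pt w).
Proof. by case: z w => a b [a' b']. Qed.

Lemma pt_scale (t : R) (z : C) : pt (t%:C * z) = scale t (pt z).
Proof. by case: z => a b; rewrite /pt /scale/= !mul0r subr0 addr0. Qed.

Definition others n k := [seq j <- iota 0 n | j != k].

Lemma others_uniq n k : uniq (others n k).
Proof. by rewrite filter_uniq// iota_uniq. Qed.

Lemma others_notin n k : k \notin others n k.
Proof. by rewrite mem_filter eqxx. Qed.


Lemma size_others m k : (k < m.+1)%N -> size (others m.+1 k) = m.
Proof.
move=> km; have := count_predC (pred1 k) (iota 0 m.+1).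
rewrite count_uniq_mem ?iota_uniq// mem_iota km size_iota /= => -[] H.
by rewrite size_filter -[RHS]H.
Qed.

Lemma prod_others n k (F : nat -> R) : (k < n)%N ->
  \prod_(j < n) F j = F k * \prod_(j <- others n k) F j.
Proof.
move=> kn; rewrite -(big_mkord xpredT F) (bigD1_seq k)//= ?iota_uniq ?mem_index_iota//.
by rewrite /others big_filter /index_iota subn0.
Qed.

Variables (x : nat -> C) (n : nat).
Let y j := pt (x j).

Lemma num_components_le_plane (b : nat -> bool) :
  (forall k, (k < n)%N -> ~~ b k -> forall t : R, 0 <= t <= 1 ->
    dst (scale t (y k)) (y k) * \prod_(j <- others n k) dst (scale t (y k)) (y j) < 1) ->
  (num_components R (lemniscate (root_poly x n)) <= (1 + \sum_(k < n) (b k)%:R)%:E)%E.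
Proof.
move=> H; apply: num_components_le => k kn nb t t01.
under eq_bigr do rewrite normc_dst pt_scale.
by rewrite (prod_others (fun j => dst (scale t (pt (x k))) (pt (x j))) kn); exact: H.
Qed.

Lemma num_components_ge_plane (g : nat -> bool) :
  (forall k, (k < n)%N -> g k ->
    ln (4 * n%:R ^+ 2) <= \sum_(j <- others n k) ln (dst (y k) (y j)) /\
    forall j, j \in others n k -> n%:R^-1 <= dst (y j) (y k)) ->
  ((\sum_(k < n) (g k)%:R)%:E <= num_components R (lemniscate (root_poly x n)))%E.
Proof.
move=> H; apply: num_components_ge => k kn gk.
have n0 : 0 < n%:R :> R by rewrite ltr0n (leq_ltn_trans _ kn).
have n1 : 1 <= n%:R :> R by rewrite ler1n (leq_ltn_trans _ kn).
have [Hl Hd] := H k kn gk.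
exists (2 * n%:R ^+ 2)^-1; first by rewrite invr_gt0 mulr_gt0// exprn_gt0.
split => [z|j jn jk].
  rewrite normc_dst => zr; under eq_bigr do rewrite normc_dst.
  rewrite (prod_others (fun j => dst (pt z) (pt (x j))) kn).
  have nE : n = (size (others n k)).+1.
    by case: n kn => // m km; rewrite size_others.
  by apply: isolating_circle; rewrite -nE.
rewrite normc_dst; apply: lt_le_trans (Hd j _); last first.
  by rewrite mem_filter jk mem_iota.
rewrite ltf_pV2 ?posrE ?mulr_gt0 ?exprn_gt0//.
rewrite expr2 mulrA ltr_pMl//; lra.
Qed.

End plane_of_complex.

Section monotone_integral.
Context {R : realType} d (T : measurableType d) (P : probability T R).

(** The integral of a nonnegative function is a supremum over the simple
    functions below it, hence monotone on all functions, measurable or not; the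
    number of components is handled in this way. *)
Lemma le_integral_ge0 (f g : T -> \bar R) : (forall w, 0 <= f w) ->
  (forall w, f w <= g w) -> \int[P]_w f w <= \int[P]_w g w.
Proof.
move=> f0 fg; have g0 w : 0 <= g w by exact: le_trans (fg w).
rewrite !ge0_integralTE//; apply: le_ereal_sup => _ [h hf <-].
by exists h => // w; exact: le_trans (fg w).
Qed.

Lemma integral_sum_indic n (B : nat -> set T) : (forall k, measurable (B k)) ->
  \int[P]_w (\sum_(k < n) (\1_(B k) w))%R%:E = \sum_(k < n) P (B k).
Proof.
move=> mB; under eq_integral do rewrite -sumEFin.
rewrite ge0_integral_sum//.
- by apply: eq_bigr => k _; rewrite -prob_indic.
- by move=> k; apply/measurable_EFinP; exact: measurable_indic.
Qed.

End monotone_integral.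

Section expected_components.
Context {R : realType} d (T : measurableType d) (P : probability T R).
Context (mu : probability (plane R) R).
Hypothesis mu_disc : disc_law mu.
Variable X : nat -> T -> Cplx R.
Let Y k w := pt (X k w).
Hypothesis mY : forall k, measurable_fun setT (Y k).
Hypothesis Y_law : forall k A, measurable A -> P (Y k @^-1` A) = mu A.
Hypothesis Y_indep : forall (J : {fset nat}) (A : nat -> set (plane R)),
  (forall k, k \in J -> measurable (A k)) ->
  P (\bigcap_(k in [set` J]) (Y k @^-1` A k)) =
  \big[*%E/1]_(k <- J) P (Y k @^-1` A k).
Local Open Scope ring_scope.

Let sigma : R := Num.sqrt ((zeta (2 : R) - 1) / 2).
Let walk (m : nat) : R := iter m (coin 1) (fun x => `|x|) 0.
Let comp n w : \bar R := num_components R (lemniscate (root_poly (fun k => X k w) n)).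
Let third : R := 162 + sigma ^+ 3.

Let comp_ge0 n w : (0 <= comp n w)%E.
Proof.
have := @num_components_ge_plane R (fun k => X k w) n (fun=> false).
by rewrite big1// => H; apply: H.
Qed.

Let third_ge0 : 0 <= third. Proof. by rewrite addr_ge0// exprn_ge0// sqrtr_ge0. Qed.

(** [beta] is such that the steps of the net of unit [b = beta / r] satisfy the
    hypothesis of [upper_event]; its points before depth one have index at most
    [sqrt (r / beta)]. *)
Lemma expected_components_le (eps : R) (m : nat) :
  let r : R := Num.sqrt m%:R in
  let beta := eps / (5 + 100 / eps) in
  0 < eps -> eps < 1 -> (0 < m)%N ->
  (\int[P]_w comp m.+1 w <=
   (1 + m.+1%:R * ((sigma * walk m + 3 * third / eps ^+ 2 + 5 * eps * r) / ((1 - eps) * m%:R) +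
     (1 + Num.sqrt (r / beta)) * (4096 / (eps ^+ 2 * m%:R))))%:E)%E.
Proof.
move=> r beta eps0 eps1 m0.
have M0 : 0 < m%:R :> R by rewrite ltr0n.
have r0 : 0 < r by rewrite sqrtr_gt0.
have r2 : r ^+ 2 = m%:R by rewrite sqr_sqrtr// ltW.
have den0 : 0 < 5 + 100 / eps by rewrite addr_gt0// divr_gt0.
have beta0 : 0 < beta by exact: divr_gt0.
pose b := beta / r.
have b0 : 0 < b by exact: divr_gt0.
have stepb i : 5 * step b i <= eps / 4 * depth b i + eps / r.
  rewrite /step /depth -(@ler_pM2r _ (r / beta)) ?divr_gt0//.
  have -> : 5 * (b * (2 * i%:R + 1)) * (r / beta) = 10 * i%:R + 5.
    by rewrite /b; field; rewrite !gt_eqF.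
  have -> : (eps / 4 * (b * i%:R ^+ 2) + eps / r) * (r / beta) =
      eps / 4 * i%:R ^+ 2 + (5 + 100 / eps).
    have <- : eps / beta = 5 + 100 / eps.
      by rewrite /beta invf_div mulrCA divff ?mulr1// gt_eqF.
    by rewrite /b; field; rewrite !gt_eqF.
  rewrite -subr_ge0.
  have -> : eps / 4 * i%:R ^+ 2 + (5 + 100 / eps) - (10 * i%:R + 5) =
      (eps / 2 * i%:R - 10) ^+ 2 / eps by field; rewrite gt_eqF.
  by rewrite divr_ge0 ?sqr_ge0// ltW.
have exM : exists j, 1 <= depth b j.
  have [j Hj] : exists j : nat, b^-1 <= j%:R.
    by exists (Num.bound b^-1); apply: ltW; apply: archi_boundP; rewrite invr_ge0 ltW.
  exists j.+1; rewrite /depth.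
  have : b^-1 <= j.+1%:R ^+ 2.
    apply: le_trans Hj _; rewrite -natrX ler_nat expnS expn1.
    by apply: leq_trans (leqnSn _) _; rewrite leq_pmulr.
  by move=> H; have := ler_wpM2l (ltW b0) H; rewrite mulfV// gt_eqF.
have [j Hj minj] := ex_minnP exM.
case: j Hj minj => [|M] HM minM; first by move: HM; rewrite /depth expr0n/= mulr0 ler10.
have M1 i : (i <= M)%N -> depth b i < 1.
  by move=> iM; rewrite ltNge; apply/negP => /minM; rewrite ltnNge iM.
have MM : M.+1%:R <= 1 + Num.sqrt (r / beta).
  rewrite -natr1 addrC lerD2l -[leLHS]ger0_norm// -sqrtr_sqr ler_sqrt; last first.
    by rewrite divr_ge0// ltW.
  have := M1 M (leqnn M); rewrite /depth => /ltW.
  by rewrite /b mulrAC ler_pdivrMr// mul1r ler_pdivlMr// mulrC.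
set e := eps * r; have e0 : 0 < e by exact: mulr_gt0.
pose p := (sigma * walk m + e + m%:R * (3 / e ^+ 2 * third) + 4 * eps * r) / ((1 - eps) * m%:R) +
     M.+1%:R * (4096 / (eps ^+ 2 * m%:R)).
have HB k : exists B : set T, (k < m.+1)%N -> [/\ measurable B, (P B <= p%:E)%E &
    forall w, ~ B w -> forall t, 0 <= t <= 1 ->
      dst (scale t (Y k w)) (Y k w) *
        \prod_(j <- others m.+1 k) dst (scale t (Y k w)) (Y j w) < 1].
  have [km|km] := boolP (k < m.+1)%N; last by exists set0.
  have sz := size_others km.
  have s0 : (0 < size (others m.+1 k))%N by rewrite sz.
  have stepb' i : 5 * step b i <= eps / 4 * depth b i + eps / Num.sqrt (size (others m.+1 k))%:R.
    by rewrite sz.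
  have [B [mB PB HB]] := upper_event mu_disc mY Y_law Y_indep (others_uniq m.+1 k)
    (others_notin m.+1 k) s0 eps0 eps1 b0 stepb' e0 HM M1.
  by exists B => _; split => //; apply: le_trans PB _; rewrite sz.
have [B HB'] := choice HB.
pose B' k := if (k < m.+1)%N then B k else set0.
have mB' k : measurable (B' k).
  by rewrite /B'; case: ifP => // km; have [] := HB' k km.
apply: (@le_trans _ _ (\int[P]_w (1%:E + (\sum_(k < m.+1) (\1_(B' k) w))%:E))%E).
  apply: le_integral_ge0 => // w.
  pose bb k := `[< B' k w >].
  apply: le_trans (num_components_le_plane (b := bb) _) _.
    move=> k km /asboolP nB; have [_ _] := HB' k km; apply.
    by move: nB; rewrite /B' km.
  rewrite -EFinD lee_fin lerD2l; apply: ler_sum => k _.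
  by rewrite indicE /bb /in_mem/= /mem/=.
rewrite ge0_integralD//; last 2 first.
- by move=> w _; rewrite lee_fin sumr_ge0.
- by apply/measurable_EFinP; apply: measurable_sum => k; exact: measurable_indic.
rewrite integral_cst_prob integral_sum_indic//.
rewrite EFinD leeD2l//.
apply: (@le_trans _ _ (\sum_(k < m.+1) p%:E)%E).
  apply: lee_sum => k _; have [_ Pk _] := HB' k (ltn_ord k).
  by rewrite /B' ltn_ord.
rewrite sumEFin lee_fin sumr_const card_ord -[leLHS]mulr_natl ler_wpM2l//.
rewrite /p; apply: lerD.
  rewrite le_eqVlt; apply/predU1P; left; congr (_ / _).
  have -> : m%:R * (3 / e ^+ 2 * third) = 3 * third / eps ^+ 2.
    by rewrite /e exprMn r2; field; rewrite !gt_eqF.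
  by rewrite /e; ring.
apply: ler_wpM2r MM; apply: divr_ge0; first exact: ler0n.
by apply: mulr_ge0; [exact: sqr_ge0|exact: ltW].
Qed.

(** [lower_event] with the constants required by [isolating_circle], retaining
    the depths up to [1 / (eps * r)]. *)
Lemma expected_components_ge (eps : R) (m : nat) : 0 < eps -> (0 < m)%N ->
  let r : R := Num.sqrt m%:R in
  let n : R := m.+1%:R in
  eps^-1 / r <= 1 / 2 ->
  ((n * ((sigma * walk m - 3 * third / eps ^+ 2 - 3 * eps * r - 2 * ln (4 * n ^+ 2) -
      sigma ^+ 2 * r * eps / 2) / m%:R - 128 / (eps ^+ 4 * m%:R) - m%:R / n ^+ 2))%:E <=
   \int[P]_w comp m.+1 w)%E.
Proof.
move=> eps0 m0 r n Mr.
have M0 : 0 < m%:R :> R by rewrite ltr0n.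
have r0 : 0 < r by rewrite sqrtr_gt0.
have r2 : r ^+ 2 = m%:R by rewrite sqr_sqrtr// ltW.
have n0 : 0 < n by rewrite ltr0n.
have n1 : 1 <= n by rewrite ler1n.
have L0 : 0 <= ln (4 * n ^+ 2).
  by apply: ln_ge0; have := exprn_ege1 2 n1; lra.
have ie0 : 0 < eps^-1 by rewrite invr_gt0.
set e := eps * r; have e0 : 0 < e by exact: mulr_gt0.
have in0 : 0 <= n^-1 by rewrite invr_ge0 ltW.
set p := (X in (n * X)%:E).
have HG k : exists G : set T, (k < m.+1)%N -> [/\ measurable G, (p%:E <= P G)%E &
    forall w, G w -> ln (4 * n ^+ 2) <= \sum_(j <- others m.+1 k) ln (dst (Y k w) (Y j w)) /\
      forall j, j \in others m.+1 k -> n^-1 <= dst (Y j w) (Y k w)].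
  have [km|km] := boolP (k < m.+1)%N; last by exists set0.
  have sz := size_others km.
  have s0 : (0 < size (others m.+1 k))%N by rewrite sz.
  have Mr' : eps^-1 / Num.sqrt (size (others m.+1 k))%:R <= 1 / 2 by rewrite sz.
  have [G [mG PG HG]] := lower_event mu_disc mY Y_law Y_indep (others_uniq m.+1 k)
    (others_notin m.+1 k) s0 eps0 L0 ie0 Mr' e0 in0.
  exists G => _; split => //; apply: le_trans PG; rewrite sz lee_fin le_eqVlt; apply/predU1P; left.
  rewrite -/(walk m) -/sigma -/third -/r /p.
  have -> : m%:R * (3 / e ^+ 2 * third) = 3 * third / eps ^+ 2.
    by rewrite /e exprMn r2; field; rewrite !gt_eqF.
  rewrite /e -r2; field; rewrite !gt_eqF//.
have [G HG'] := choice HG.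
pose G' k := if (k < m.+1)%N then G k else set0.
have mG' k : measurable (G' k).
  by rewrite /G'; case: ifP => // km; have [] := HG' k km.
apply: (@le_trans _ _ (\int[P]_w (\sum_(k < m.+1) (\1_(G' k) w))%:E)%E); last first.
  apply: le_integral_ge0 => // w; first by rewrite lee_fin sumr_ge0.
  pose gg k := `[< G' k w >].
  apply: le_trans (num_components_ge_plane (g := gg) _); last first.
    move=> k km /asboolP gG; have [_ _] := HG' k km; apply.
    by move: gG; rewrite /G' km.
  rewrite lee_fin; apply: ler_sum => k _.
  by rewrite indicE /gg /in_mem/= /mem/=.
rewrite integral_sum_indic//.
apply: (@le_trans _ _ (\sum_(k < m.+1) p%:E)%E).
  by rewrite sumEFin lee_fin sumr_const card_ord -[leRHS]mulr_natl.
apply: lee_sum => k _; have [_ Pk _] := HG' k (ltn_ord k).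
by rewrite /G' ltn_ord.
Qed.

End expected_components.

(** * Limits *)

Section limits.
Context {R : realType}.
Local Open Scope ring_scope.
Implicit Types (m : nat) (eps : R).

(** In terms of these, [sqrt m.+1] is [w m / v m]. *)
Let v m : R := (Num.sqrt m%:R)^-1.
Let w m : R := Num.sqrt (1 + v m ^+ 2).
Let walk m : R := iter m (coin 1) (fun x => `|x|) 0.

Let cvg_sqrt (u : nat -> R) (l : R) : u m @[m --> \oo] --> l ->
  Num.sqrt (u m) @[m --> \oo] --> Num.sqrt l.
Proof. by move=> ul; apply: (cvg_comp _ _ ul); exact: sqrt_continuous. Qed.

Let v_ge0 m : 0 <= v m. Proof. by rewrite invr_ge0 sqrtr_ge0. Qed.

Let v_cvg : v m @[m --> \oo] --> (0 : R).
Proof.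
apply/cvgrPdist_lt => e e0; near=> m; rewrite sub0r normrN ger0_norm//.
have m0 : (0 < m)%N by near: m; exists 1%N.
have M0 : 0 < m%:R :> R by rewrite ltr0n.
rewrite /v -[e]invrK ltf_pV2 ?posrE ?invr_gt0 ?sqrtr_gt0//.
rewrite -[ltLHS]gtr0_norm ?invr_gt0// -sqrtr_sqr ltr_sqrt//.
near: m; exact: nbhs_infty_gtr.
Unshelve. all: by end_near. Qed.

Let w_cvg : w m @[m --> \oo] --> (1 : R).
Proof.
rewrite -[X in _ --> X]sqrtr1; apply: cvg_sqrt.
rewrite -[X in _ --> X]addr0; apply: cvgD; first exact: cvg_cst.
rewrite (_ : (0 : R) = 0 ^+ 2); last by rewrite expr0n.
by under eq_fun do rewrite expr2; rewrite expr2; exact: cvgM.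
Qed.

Variable sigma : R.
Hypothesis sigma0 : 0 <= sigma.
Let third : R := 162 + sigma ^+ 3.
Let c : R := sigma * Num.sqrt (2 / pi).

(** [upper] and [lower] are the bounds on the expectation over [sqrt m.+1], for
    [m.+1] points, as functions of the normalised walk and of the sequences [v]
    and [w]. *)
Let upper eps m : R :=
  v m + w m * ((sigma * (walk m * v m) + 3 * third / eps ^+ 2 * v m + 5 * eps) / (1 - eps) +
    (v m + Num.sqrt (v m / (eps / (5 + 100 / eps)))) * (4096 / eps ^+ 2)).

Let lower eps m : R :=
  w m * (sigma * (walk m * v m) - 3 * third / eps ^+ 2 * v m - 3 * eps -
    16 * Num.sqrt (2 * v m) - sigma ^+ 2 * eps / 2) - w m * v m * (128 / eps ^+ 4) - v m.

Let upper_cvg eps : upper eps m @[m --> \oo] --> (c + 5 * eps) / (1 - eps).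
Proof.
have walk_cvg : sigma * (walk m * v m) @[m --> \oo] --> c.
  by apply: cvgM; [exact: cvg_cst|exact: iter_coin_normr_asymp].
have H : upper eps m @[m --> \oo] --> 0 + 1 * ((c + 3 * third / eps ^+ 2 * 0 + 5 * eps) / (1 - eps) +
    (0 + Num.sqrt (0 / (eps / (5 + 100 / eps)))) * (4096 / eps ^+ 2)).
  apply: cvgD v_cvg _; apply: cvgM w_cvg _; apply: cvgD.
    apply: cvgM; last exact: cvg_cst.
    apply: cvgD; last exact: cvg_cst.
    by apply: cvgD walk_cvg _; apply: cvgM; [exact: cvg_cst|exact: v_cvg].
  apply: cvgM; last exact: cvg_cst.
  apply: cvgD v_cvg _; apply: cvg_sqrt.
  by apply: cvgM v_cvg _; exact: cvg_cst.
by move: H; rewrite !(mul0r, mulr0, sqrtr0, add0r, addr0, mul1r).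
Qed.

Let lower_cvg eps : lower eps m @[m --> \oo] --> c - 3 * eps - sigma ^+ 2 * eps / 2.
Proof.
have walk_cvg : sigma * (walk m * v m) @[m --> \oo] --> c.
  by apply: cvgM; [exact: cvg_cst|exact: iter_coin_normr_asymp].
have H : lower eps m @[m --> \oo] -->
  1 * (c - 3 * third / eps ^+ 2 * 0 - 3 * eps -
    16 * Num.sqrt (2 * 0) - sigma ^+ 2 * eps / 2) - 1 * 0 * (128 / eps ^+ 4) - 0.
  apply: cvgB _ v_cvg; apply: cvgB.
    apply: cvgM w_cvg _; apply: cvgB; last exact: cvg_cst.
    apply: cvgB; last first.
      apply: cvgM; first exact: cvg_cst.
      by apply: cvg_sqrt; apply: cvgM v_cvg; exact: cvg_cst.
    apply: cvgB; last exact: cvg_cst.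
    by apply: cvgB walk_cvg _; apply: cvgM v_cvg; exact: cvg_cst.
  by apply: cvgM; [apply: cvgM w_cvg v_cvg|exact: cvg_cst].
by move: H; rewrite !mulr0 sqrtr0 !mulr0 !mul0r !subr0 mul1r.
Qed.

Section normalisation.
Variable m : nat.
Hypothesis m0 : (0 < m)%N.
Let r : R := Num.sqrt m%:R.
Let n : R := m.+1%:R.

Let M0 : 0 < m%:R :> R. Proof. by rewrite ltr0n. Qed.
Let r0 : 0 < r. Proof. by rewrite sqrtr_gt0. Qed.
Let r2 : r ^+ 2 = m%:R. Proof. by rewrite sqr_sqrtr// ltW. Qed.
Let n0 : 0 < n. Proof. by rewrite ltr0n. Qed.
Let sn0 : 0 < Num.sqrt n. Proof. by rewrite sqrtr_gt0. Qed.
Let sn2 : Num.sqrt n ^+ 2 = n. Proof. by rewrite sqr_sqrtr// ltW. Qed.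
Let nE : n = m%:R + 1. Proof. by rewrite natr1. Qed.

Let wE : Num.sqrt n = w m * r.
Proof.
rewrite /w /r -sqrtrM ?addr_ge0 ?sqr_ge0//; congr Num.sqrt.
by rewrite /v -/r exprVn r2 mulrDl mulVf ?gt_eqF// mul1r nE.
Qed.

Let vE : v m = r^-1. Proof. by []. Qed.

Let inv_sqrt_n : 1 / Num.sqrt n <= v m.
Proof.
rewrite vE mul1r lef_pV2 ?posrE// ler_sqrt//.
by rewrite nE lerDl.
Qed.

Lemma upper_normalised eps : 0 < eps -> eps < 1 ->
  (1 + n * ((sigma * walk m + 3 * third / eps ^+ 2 + 5 * eps * r) / ((1 - eps) * m%:R) +
     (1 + Num.sqrt (r / (eps / (5 + 100 / eps)))) * (4096 / (eps ^+ 2 * m%:R)))) / Num.sqrt n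
  <= upper eps m.
Proof.
move=> e0 e1; rewrite mulrDl; apply: lerD; first exact: inv_sqrt_n.
rewrite le_eqVlt; apply/predU1P; left.
set beta := eps / _.
have beta0 : 0 < beta by rewrite divr_gt0// addr_gt0// divr_gt0.
have -> : Num.sqrt (v m / beta) = Num.sqrt (r / beta) / r.
  have -> : v m / beta = (r / beta) * r^-1 ^+ 2 by rewrite vE; field; rewrite !gt_eqF.
  rewrite sqrtrM; last exact/ltW/divr_gt0.
  by rewrite sqrtr_sqr ger0_norm// invr_ge0 ltW.
rewrite -[X in X * (_ + _) / _]sn2 -r2 vE.
have -> : Num.sqrt n ^+ 2 = (w m * r) * Num.sqrt n by rewrite -wE expr2.
have e1' : 0 < 1 - eps by rewrite subr_gt0.
move: (Num.sqrt (r / beta) : R) (w m : R) (Num.sqrt n : R) sn0 (walk m : R) => q w' s s0 a.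
by field; rewrite !gt_eqF.
Qed.

Lemma lower_normalised eps : 0 < eps ->
  lower eps m <= n * ((sigma * walk m - 3 * third / eps ^+ 2 - 3 * eps * r - 2 * ln (4 * n ^+ 2) -
      sigma ^+ 2 * r * eps / 2) / m%:R - 128 / (eps ^+ 4 * m%:R) - m%:R / n ^+ 2) / Num.sqrt n.
Proof.
move=> e0; have w0 : 0 <= w m by exact: sqrtr_ge0.
(* [ln y <= y] at [y = sqrt (2 r)]: its eighth power is at least [4 n ^ 2], and
   it is negligible against [r]. *)
have Lle : 2 * ln (4 * n ^+ 2) * v m <= 16 * Num.sqrt (2 * v m).
  have n2 : n <= 2 * m%:R by rewrite nE mulrDl mul1r lerD2l ler1n.
  have x0 : 0 < Num.sqrt (2 * r) by rewrite sqrtr_gt0 mulr_gt0.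
  have x2 : Num.sqrt (2 * r) ^+ 2 = 2 * r by rewrite sqr_sqrtr// mulr_ge0// ltW.
  have H : 4 * n ^+ 2 <= Num.sqrt (2 * r) ^+ 8.
    rewrite (_ : 8 = 2 * 4)%N// exprM x2.
    have -> : (2 * r) ^+ 4 = 4 * (2 * m%:R) ^+ 2 by rewrite -r2; ring.
    by rewrite ler_pM2l// lerXn2r ?nnegrE ?mulr_ge0 ?(ltW n0).
  have H2 : ln (4 * n ^+ 2) <= 8 * Num.sqrt (2 * r).
    apply: (@le_trans _ _ (ln (Num.sqrt (2 * r) ^+ 8))).
      by rewrite ler_ln ?posrE ?mulr_gt0 ?exprn_gt0.
    by rewrite lnXn// -[leLHS]mulr_natl ler_pM2l//; apply/ltW/ln_sublinear.
  have -> : Num.sqrt (2 * v m) = Num.sqrt (2 * r) * v m.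
    have -> : 2 * v m = (2 * r) * v m ^+ 2 by rewrite vE; field; rewrite gt_eqF.
    by rewrite sqrtrM ?mulr_ge0 ?ltW// sqrtr_sqr ger0_norm.
  by rewrite mulrA ler_wpM2r//; lra.
have sm : m%:R / n ^+ 2 * Num.sqrt n <= v m.
  apply: le_trans inv_sqrt_n; rewrite mul1r.
  have <- : Num.sqrt n / n = (Num.sqrt n)^-1.
    by rewrite -[X in _ / X]sn2 expr2 invfM mulrA divff ?mul1r// gt_eqF.
  have -> : m%:R / n ^+ 2 * Num.sqrt n = (m%:R / n) * (Num.sqrt n / n).
    by field; rewrite gt_eqF.
  rewrite ler_piMl//; first exact/ltW/divr_gt0.
  by rewrite ler_pdivrMr// mul1r nE lerDl.
have -> : n * ((sigma * walk m - 3 * third / eps ^+ 2 - 3 * eps * r - 2 * ln (4 * n ^+ 2) -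
      sigma ^+ 2 * r * eps / 2) / m%:R - 128 / (eps ^+ 4 * m%:R) - m%:R / n ^+ 2) / Num.sqrt n =
    w m * (sigma * (walk m * v m) - 3 * third / eps ^+ 2 * v m - 3 * eps -
    2 * ln (4 * n ^+ 2) * v m - sigma ^+ 2 * eps / 2) - w m * v m * (128 / eps ^+ 4)
    - m%:R / n ^+ 2 * Num.sqrt n.
  have -> : w m = Num.sqrt n * v m by rewrite wE vE mulfK ?gt_eqF.
  rewrite -[X in X * (_ - _) / _]sn2.
  move: (m%:R / n ^+ 2 : R) (ln (4 * n ^+ 2) : R) (Num.sqrt n : R) sn0 (walk m : R) => q l s s0 a.
  by rewrite vE -r2; field; rewrite !gt_eqF.
rewrite /lower lerB// lerD2r ler_wpM2l// lerD2r lerB//.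
Qed.

End normalisation.

(** The limits of the two bounds in [m] both tend to [c] as [eps] tends to
    zero. *)
Lemma expected_components_limit (E : nat -> \bar R) :
  (forall eps m, 0 < eps -> eps < 1 -> (0 < m)%N -> (E m <= (upper eps m)%:E)%E) ->
  (forall eps m, 0 < eps -> (0 < m)%N -> eps^-1 * v m <= 1 / 2 -> ((lower eps m)%:E <= E m)%E) ->
  E m @[m --> \oo] --> c%:E.
Proof.
move=> HU HL.
have c0 : 0 <= c by rewrite mulr_ge0// sqrtr_ge0.
have main (dl : R) : 0 < dl -> \forall m \near \oo, ((c - dl)%:E <= E m <= (c + dl)%:E)%E.
  move=> dl0; pose eps := dl / (6 + c + dl + sigma ^+ 2).
  have s20 : 0 <= sigma ^+ 2 by exact: sqr_ge0.
  have den0 : 0 < 6 + c + dl + sigma ^+ 2 by lra.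
  have e0 : 0 < eps by exact: divr_gt0.
  have epsE : eps * (6 + c + dl + sigma ^+ 2) = dl by rewrite /eps divfK// gt_eqF.
  have e1 : eps < 1 by rewrite ltr_pdivrMr// mul1r; lra.
  have es : 0 <= eps * sigma ^+ 2 by rewrite mulr_ge0// ltW.
  have ec : 0 <= eps * c by rewrite mulr_ge0// ltW.
  have ed : 0 <= eps * dl by rewrite mulr_ge0// ltW.
  have epsE' : 6 * eps + eps * c + eps * dl + eps * sigma ^+ 2 = dl.
    by rewrite -[RHS]epsE; ring.
  have hU : (c + 5 * eps) / (1 - eps) < c + dl.
    rewrite ltr_pdivrMr ?subr_gt0//; move: (c : R) (sigma ^+ 2) epsE' es ec ed e0 => x y; lra.
  have hL : c - dl < c - 3 * eps - sigma ^+ 2 * eps / 2.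
    by move: (c : R) (sigma ^+ 2) epsE' es ec ed e0 => x y; lra.
  have nU : \forall m \near \oo, upper eps m <= c + dl.
    by move/cvgr_le: (@upper_cvg eps); apply.
  have nL : \forall m \near \oo, c - dl <= lower eps m.
    by move/cvgr_ge: (@lower_cvg eps); apply.
  have nv : \forall m \near \oo, eps^-1 * v m <= 1 / 2.
    have cv : eps^-1 * v m @[m --> \oo] --> eps^-1 * 0 by apply: cvgM v_cvg; exact: cvg_cst.
    by rewrite mulr0 in cv; move/cvgr_le: cv; apply; rewrite divr_gt0.
  near=> m; have m0 : (0 < m)%N by near: m; exists 1%N.
  apply/andP; split.
    apply: le_trans (HL eps m e0 m0 _); last by near: m.
    by rewrite lee_fin; near: m.
  apply: le_trans (HU eps m e0 e1 m0) _.
  by rewrite lee_fin; near: m.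
have fin : \forall m \near \oo, E m \is a fin_num.
  have := main 1 ltr01; apply: filterS => m /andP[a b].
  by rewrite fin_numE; case: (E m) a b.
apply/fine_cvgP; split => //.
apply/cvgrPdist_le => dl dl0; have H := main dl dl0.
near=> m; have fm : E m \is a fin_num by near: m.
have /andP[] : ((c - dl)%:E <= E m <= (c + dl)%:E)%E by near: m; exact: H.
rewrite -[E m](fineK fm) !lee_fin /= => a b.
by rewrite ler_distlC; apply/andP; split; rewrite // ?lerBlDr -?lerBlDr.
Unshelve. all: by end_near. Qed.

End limits.

(** * Uniform points in the disc *)

Section uniform_points.
Context {R : realType}.
Local Notation C := (Cplx R).
Local Open Scope ring_scope.

Lemma continuous_Re : continuous (fun z : C => complex.Re z : R).
Proof.
move=> z; apply: (iffRL (@cvgrPdist_lt _ _ _ (nbhs z) _ _ _)) => e e0.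
exists (e%:C)%C; first by rewrite /= ltcR.
move=> w /=; rewrite Cplx_normE ltcR; apply: le_lt_trans.
by case: z w => a b [a' b']; rewrite /= -sqrtr_sqr ler_sqrt ?addr_ge0 ?sqr_ge0// lerDl sqr_ge0.
Qed.

Lemma continuous_Im : continuous (fun z : C => complex.Im z : R).
Proof.
move=> z; apply: (iffRL (@cvgrPdist_lt _ _ _ (nbhs z) _ _ _)) => e e0.
exists (e%:C)%C; first by rewrite /= ltcR.
move=> w /=; rewrite Cplx_normE ltcR; apply: le_lt_trans.
by case: z w => a b [a' b']; rewrite /= -sqrtr_sqr ler_sqrt ?addr_ge0 ?sqr_ge0// lerDr sqr_ge0.
Qed.

Lemma measurable_continuous_borelC (f : C -> R) : continuous f ->
  measurable_fun setT (f : borelC R -> R).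
Proof.
move=> cf; apply: (measurability _ (RGenOInfty.measurableE R)) => //.
move=> /= _ [_ [x ->] <-]; rewrite setTI; apply: sub_sigma_algebra.
by apply: (continuousP _).1 => //; exact: interval_open.
Qed.

Lemma measurable_pt : measurable_fun setT (@pt R : borelC R -> plane R).
Proof.
apply: measurable_fun_pair; apply: measurable_continuous_borelC.
  exact: continuous_Re.
exact: continuous_Im.
Qed.

Lemma area_pt (A : set (plane R)) :
  area ((@pt R @^-1` A) `&` @unit_disc R) = leb2 (A `&` [set p | sqn p < 1]).
Proof.
rewrite /area; congr (_ _); apply/seteqP; split => -[a b] /= [Aab]; rewrite /unit_disc/=.
  rewrite Cplx_normE -[X in _ < X]/((1 : R)%:C)%C ltcR /= => H; split => //.
  rewrite -[sqn _]sqr_sqrtr ?sqn_ge0// exprn_ilt1 ?sqrtr_ge0//.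
move=> H; split => //; rewrite Cplx_normE -[X in _ < X]/((1 : R)%:C)%C ltcR /=.
by have := nrm_lt1 H.
Qed.

End uniform_points.

(* X k stands for X_{k+1}. *)
Theorem theorem1p2 (R : realType) (d : measure_display) (T : measurableType d)
    (P : probability T R) (X : nat -> {RV P >-> borelC R})
    (X_indep : mutually_independent X)
    (X_unif : forall k, uniformly_distributed_on (X k) (@unit_disc R)) :
  (\int[P]_w num_components R
     (lemniscate (root_poly (fun k => X k w : Cplx R) n)) /
     (Num.sqrt (n%:R : R))%:E) @[n --> \oo] -->
  (Num.sqrt ((zeta (2 : R) - 1) / pi))%:E.
Proof.
pose Y k w : plane R := pt (X k w : Cplx R).
have mY k : measurable_fun setT (Y k).
  by apply: (measurableT_comp (@measurable_pt R)); exact: measurable_funPT.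
pose Y0 : {mfun T >-> plane R} := HB.pack (Y 0%N) (isMeasurableFun.Build _ _ _ _ _ (mY 0%N)).
pose mu : probability (plane R) R := distribution P Y0.
have mpt A : measurable A -> measurable (@pt R @^-1` A : set (borelC R)).
  by move=> mA; rewrite -[X in measurable X]setTI; exact: (measurable_pt measurableT mA).
pose a : \bar R := area (@unit_disc R).
have lawE k (A : set (plane R)) : measurable A ->
    P (Y k @^-1` A) = leb2 (A `&` [set p | (sqn p < 1)%R]) / a.
  by move=> mA; have := X_unif k _ (@mpt A mA); rewrite area_pt.
have Y_law k A : measurable A -> P (Y k @^-1` A) = mu A.
  by move=> mA; rewrite lawE// -(lawE 0%N).
have Y_indep (J : {fset nat}) (A : nat -> set (plane R)) :
    (forall k, k \in J -> measurable (A k)) ->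
    P (\bigcap_(k in [set` J]) (Y k @^-1` A k)) = \big[*%E/1]_(k <- J) P (Y k @^-1` A k).
  by move=> mA; apply: (X_indep J (fun k => @pt R @^-1` A k)) => k kJ; by apply: mpt; exact: mA.
have mu_disc : disc_law mu.
  have aE : a = leb2 [set p : plane R | (sqn p < 1)%R].
    by rewrite /a -[unit_disc (R:=R)]setTI -[X in X `&` _](preimage_setT (@pt R)) area_pt setTI.
  have a1 : a / a = 1.
    have := lawE 0%N setT measurableT.
    by rewrite setTI -aE preimage_setT probability_setT.
  have a0 : 0 <= a by rewrite aE measure_ge0.
  (* The area of the disc is neither zero nor infinite, because the law has
     mass one. *)
  have [c c0 ac] : exists2 c : R, (0 < c)%R & a = c%:E.
    case: (a) a0 a1 => [c|_|//].
      rewrite lee_fin le_eqVlt => /predU1P[<-|c0 _]; last by exists c.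
      by rewrite inve0 mul0e => -[/eqP]; rewrite eq_sym oner_eq0.
    by rewrite invey mule0 => -[/eqP]; rewrite eq_sym oner_eq0.
  exists c; first exact: c0.
  by move=> A mA; rewrite -(Y_law 0%N _ mA) (lawE _ _ mA) ac inver (gt_eqF c0) muleC.
pose comp n w := num_components R (lemniscate (root_poly (fun k => X k w : Cplx R) n)).
pose E m : \bar R := \int[P]_w comp m.+1 w / (Num.sqrt (m.+1%:R : R))%:E.
pose sigma : R := Num.sqrt ((zeta (2 : R) - 1) / 2).
have sn0 m : (0 < Num.sqrt (m.+1%:R : R))%R by rewrite sqrtr_gt0 ltr0n.
have EE m : E m = \int[P]_w comp m.+1 w * ((Num.sqrt (m.+1%:R : R))^-1)%:E.
  by rewrite /E inver gt_eqF.
have isn0 m : 0 <= ((Num.sqrt (m.+1%:R : R))^-1)%:E by rewrite lee_fin invr_ge0 ltW.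
have z0 : (0 <= (zeta (2 : R) - 1) / 2)%R.
  have e1 : sqn ((1, 0)%R : plane R) = 1%R by rewrite /sqn/= expr1n expr0n/= addr0.
  have <- : (\int[mu]_p (ln (dst (1, 0) p) ^+ 2))%R = ((zeta (2 : R) - 1) / 2)%R.
    by apply: Rintegral_ln_dst_sqr; rewrite ?e1.
  by apply: Rintegral_ge0 => p _; exact: sqr_ge0.
have cE : Num.sqrt ((zeta (2 : R) - 1) / pi) = (sigma * Num.sqrt (2 / pi))%R.
  rewrite -sqrtrM//; congr Num.sqrt; have := pi_gt0 R; move: (pi : R) => p p0.
  by field; rewrite gt_eqF.
rewrite -(cvg_shiftS (fun n => \int[P]_w comp n w / (Num.sqrt (n%:R : R))%:E)) cE.
apply: (@expected_components_limit R sigma (sqrtr_ge0 _) E).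
  move=> eps m e0 e1 m0; rewrite EE.
  have H := expected_components_le mu_disc mY Y_law Y_indep e0 e1 m0.
  apply: le_trans (lee_wpmul2r (isn0 m) H) _; rewrite -EFinM lee_fin.
  exact: upper_normalised.
move=> eps m e0 m0 vm; rewrite EE.
have H := expected_components_ge mu_disc mY Y_law Y_indep e0 m0 vm.
apply: le_trans (lee_wpmul2r (isn0 m) H); rewrite -EFinM lee_fin.
exact: lower_normalised.
Qed.
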